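(* Let $Q(X_0,\dots,X_n)$ be a quadratic form with integer coefficients which is equivalent over $\mathbb{Q}$ to a non-zero multiple of $X_0X_1-(X_2^2-dX_4^2)$ for some integer $d$ that is not a square. Let $F_1,\dots,F_r\in\mathbb{Z}[X_0,\dots,X_n]$ be forms, and assume that the variety $Z\subset\mathbb{P}^n$ defined by $Q=F_1=\dots=F_r=0$ has codimension at least $3$ in $\mathbb{P}^n$. For $B\ge1$ and $M>1$ let $N(B,M)$ be the number of vectors $\mathbf{x}\in\mathbb{Z}^{n+1}$ with $Q(\mathbf{x})=0$ and $|\mathbf{x}|\le B$, such that $F_1(\mathbf{x}),\dots,F_r(\mathbf{x})$ have a common prime divisor $p>M$. Then for every fixed $\varepsilon>0$, $$N(B,M)\ll_{\varepsilon,Q,F_1,\dots,F_r}\frac{B^{n-1+\varepsilon}}{M\log M}+B^{n-3/2+\varepsilon}.$$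
   Context: $|\mathbf{x}|$ denotes the supremum norm $\max_i|x_i|$. The notation $A\ll_{\dots}C$ means $|A|\le kC$ for a constant $k$ depending only on the indicated quantities. *)

(* Defs.v *)
From mathcomp Require Import all_boot all_order all_algebra all_field.
From mathcomp Require Import finmap mpoly.
From mathcomp Require Import zify.
From mathcomp Require Import boolp classical_sets functions cardinality.
From mathcomp Require Import reals exp.

Set Implicit Arguments.
Unset Strict Implicit.
Unset Printing Implicit Defensive.

Import Order.TTheory GRing.Theory Num.Theory.

Local Open Scope classical_set_scope.
Local Open Scope ring_scope.

Definition is_form (R : nzRingType) (m : nat) (f : {mpoly R[m]}) : Prop :=
  exists d : nat, f \is d.-homog.

(* The Zariski topology on P^n over K.  A subset of P^n is represented by the
   set of all its homogeneous coordinate vectors, a set of nonzero vectors of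
   K^(n+1) stable under nonzero scaling. *)
Section Projective.
Variables (K : fieldType) (n : nat).

Definition proj_zeros (S : set {mpoly K[n.+1]}) : set 'rV[K]_n.+1 :=
  [set v : 'rV[K]_n.+1 | v != 0 /\ forall f, S f -> f.@[v 0] = 0].

Definition proj_closed (Y : set 'rV[K]_n.+1) : Prop :=
  exists2 S : set {mpoly K[n.+1]}, S `<=` @is_form K n.+1 & Y = proj_zeros S.

Definition proj_irreducible (Y : set 'rV[K]_n.+1) : Prop :=
  [/\ proj_closed Y, Y !=set0 &
      forall Y1 Y2 : set 'rV[K]_n.+1, proj_closed Y1 -> proj_closed Y2 ->
        Y = Y1 `|` Y2 -> Y = Y1 \/ Y = Y2].

(* For Y irreducible closed, codim(Y, P^n) is the supremum of the lengths c of
   the chains Y = C_0 < C_1 < ... < C_c of irreducible closed subsets of P^n;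
   for Z closed, codim(Z, P^n) is the infimum of codim(Y, P^n) over the
   irreducible closed Y contained in Z (hence +oo if Z is empty). *)
Definition proj_codim_ge (c : nat) (Z : set 'rV[K]_n.+1) : Prop :=
  forall Y : set 'rV[K]_n.+1, proj_irreducible Y -> Y `<=` Z ->
    exists C : nat -> set 'rV[K]_n.+1,
      [/\ C 0%N = Y,
          forall i : nat, (i <= c)%N -> proj_irreducible (C i) &
          forall i : nat, (i < c)%N -> C i `<` C i.+1].

End Projective.

(* Geometric points, i.e. points over the algebraic closure of the rationals,
   of the variety Q = F_1 = ... = F_r = 0. *)
Definition variety (n r : nat) (Q : {mpoly int[n.+1]})
    (F : 'I_r -> {mpoly int[n.+1]}) : set 'rV[algC]_n.+1 :=
  let toC := map_mpoly (intr : int -> algC) in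
  proj_zeros [set f | f = toC Q \/ exists i : 'I_r, f = toC (F i)].

Definition lin_subst (m : nat) (A : 'M[rat]_m) (f : {mpoly rat[m]}) :
    {mpoly rat[m]} :=
  f \mPo [tuple \sum_(j < m) A i j *: 'X_j | i < m].

Definition equiv_over_rat (m : nat) (f g : {mpoly rat[m]}) : Prop :=
  exists2 A : 'M[rat]_m, A \in unitmx & lin_subst A f = g.

(* Meaningful only for n >= 3: inord k is the variable of index k then. *)
Definition model_form (n : nat) (d : int) : {mpoly rat[n.+1]} :=
  'X_(inord 0) * 'X_(inord 1)
  - ('X_(inord 2) ^+ 2 - d%:~R *: 'X_(inord 3) ^+ 2).

Definition supnorm (m : nat) (x : 'rV[int]_m) : nat :=
  \max_(i < m) `|(x 0 i)%R|%N.

Section Counting.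
Variables (R : realType) (n r : nat).
Variables (Q : {mpoly int[n.+1]}) (F : 'I_r -> {mpoly int[n.+1]}).

Definition sieve_set (B M : R) : set 'rV[int]_n.+1 :=
  [set x : 'rV[int]_n.+1 | [/\ Q.@[x 0] = 0, (supnorm x)%:R <= B &
     exists p : nat, [/\ prime p, M < p%:R &
       forall i : 'I_r, (p%:Z %| ((F i).@[x 0])%R)%Z]]].

Lemma finite_sieve_set (B M : R) : finite_set (sieve_set B M).
Proof.
pose b := Num.truncn B.
pose D := {ffun 'I_n.+1 -> 'I_(b + b).+1}.
pose g (f : D) : 'rV[int]_n.+1 := \row_i ((f i)%:Z - b%:Z).
apply: (@sub_finite_set _ _ (g @` [set: D])); last first.
  by apply: finite_image; exact: finite_finset.
move=> x [_ xB _].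
have xb i : (`|(x 0 i)%R| <= b)%N.
  apply: leq_trans (_ : supnorm x <= b)%N; first exact: (leq_bigmax i).
  by rewrite /b truncn_ge_nat // (le_trans _ xB).
exists [ffun i => inord `|(x 0 i + b%:Z)%R|] => //.
apply/rowP => i; rewrite mxE ffunE inordK; last first.
  by rewrite ltnS; move: (xb i); lia.
by move: (xb i); lia.
Qed.

(* The set is finite by finite_sieve_set, so fset_set is not degenerate. *)
Definition sieve_count (B M : R) : nat := #|` fset_set (sieve_set B M)|%fset.

End Counting.

(* Main.v *)
Require Import Defs.
From mathcomp Require Import all_boot all_order all_algebra all_field.
From mathcomp Require Import finmap mpoly.
From mathcomp Require Import boolp classical_sets functions cardinality.
From mathcomp Require Import reals exp.
From mathcomp Require Import zify ring lra.

Set Implicit Arguments.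
Unset Strict Implicit.
Unset Printing Implicit Defensive.

Import Order.TTheory GRing.Theory Num.Theory.

Local Open Scope ring_scope.

(* After an integral linear change of variables Q becomes a multiple of
   y0 y1 - N(w), where N(u, v) = u^2 - d v^2 and w = (y2, y3), and some form
   does not vanish at the apex (0, 1, 0, ...).  Let c be the gcd of w; points
   with p | c or y0 y1 = 0 are few.  For the others Thue's lemma provides e <> 0 with
   |e| <= sqrt B, |c e| << B, N(e) small relative to y0 / gcd(y0, c^2), and w / c
   parallel to e modulo that number.  With (c, e, y0) and the outer data
   t = det(w, e), y4, ..., yn fixed, y moves on an integral parabola y(i), on
   which a form not vanishing at the apex has leading coefficient prime to p;
   so p leaves O(1 + B / (c |e| M)) values of i.  If p divides all forms at
   y(i), it divides the resultant in i of two combinations of them.  Since the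
   codimension is at least 3, the n - 1 outer polynomials y0, t, y4, ..., yn
   are algebraically dependent on the cone over Z for fixed e, so some such
   resultant is not identically zero: it has few zeros, and elsewhere only
   O(B^eps) primes p remain.  Summing over (c, e, y0) and the outer data gives
   B^(n-1+eps) / M + B^(n-3/2+eps); replacing M by min(M, B) and using
   log M << B^eps when M <= B yields the factor 1 / log M. *)

(** * Codimension and algebraic dependence *)

(** For a fixed key (c, e, y0) put X = B / (c |e|), which is bounded below. Up to constants X is the
    number of points on one parabola, and also the number of values of t, since t << B |e| is a
    multiple of c y0 / gcd(y0, c^2), which is at least c |e|^2. Hence there are about B^(n-3) X
    outer data. Where the resultant vanishes nothing is saved along the parabola, but one free
    coordinate is lost: B^(n-3) (X + X^2 / B) points. Elsewhere each of the B^eps primes leaves X /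
    M + 1 points, in all B^(n-3) (X^2 / M + X). Summed over c and |e| <= sqrt B, the term X gives
    B^(3/2), the origin of the exponent n - 3/2, and X^2 / M gives B^2 / M. The obstacle is the
    leading coefficient c^2 N(e) / y0 of the parabola: a primitive vector along w could make it
    divisible by p. For Thue's e it is c^2 / gcd(y0, c^2) times an integer of size at most 1 + |d|,
    so a prime p > 1 + |d| not dividing c is harmless; it is nonzero because N has no nontrivial
    zero when d is not a square. All these parabolas pass through the apex at infinity, so one form
    nonzero there serves them all. *)

(** Every tail attains its minimum. Jumping to an index where it does, then to such an index for the
    tail strictly after it, gives the subsequence. *)
Lemma nondecr_subseq (f : nat -> nat) :
  exists2 phi : nat -> nat, {homo phi : i j / (i < j)%N} &
    {homo f \o phi : i j / (i <= j)%N}.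
Proof.
have ex_min k : exists j, (k <= j)%N /\ forall i, (k <= i)%N -> (f j <= f i)%N.
  pose P m := `[< exists2 j, (k <= j)%N & f j = m >].
  have exP : exists m, P m by exists (f k); apply/asboolP; exists k.
  case: (ex_minnP exP) => m /asboolP[j kj <-] mmin.
  by exists j; split=> // i ki; apply: mmin; apply/asboolP; exists i.
pose g k := projT1 (cid (ex_min k)).
have gP k : (k <= g k)%N /\ forall i, (k <= i)%N -> (f (g k) <= f i)%N.
  exact: projT2 (cid (ex_min k)).
pose phi := fix phi i := if i is i'.+1 then g (phi i').+1 else g 0%N.
have phiS i : (phi i < phi i.+1)%N by have [] := gP (phi i).+1.
exists phi.
  exact: (homo_ltn ltn_trans).
apply: (homo_leq leqnn leq_trans) => i /=; case: i => [|i] /=.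
  by case: (gP 0%N) => _; apply.
case: (gP (phi i).+1) => le1 + ; apply.
by apply: leq_trans le1 _; exact: ltnW (phiS i.+1).
Qed.

(** The sequence is thinned out one coordinate at a time until every exponent is nondecreasing. *)
Lemma dickson (n : nat) (m : nat -> 'X_{1..n}) :
  exists i j, (i < j)%N /\ (m i <= m j)%MM.
Proof.
suff [phi phi_inc phiP] : exists2 phi : nat -> nat,
    {homo phi : i j / (i < j)%N} &
    forall a i j, a \in enum 'I_n -> (i <= j)%N -> (m (phi i) a <= m (phi j) a)%N.
  exists (phi 0%N), (phi 1%N); split; first exact: phi_inc.
  by apply/mnm_lepP => a; apply: phiP => //; rewrite mem_enum.
elim: (enum 'I_n) => [|a s [phi phi_inc phiP]]; first by exists id.
have [psi psi_inc psiP] := nondecr_subseq (fun i => m (phi i) a).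
exists (phi \o psi) => [i j ij|b i j]; first exact/phi_inc/psi_inc.
rewrite inE => /orP[/eqP-> | bs] ij; first exact: psiP.
by apply: phiP => //; move: ij; exact: (ltnW_homo psi_inc).
Qed.

Section Projective.
Variables (K : numFieldType) (n : nat).
Implicit Types (Y C Z : set 'rV[K]_n.+1) (f g u : {mpoly K[n.+1]}).

Definition vanishes Y f := forall v, Y v -> f.@[v 0] = 0.

Lemma meval_homog_scale (R : comNzRingType) (m d : nat) (f : {mpoly R[m]})
    (t : R) (v : 'I_m -> R) :
  f \is d.-homog -> f.@[fun i => t * v i] = t ^+ d * f.@[v].
Proof.
move=> /dhomogP hf; rewrite !mevalE mulr_sumr big_seq [RHS]big_seq.
apply: eq_bigr => a /hf da; rewrite mulrCA; congr (_ * _).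
under eq_bigr do rewrite exprMn.
have {da}<- : mdeg a = d by [].
rewrite big_split /= mdegE; congr (_ * _).
by rewrite (big_morph _ (exprD t) (expr0 t)).
Qed.

Lemma proj_closed_scale Y (t : K) v : proj_closed Y -> t != 0 -> Y v -> Y (t *: v).
Proof.
move=> [S Shom ->] t0 [v0 vS]; split; first by rewrite scaler_eq0 negb_or t0.
move=> f Sf; have [d hd] := Shom f Sf.
have -> : f.@[(t *: v) 0] = f.@[fun i => t * v 0 i].
  by apply: meval_eq => i; rewrite mxE.
by rewrite (meval_homog_scale _ _ hd) vS // mulr0.
Qed.

(** As [f] and [g] need not be forms, their zeros in [Y] need not form closed sets; [D u] is the
    closed part of [Y] where all homogeneous components of [u] vanish. The polynomial [U u v] is t
    -> u(t v). For [v] in [Y] the product of those of [f] and [g] vanishes at every positive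
    integer, so one of them is zero and [v] lies in [D f] or [D g]. *)
Lemma proj_irreducible_prime Y f g : proj_irreducible Y ->
  vanishes Y (f * g) -> vanishes Y f \/ vanishes Y g.
Proof.
move=> [Yc _ Yirr] fg0.
pose D u : set 'rV[K]_n.+1 :=
  [set v | Y v /\ forall d, (pihomog mdeg d u).@[v 0] = 0]%classic.
have Dc u : proj_closed (D u).
  have [S Shom eY] := Yc.
  exists (S `|` [set w | exists d, w = pihomog mdeg d u])%classic.
    by move=> w [/Shom //|[d ->]]; exists d; exact: pihomogP.
  rewrite /D eY; apply/seteqP; split=> v /=.
    by move=> [[v0 vS] hd]; split=> // w [/vS //|[d ->]].
  move=> [v0 vS]; split; last by move=> d; apply: vS; right; exists d.
  by split=> // w Sw; apply: vS; left.
have Dv u : Y = D u -> vanishes Y u.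
  move=> eY v; rewrite eY => -[_ h].
  rewrite (pihomog_partitionE (mf := mdeg) (p := u) (leqnn _)) raddf_sum /=.
  by rewrite big1 // => i _; exact: h.
pose U u (v : 'rV[K]_n.+1) : {poly K} :=
  \poly_(i < mmeasure mdeg u) (pihomog mdeg i u).@[v 0].
have UE u v t : (U u v).[t] = u.@[(t *: v) 0].
  rewrite horner_poly [in RHS](pihomog_partitionE (mf := mdeg) (p := u) (leqnn _)).
  rewrite raddf_sum /=; apply: eq_bigr => i _.
  rewrite mulrC -(meval_homog_scale _ _ (pihomogP _ _ _)).
  by apply: meval_eq => j; rewrite mxE.
have U0 u v : Y v -> U u v = 0 -> D u v.
  move=> Yv u0; split=> // d; have [du|ud] := ltnP d (mmeasure mdeg u).
    by have := congr1 (fun p : {poly K} => p`_d) u0; rewrite coef_poly du coef0.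
  rewrite pihomogE big_seq_cond big1 ?raddf0 // => a /andP[/mmeasure_mnm_lt aD /eqP ad].
  have : (mdeg a < d)%N := leq_trans (aD mdeg) ud.
  by have -> : mdeg a = d := ad; rewrite ltnn.
have [] := Yirr (D f) (D g) (Dc f) (Dc g); last 2 first.
- by move=> /Dv; left.
- by move=> /Dv; right.
apply/seteqP; split=> v; last by move=> [] [].
move=> Yv.
have /eqP : U f v * U g v = 0.
  apply/eqP; apply: contraT => nz.
  have := max_poly_roots (p := U f v * U g v)
    (rs := [seq i.+1%:R | i <- iota 0 (size (U f v * U g v)%R)]) nz.
  rewrite size_map size_iota ltnn; apply.
    apply/allP => _ /mapP[i _ ->]; apply/rootP.
    by rewrite hornerM !UE -mevalM fg0 //; apply: proj_closed_scale => //; rewrite pnatr_eq0.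
  rewrite map_inj_uniq ?iota_uniq // => i j /eqP.
  by rewrite eqr_nat => /eqP[].
by rewrite mulf_eq0 => /orP[]/eqP/(U0 _ _ Yv); [left|right].
Qed.

Lemma mlead_cancel f g : f != 0 -> mlead f = mlead g -> mleadc f = mleadc g ->
  f - g != 0 -> (mlead (f - g) < mlead f)%O.
Proof.
move=> f0 em ec fg0; rewrite lt_neqAle; apply/andP; split.
  apply: contra fg0 => /eqP e; rewrite -mleadc_eq0 e mcoeffB ec em subrr //.
by have := mleadB_le f g; rewrite -em joinxx.
Qed.

(** A Groebner argument: to each strict inclusion attach the least leading monomial of a polynomial
    vanishing on [Y k.+1] but not on [Y k]. By Dickson the i-th monomial divides the j-th for some i
    < j. A monomial multiple of [fi] vanishes on [Y j], so subtracting it from [fj] cancels the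
    leading term and keeps the vanishing properties, against minimality. *)
Lemma proj_noetherian (Y : nat -> set 'rV[K]_n.+1) :
  (forall k, proj_closed (Y k)) -> ~ (forall k, (Y k.+1 `<` Y k)%classic).
Proof.
move=> Yc Ydec.
have Ymono i j : (i <= j)%N -> (Y j `<=` Y i)%classic.
  move=> ij; rewrite -(subnK ij); elim: (j - i)%N => [|k ih] //.
  by apply: subset_trans ih; rewrite addSn; exact: properW (Ydec _).
pose T k (m : 'X_{1..n.+1}) := exists2 f, mlead f = m &
   vanishes (Y k.+1) f /\ ~ vanishes (Y k) f.
have exT k : exists m, T k m.
  have [_ nle] := Ydec k.
  have [S Shom eY] := Yc k.+1; apply: contrapT => noT; apply: nle.
  move=> v Yv; rewrite eY; split.
    by have [S' _ eY'] := Yc k; move: Yv; rewrite eY' => -[].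
  move=> f Sf; apply: contrapT => fv; apply: noT; exists (mlead f), f => //.
  split; first by move=> w; rewrite eY => -[_]; exact.
  by move=> /(_ v Yv).
have exmin k : exists m, T k m /\ forall m', T k m' -> ~ (m' < m)%O.
  have [m Tm] := exT k; move: m Tm; apply: ltmwf => m ih Tm.
  have [[m' [Tm' lt]]|no] := pselect (exists m', T k m' /\ (m' < m)%O).
    exact: ih lt Tm'.
  by exists m; split=> // m' Tm' lt; apply: no; exists m'.
have [m mP] := choice exmin.
have [i [j [ij mij]]] := dickson m.
have [[fi ei [fi1 fi2]] _] := mP i.
have [[fj ej [fj1 fj2]] jmin] := mP j.
have nz f k : ~ vanishes (Y k) f -> f != 0.
  by apply: contra_notN => /eqP-> v _; exact: meval0.
have fi0 := nz _ _ fi2; have fj0 := nz _ _ fj2.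
pose c := mleadc fj / mleadc fi.
pose h := c *: 'X_[m j - m i] * fi.
have c0 : c != 0 by rewrite mulf_neq0 ?invr_eq0 ?mleadc_eq0.
have Xn0 : c *: 'X_[m j - m i] != 0 :> {mpoly K[n.+1]}.
  by rewrite -mleadc_eq0 mleadZ // mleadXm mcoeffZ mcoeffX eqxx mulr1.
have eh : mlead fj = mlead h.
  by rewrite /h mleadM // mleadZ // mleadXm ei ej submK.
have ech : mleadc fj = mleadc h.
  rewrite /h mleadM // mleadcM mleadZ // mleadXm mcoeffZ mcoeffX eqxx mulr1.
  by rewrite /c divfK // mleadc_eq0.
have hv k : (i < k)%N -> vanishes (Y k) h.
  move=> ik v Yv; rewrite /h mevalM [X in _ * X]fi1 ?mulr0 //.
  exact: (Ymono i.+1 k).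
have nv : ~ vanishes (Y j) (fj - h).
  move=> h0; apply: fj2 => v Yv; have := h0 v Yv.
  by rewrite mevalB (hv j) // subr0.
apply: (jmin (mlead (fj - h))); last first.
  by rewrite -ej; apply: mlead_cancel => //; exact: nz nv.
exists (fj - h) => //; split=> // v Yv.
by rewrite mevalB fj1 // (hv j.+1) ?subr0 // ltnS ltnW.
Qed.

Lemma proj_minimal_closed (Phi : set 'rV[K]_n.+1 -> Prop) Z :
  proj_closed Z -> Phi Z ->
  exists Y, [/\ proj_closed Y, (Y `<=` Z)%classic, Phi Y &
    forall Y', proj_closed Y' -> (Y' `<` Y)%classic -> ~ Phi Y'].
Proof.
move=> Zc PZ; apply: contrapT => no.
pose T := {Y | [/\ proj_closed Y, (Y `<=` Z)%classic & Phi Y]}.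
have step (Y : T) : exists Y' : T, (sval Y' `<` sval Y)%classic.
  apply: contrapT => noY; apply: no; exists (sval Y).
  case: Y noY => Y [Yc YZ PY] /= noY; split=> // Y' Y'c Y'Y PY'.
  apply: noY; have Y'P : [/\ proj_closed Y', (Y' `<=` Z)%classic & Phi Y'].
    by split=> //; apply: subset_trans YZ; exact: properW.
  by exists (exist _ Y' Y'P).
have [F FP] := choice step.
have ZP : [/\ proj_closed Z, (Z `<=` Z)%classic & Phi Z] by split.
pose Y k := sval (iter k F (exist _ Z ZP)).
apply: (@proj_noetherian Y) => k; last exact: FP.
by rewrite /Y; case: (iter k F _) => ? [].
Qed.

Definition lin_indep Y (J : finType) (u : J -> {mpoly K[n.+1]}) :=
  forall c : J -> K, vanishes Y (\sum_j c j *: u j) -> forall j, c j = 0.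

(** Restricting a relation to [C] kills all terms containing [g], so the coefficients of exponent 0
    vanish. What remains is [g] times a shorter relation, and [g] cancels because the ideal of the
    irreducible [C'] is prime. *)
Lemma lin_indep_ext C C' (J : finType) (u : J -> {mpoly K[n.+1]}) g (T : nat) :
  proj_irreducible C' -> (C `<=` C')%classic ->
  lin_indep C u -> vanishes C g -> ~ vanishes C' g ->
  lin_indep C' (fun jb : J * 'I_T => u jb.1 * g ^+ jb.2).
Proof.
move=> irr CC' ind gC gC'; elim: T => [|T ih] c; first by move=> _ [j []].
have -> : \sum_jb c jb *: (u jb.1 * g ^+ jb.2) =
   (\sum_j c (j, ord0) *: u j) +
   g * \sum_(jb : J * 'I_T) c (jb.1, lift ord0 jb.2) *: (u jb.1 * g ^+ jb.2).
  transitivity (\sum_j \sum_(b < T.+1) c (j, b) *: (u j * g ^+ b)).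
    by rewrite pair_bigA /=; apply: eq_bigr => -[].
  under eq_bigr do rewrite big_ord_recl expr0 mulr1.
  rewrite big_split /=; congr (_ + _).
  rewrite -(pair_bigA _ (fun j (b : 'I_T) => c (j, lift ord0 b) *: (u j * g ^+ b))) /=.
  rewrite mulr_sumr; apply: eq_bigr => j _; rewrite mulr_sumr.
  apply: eq_bigr => b _; rewrite exprS -scalerAr.
  by congr (_ *: _); rewrite mulrCA.
move=> h.
have c0 : forall j, c (j, ord0) = 0.
  apply: ind => v Cv; have := h v (CC' _ Cv).
  by rewrite mevalD mevalM gC // mul0r addr0.
have h' : vanishes C' (g * \sum_(jb : J * 'I_T)
    c (jb.1, lift ord0 jb.2) *: (u jb.1 * g ^+ jb.2)).
  by move=> v Cv; have := h v Cv; rewrite big1 ?add0r // => j _; rewrite c0 scale0r.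
have [//|h''] := proj_irreducible_prime irr h'.
have c1 := ih _ h''.
case=> j b; case: (unliftP ord0 b) => [b' ->|-> //].
exact: (c1 (j, b')).
Qed.

End Projective.

Section Dimension.
Variables (K : numFieldType) (n : nat).

(** All [u j] are combinations of the [s ^ n.+1] monomials with exponents below [s], so more of them
    would be dependent even before restriction to [Y]. *)
Lemma lin_indep_card (Y : set 'rV[K]_n.+1) (J : finType)
    (u : J -> {mpoly K[n.+1]}) (s : nat) :
  lin_indep Y u -> (forall j, (msize (u j) <= s)%N) -> (#|J| <= s ^ n.+1)%N.
Proof.
move=> ind us; pose E := {ffun 'I_n.+1 -> 'I_s}.
have cE : #|E| = (s ^ n.+1)%N by rewrite card_ffun !card_ord.
pose mon (a : E) : 'X_{1..n.+1} := [multinom (a i : nat) | i < n.+1].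
pose A : 'M[K]_(#|J|, #|E|) := \matrix_(i, k) (u (enum_val i))@_(mon (enum_val k)).
rewrite -cE; apply: leq_trans (rank_leq_col A); rewrite leqNgt; apply/negP => rA.
have /rowV0Pn[c /sub_kermxP cA c0] : kermx A != 0.
  by rewrite kermx_eq0 /row_free neq_ltn rA.
case/negP: c0; apply/eqP/rowP => i; rewrite !mxE.
have uE : \sum_j c 0 (enum_rank j) *: u j = 0.
  apply/mpolyP => m; rewrite mcoeff0 raddf_sum /=.
  have [small|/forallPn[a ma]] := boolP [forall a, (m a < s)%N].
    pose e : E := [ffun a => Ordinal (forallP small a)].
    have em : mon e = m by apply/mnmP => a; rewrite mnmE ffunE.
    have := congr1 (fun M : 'rV[K]_#|E| => M 0 (enum_rank e)) cA.
    rewrite mxE mxE => e0; rewrite -[RHS]e0.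
    rewrite (reindex_onto (@enum_val J predT) enum_rank) /=; last first.
      by move=> j _; exact: enum_rankK.
    apply: eq_big => [k|k _]; first by rewrite enum_valK eqxx.
    by rewrite mcoeffZ enum_valK mxE enum_rankK em.
  rewrite big1 // => j _; rewrite mcoeffZ.
  suff -> : (u j)@_m = 0 by rewrite mulr0.
  apply/memN_msupp_eq0/msize_mdeg_ge; apply: leq_trans (us j) _.
  rewrite -leqNgt in ma; apply: leq_trans ma _.
  by rewrite mdegE (bigD1 a) //= leq_addr.
rewrite -[i in LHS]enum_valK; apply: (ind (fun j => c 0 (enum_rank j))).
by move=> v _; rewrite uE meval0.
Qed.

Lemma msizeM_leD (R : idomainType) (m : nat) (p q : {mpoly R[m]}) :
  (msize (p * q) <= msize p + msize q)%N.
Proof.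
have [->|p0] := eqVneq p 0; first by rewrite mul0r msize0.
have [->|q0] := eqVneq q 0; first by rewrite mulr0 msize0.
by rewrite msizeM // leq_pred.
Qed.

Lemma msizeXn_le (R : idomainType) (m : nat) (p : {mpoly R[m]}) (k : nat) :
  (msize (p ^+ k) <= k * msize p + 1)%N.
Proof.
elim: k => [|k ih]; first by rewrite expr0 msize1.
by rewrite exprS; apply: leq_trans (msizeM_leD _ _) _; lia.
Qed.

Lemma msize_prod_le (R : idomainType) (m k s : nat) (p : 'I_k -> {mpoly R[m]}) :
  (forall i, (msize (p i) <= s)%N) -> (msize (\prod_i p i) <= k * s + 1)%N.
Proof.
move=> ps; elim: k p ps => [|k ih] p ps; first by rewrite big_ord0 msize1.
rewrite big_ord_recl; apply: leq_trans (msizeM_leD _ _) _.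
apply: leq_trans (leq_add (ps ord0) (ih _ (fun i => ps (lift ord0 i)))) _.
by rewrite mulSn addnA.
Qed.

Definition monomial_family (k T : nat) (l : 'I_k -> {mpoly K[n.+1]})
  (a : {ffun 'I_k -> 'I_T}) : {mpoly K[n.+1]} := \prod_i l i ^+ a i.

Definition alg_indep (Y : set 'rV[K]_n.+1) (k : nat) (l : 'I_k -> {mpoly K[n.+1]}) :=
  forall P : {mpoly K[k]},
    (forall v, Y v -> P.@[fun i => (l i).@[v 0]] = 0) -> P = 0.

Lemma alg_indep_lin (Y : set 'rV[K]_n.+1) k T (l : 'I_k -> {mpoly K[n.+1]}) :
  alg_indep Y l -> lin_indep Y (@monomial_family k T l).
Proof.
move=> ind c h a0.
pose mon (a : {ffun 'I_k -> 'I_T}) : 'X_{1..k} := [multinom (a i : nat) | i < k].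
have mon_inj : injective mon.
  move=> a b /mnmP ab; apply/ffunP => i; apply: val_inj.
  by have := ab i; rewrite !mnmE.
pose P : {mpoly K[k]} := \sum_a c a *: 'X_[mon a].
have P0 : P = 0.
  apply: ind => v Yv; rewrite -[RHS](h v Yv) !raddf_sum /=.
  apply: eq_bigr => a _; rewrite !mevalZ mevalX; congr (_ * _).
  by rewrite rmorph_prod /=; apply: eq_bigr => i _; rewrite mnmE rmorphXn.
have := congr1 (mcoeff (mon a0)) P0; rewrite mcoeff0 raddf_sum /= => <-.
rewrite (bigD1 a0) //= mcoeffZ mcoeffX eqxx mulr1 big1 ?addr0 // => a aa0.
rewrite mcoeffZ mcoeffX; case: eqP => [/mon_inj e|]; last by rewrite mulr0.
by rewrite e eqxx in aa0.
Qed.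

Lemma proj_sub_vanish (C C' : set 'rV[K]_n.+1) :
  proj_closed C -> (C `<` C')%classic -> proj_closed C' ->
  exists2 g, vanishes C g & ~ vanishes C' g.
Proof.
move=> [S Shom eC] [CC' nle] [S' _ eC']; apply: contrapT => no; apply: nle => v Cv.
rewrite eC; split; first by move: Cv; rewrite eC' => -[].
move=> f Sf; apply: contrapT => fv; apply: no; exists f.
  by move=> w; rewrite eC => -[_]; exact.
by move=> /(_ v Cv).
Qed.

(* Otherwise take Y closed in Z and minimal with l algebraically independent on
   Y; it is irreducible.  Each step of a chain of length 3 above Y adds one
   algebraically independent function, which makes n + 2 independent
   polynomials in n + 1 variables. *)
Theorem codim3_alg_dep (Z : set 'rV[K]_n.+1) (l : 'I_n.-1 -> {mpoly K[n.+1]}) :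
  (0 < n)%N -> proj_closed Z -> proj_codim_ge 3 Z ->
  exists2 P : {mpoly K[n.-1]}, P != 0 &
    forall v, Z v -> P.@[fun i => (l i).@[v 0]] = 0.
Proof.
move=> n0 Zc codim; apply: contrapT => no.
have indZ : alg_indep Z l.
  move=> P PZ; apply/eqP; apply: contraT => P0; exfalso; apply: no.
  by exists P.
have [Y [Yc YZ indY Ymin]] :=
  proj_minimal_closed (Phi := fun Y => alg_indep Y l) Zc indZ.
have Yirr : proj_irreducible Y.
  split=> //.
    apply/set0P/eqP => Y0; have := indY 1; rewrite Y0 => h.
    by have /eqP := h (fun v => False_ind _); rewrite oner_eq0.
  (* By minimality each smaller closed part carries a nonzero relation between the [l i]; the
     product of two such relations holds on the union [Y]. *)
  move=> Y1 Y2 Y1c Y2c eY; apply: contrapT => /not_orP[n1 n2].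
  have dep Y' : proj_closed Y' -> (Y' `<=` Y)%classic -> Y <> Y' ->
      exists2 P : {mpoly K[n.-1]}, P != 0 &
        forall v, Y' v -> P.@[fun i => (l i).@[v 0]] = 0.
    move=> Y'c Y'Y neq; apply: contrapT => no'; apply: (Ymin Y') => //.
      by split=> // YY'; apply: neq; apply/seteqP; split.
    move=> P PZ; apply/eqP; apply: contraT => P0; exfalso; apply: no'.
    by exists P.
  have sub1 : (Y1 `<=` Y)%classic by move=> v Yv; rewrite eY; left.
  have sub2 : (Y2 `<=` Y)%classic by move=> v Yv; rewrite eY; right.
  have [P1 P10 PY1] := dep Y1 Y1c sub1 n1.
  have [P2 P20 PY2] := dep Y2 Y2c sub2 n2.
  have /eqP : P1 * P2 = 0.
    apply: indY => v; rewrite eY mevalM => -[/PY1->|/PY2->]; rewrite ?mul0r //.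
    by rewrite mulr0.
  by rewrite mulf_eq0 (negPf P10) (negPf P20).
have [C [C0 Cirr Clt]] := codim Y Yirr YZ.
have Cc i : (i <= 3)%N -> proj_closed (C i) by move=> /Cirr[].
have [g1 g10 g11] := proj_sub_vanish (Cc 0 isT) (Clt 0 isT) (Cc 1 isT).
have [g2 g20 g21] := proj_sub_vanish (Cc 1 isT) (Clt 1 isT) (Cc 2 isT).
have [g3 g30 g31] := proj_sub_vanish (Cc 2 isT) (Clt 2 isT) (Cc 3 isT).
pose e := maxn (\max_i msize (l i)) (maxn (msize g1) (maxn (msize g2) (msize g3))).
(* All products of powers below have size at most [T * E], and there are [T ^ n.+2] of them. Since
   [T] exceeds [E ^ n.+1], this is more than the [(T * E) ^ n.+1] that [lin_indep_card] allows. *)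
pose E := (n.+2 * (e + 1) + 4)%N.
pose T := (E ^ n.+1).+1.
have ind0 := alg_indep_lin (T := T) indY; rewrite -C0 in ind0.
have ind1 := lin_indep_ext (T := T) (Cirr 1 isT) (properW (Clt 0 isT)) ind0 g10 g11.
have ind2 := lin_indep_ext (T := T) (Cirr 2 isT) (properW (Clt 1 isT)) ind1 g20 g21.
have ind3 := lin_indep_ext (T := T) (Cirr 3 isT) (properW (Clt 2 isT)) ind2 g30 g31.
have powle (g : {mpoly K[n.+1]}) (b : 'I_T) : (msize g <= e)%N -> (msize (g ^+ b) <= T * e + 1)%N.
  move=> ge; apply: leq_trans (msizeXn_le _ _) _.
  by rewrite leq_add2r leq_mul // ltnW.
have step : (T ^ n.-1 * T * T * T = T ^ n.+2)%N.
  by rewrite -!mulnA -[(T * (T * T))%N]/(T ^ 3)%N -expnD -subn1; congr (_ ^ _)%N; lia.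
have : (#|{: {ffun 'I_n.-1 -> 'I_T} * 'I_T * 'I_T * 'I_T}| <= (T * E) ^ n.+1)%N.
  apply: (lin_indep_card ind3).
  move=> [[[a b1] b2] b3] /=.
  have le_a : (msize (monomial_family l a) <= n.-1 * (T * e + 1) + 1)%N.
    apply: msize_prod_le => i; apply: powle.
    rewrite /e leq_max; apply/orP; left.
    exact: (leq_bigmax (F := fun i => msize (l i))).
  have h1 : (msize (g1 ^+ b1) <= T * e + 1)%N by apply: powle; rewrite /e; lia.
  have h2 : (msize (g2 ^+ b2) <= T * e + 1)%N by apply: powle; rewrite /e; lia.
  have h3 : (msize (g3 ^+ b3) <= T * e + 1)%N by apply: powle; rewrite /e; lia.
  apply: (leq_trans (msizeM_leD _ _)).
  have Tpos : (0 < T)%N by [].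
  have le : (n.-1 * (T * e + 1) + 1 + 3 * (T * e + 1) <= T * E)%N.
    have -> : (n.-1 = n - 1)%N by lia.
    rewrite /E; move: Tpos n0; clearbody T e; clear; nia.
  apply: leq_trans le.
  apply: (leq_trans (leq_add (leq_trans (msizeM_leD _ _)
    (leq_add (leq_trans (msizeM_leD _ _) (leq_add le_a h1)) h2)) h3)).
  by lia.
rewrite !card_prod card_ffun !card_ord step expnMn (expnSr T n.+1).
by rewrite leq_pmul2l ?expn_gt0 // /T ltnn.
Qed.

End Dimension.

(** * Elimination along the parabolas *)

(** One evaluation for all rings: the same integral form is taken at integer points, at algebraic
    points and along polynomial curves, and [ev_morph] passes between them. *)
Definition ev (R : comNzRingType) (m : nat) (v : 'I_m -> R) (G : {mpoly int[m]}) : R :=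
  mmap (intr : int -> R) v G.

Section Evaluation.
Variables (R : comNzRingType) (m : nat).
Implicit Types (v : 'I_m -> R) (G : {mpoly int[m]}).

Lemma evE v G : ev v G = \sum_(a <- msupp G) (G@_a)%:~R * \prod_i v i ^+ a i.
Proof. by []. Qed.

Lemma eq_ev v w G : v =1 w -> ev v G = ev w G.
Proof.
move=> vw; rewrite !evE; apply: eq_bigr => a _; congr (_ * _).
by apply: eq_bigr => i _; rewrite vw.
Qed.

Lemma ev_morph (S : comNzRingType) (phi : {rmorphism R -> S}) v G :
  phi (ev v G) = ev (phi \o v) G.
Proof.
rewrite !evE rmorph_sum; apply: eq_bigr => a _.
rewrite rmorphM rmorph_int rmorph_prod; congr (_ * _).
by apply: eq_bigr => i _; rewrite rmorphXn.
Qed.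

Lemma meval_map_ev v G : (map_mpoly (intr : int -> R) G).@[v] = ev v G.
Proof.
rewrite [map_mpoly _ _]/mmap raddf_sum /= evE; apply: eq_bigr => a _.
rewrite mevalM mevalC; congr (_ * _).
rewrite /mmap1 rmorph_prod /=; apply: eq_bigr => i _.
by rewrite rmorphXn /= mevalXU.
Qed.

Lemma evM v : {morph ev v : G H / G * H}. Proof. exact: rmorphM. Qed.
Lemma evX v k : {morph ev v : G / G ^+ k}. Proof. exact: rmorphXn. Qed.
Lemma ev_sum v (I : Type) (r : seq I) (F : I -> {mpoly int[m]}) :
  ev v (\sum_(i <- r) F i) = \sum_(i <- r) ev v (F i).
Proof. exact: raddf_sum. Qed.
Lemma evZ v c G : ev v (c *: G) = c%:~R * ev v G.
Proof. exact: mmapZ. Qed.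
Lemma evXU v i : ev v 'X_i = v i.
Proof. by rewrite [LHS]mmapX mmap1U. Qed.

Lemma ev_homog_scale d (t : R) v G : G \is d.-homog ->
  ev (fun i => t * v i) G = t ^+ d * ev v G.
Proof.
move=> /dhomogP hG; rewrite -!meval_map_ev; apply: meval_homog_scale.
apply/dhomogP => a; rewrite mcoeff_msupp mcoeff_map_mpoly => ca.
apply: hG; rewrite mcoeff_msupp.
by apply: contraNneq ca => ->.
Qed.

End Evaluation.

Lemma ev_int (m : nat) (v : 'I_m -> int) (G : {mpoly int[m]}) : ev v G = G.@[v].
Proof.
by rewrite evE mevalE; apply: eq_bigr => a _; rewrite intz.
Qed.

Lemma ev_comp (R : comNzRingType) (m k : nat) (v : 'I_k -> R)
    (L : m.-tuple {mpoly int[k]}) (G : {mpoly int[m]}) :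
  ev v (G \mPo L) = ev (fun i => ev v (tnth L i)) G.
Proof.
rewrite /comp_mpoly [mmap _ _ G]/mmap ev_sum [RHS]evE; apply: eq_bigr => a _.
rewrite evM; congr (_ * _); first exact: mmapC.
by rewrite /mmap1 [LHS]rmorph_prod; apply: eq_bigr => i _; exact: rmorphXn.
Qed.

Section TopCoefficient.
Variable R : comNzRingType.
Implicit Types p q : {poly R}.

(** A formal leading coefficient: [c] may be 0, so it is additive and multiplicative over any
    commutative ring with no hypothesis of nonvanishing. *)
Definition topcoef (k : nat) (p : {poly R}) (c : R) := (size p <= k.+1)%N /\ p`_k = c.

Lemma topcoefM k l p q c c' :
  topcoef k p c -> topcoef l q c' -> topcoef (k + l) (p * q) (c * c').
Proof.
move=> [sp <-] [sq <-]; split.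
  by apply: leq_trans (size_polyMleq _ _) _; lia.
rewrite coefM.
have kl : (k < (k + l).+1)%N by lia.
rewrite (bigD1 (Ordinal kl)) //= addKn big1 ?addr0 // => i.
rewrite -val_eqE /= => ik; have [lt|ge] := ltnP i k.
  by rewrite (nth_default _ (_ : size q <= _)%N) ?mulr0 //; apply: leq_trans sq _; lia.
rewrite (nth_default _ (_ : size p <= _)%N) ?mul0r //; apply: leq_trans sp _; lia.
Qed.

Lemma topcoefX k j p c : topcoef k p c -> topcoef (k * j) (p ^+ j) (c ^+ j).
Proof.
move=> h; elim: j => [|j ih].
  by rewrite muln0 !expr0; split; rewrite ?size_poly1 // coef1.
by rewrite !exprS mulnS; exact: topcoefM.
Qed.

Lemma topcoef_ev (m D : nat) (A : 'I_m -> {poly R}) (w : 'I_m -> R)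
    (G : {mpoly int[m]}) :
  G \is D.-homog -> (forall i, topcoef 2 (A i) (w i)) ->
  topcoef (2 * D) (ev A G) (ev w G).
Proof.
move=> /dhomogP hG Aw; rewrite !evE.
rewrite big_seq [X in topcoef _ _ X]big_seq.
apply: (big_ind2 (topcoef (2 * D))).
- by split; rewrite ?size_poly0 ?coef0.
- move=> p c q c' [sp <-] [sq <-]; split; last by rewrite coefD.
  by apply: leq_trans (size_polyD _ _) _; rewrite geq_max sp sq.
move=> a /hG da; have {da}<- : mdeg a = D := da.
rewrite -[(2 * _)%N]add0n; apply: topcoefM.
  have -> : (G@_a)%:~R = ((G@_a)%:~R)%:P :> {poly R} by rewrite rmorph_int.
  by split; rewrite ?coefC // size_polyC leq_b1.
rewrite mdegE big_distrr /=.
elim/big_rec3: _ => [|i p c s _ h].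
  by split; rewrite ?size_poly1 ?coef1.
by apply: topcoefM => //; exact: topcoefX.
Qed.

End TopCoefficient.

(** [z] is indexed by all coordinates so that a whole point can be passed, with its first four
    entries overwritten. *)
Definition coords (T : Type) (m : nat) (a b u v : T) (z : 'I_m -> T) (i : 'I_m) : T :=
  match val i with 0%N => a | 1%N => b | 2%N => u | 3%N => v | _ => z i end.

Lemma coords_eta (T : Type) (m : nat) (x : 'I_m.+1 -> T) :
  coords (x (inord 0)) (x (inord 1)) (x (inord 2)) (x (inord 3)) x =1 x.
Proof.
move=> i; rewrite /coords; case E: (val i) => [|[|[|[|k]]]] //;
  by congr x; apply: val_inj; rewrite /= inordK ?E // -E ltn_ord.
Qed.

Lemma coords_comp (T U : Type) (f : T -> U) (m : nat) a b u v (z : 'I_m -> T) :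
  f \o coords a b u v z =1 coords (f a) (f b) (f u) (f v) (f \o z).
Proof. by move=> i; rewrite /coords /=; case: (val i) => [|[|[|[|k]]]]. Qed.

Section CoordsInord.
Variables (T : Type) (n : nat) (n3 : (3 <= n)%N) (a b u v : T) (z : 'I_n.+1 -> T).
Lemma coords0 : coords a b u v z (inord 0) = a.
Proof. by rewrite /coords /= inordK. Qed.
Lemma coords1 : coords a b u v z (inord 1) = b.
Proof. by rewrite /coords /= inordK //; lia. Qed.
Lemma coords2 : coords a b u v z (inord 2) = u.
Proof. by rewrite /coords /= inordK //; lia. Qed.
Lemma coords3 : coords a b u v z (inord 3) = v.
Proof. by rewrite /coords /= inordK //; lia. Qed.
End CoordsInord.

Definition nrm (R : comNzRingType) (d : int) (u v : R) : R := u ^+ 2 - d%:~R * v ^+ 2.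

Lemma nrm_morph (R S : comNzRingType) (phi : {rmorphism R -> S}) d u v :
  phi (nrm d u v) = nrm d (phi u) (phi v).
Proof. by rewrite /nrm rmorphB rmorphM rmorph_int !rmorphXn. Qed.

Lemma ev_nrm (R : comNzRingType) m (x : 'I_m -> R) d u v :
  ev x (nrm d u v) = nrm d (ev x u) (ev x v).
Proof.
pose phi : {rmorphism {mpoly int[m]} -> R} := mmap intr x.
exact: (nrm_morph phi).
Qed.

Lemma ev_intr (R : comNzRingType) m (x : 'I_m -> R) (k : int) : ev x k%:~R = k%:~R.
Proof.
pose phi : {rmorphism {mpoly int[m]} -> R} := mmap intr x.
exact: (rmorph_int phi).
Qed.

Lemma ev0 (R : comNzRingType) m (x : 'I_m -> R) : ev x 0 = 0.
Proof. exact: raddf0. Qed.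

Definition on_model (R : comNzRingType) (n : nat) (d : int) (x : 'I_n.+1 -> R) :=
  x (inord 0) * x (inord 1) = nrm d (x (inord 2)) (x (inord 3)).

(** Nonzero images of the leading coefficients preserve both degrees, hence the shape of the
    Sylvester matrix. *)
Lemma resultant_morph (R S : nzRingType) (phi : {rmorphism R -> S}) (p q : {poly R}) :
  phi (lead_coef p) != 0 -> phi (lead_coef q) != 0 ->
  phi (resultant p q) = resultant (map_poly phi p) (map_poly phi q).
Proof.
move=> p0 q0; rewrite /resultant /Sylvester_mx !size_map_poly_id0 // -det_map_mx.
rewrite map_col_mx; congr (\det (col_mx _ _));
  by apply: map_lin1_mx => v; rewrite map_poly_rV rmorphM /= map_rVpoly.
Qed.

Definition apex (R : comNzRingType) (n : nat) : 'I_n.+1 -> R :=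
  coords 0 1 0 0 (fun=> 0).
Arguments apex R n i : clear implicits.
(* For a form G, the coefficient of the pure power of the variable of index 1. *)
Definition gam (n : nat) (G : {mpoly int[n.+1]}) : int := ev (apex int n) G.

Lemma ev_apex (R : comNzRingType) n D (t : R) (G : {mpoly int[n.+1]}) :
  G \is D.-homog -> ev (coords 0 t 0 0 (fun=> 0)) G = t ^+ D * (gam G)%:~R.
Proof.
move=> hG; rewrite /gam (ev_morph (intr : {rmorphism int -> R})).
rewrite -(ev_homog_scale _ _ hG); apply: eq_ev => i.
rewrite /= /apex /coords; case: (val i) => [|[|[|[|k]]]];
  by rewrite ?rmorph0 ?rmorph1 ?mulr0 ?mulr1.
Qed.

Section Curve.
Variables (R : comNzRingType) (n : nat) (d : int).
Variables (a t e2 e3 : R) (z : 'I_n.+1 -> R).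

(* With q = e2^2 + e3^2, the identity q w = t e^perp + (w.e) e, where
   t = w2 e3 - w3 e2 and e^perp = (e3, -e2), parametrises the plane vectors w
   with given t; the curve below is q^2 a times the corresponding parabola
   (a, N(w)/a, w, z) of the cone x0 x1 = N(x2, x3), free of denominators. *)
Definition curve : 'I_n.+1 -> {poly R} :=
  let q := e2 ^+ 2 + e3 ^+ 2 in
  let w2 := (t * e3)%:P + e2%:P * 'X in
  let w3 := e3%:P * 'X - (t * e2)%:P in
  coords ((q * a) ^+ 2)%:P (nrm d w2 w3) ((q * a)%:P * w2) ((q * a)%:P * w3)
    (fun i => (q ^+ 2 * a * z i)%:P).

Lemma topcoef_lin (c e : R) : topcoef 1 (c%:P + e%:P * 'X) e.
Proof.
split; last by rewrite coefD coefC coefMX coefC add0r.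
apply: leq_trans (size_polyD _ _) _; rewrite geq_max; apply/andP; split.
  by apply: leq_trans (size_polyC_leq1 _) _.
apply: leq_trans (size_polyMleq _ _) _; rewrite size_polyX.
by have := size_polyC_leq1 e; lia.
Qed.

Lemma topcoef_const (k : nat) (c : R) : (0 < k)%N -> topcoef k c%:P 0.
Proof.
move=> k0; split; last by rewrite coefC (gtn_eqF k0).
by apply: leq_trans (size_polyC_leq1 _) _; lia.
Qed.

Lemma topcoefD k (p q : {poly R}) c c' :
  topcoef k p c -> topcoef k q c' -> topcoef k (p + q) (c + c').
Proof.
move=> [sp <-] [sq <-]; split; last by rewrite coefD.
by apply: leq_trans (size_polyD _ _) _; rewrite geq_max sp sq.
Qed.

Lemma topcoefC c : topcoef 0 (c%:P : {poly R}) c.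
Proof. by split; rewrite ?coefC // size_polyC_leq1. Qed.

Lemma topcoef_nrm (u v : {poly R}) (x y : R) :
  topcoef 1 u x -> topcoef 1 v y -> topcoef 2 (nrm d u v) (nrm d x y).
Proof.
move=> hu hv; rewrite /nrm -!mulNr.
apply: topcoefD; first exact: (topcoefX (k := 1) 2 hu).
have -> : - d%:~R = (- d%:~R : R)%:P by rewrite polyCN rmorph_int.
by rewrite -[2%N]/(0 + 1 * 2)%N; apply: topcoefM; [exact: topcoefC|exact: topcoefX].
Qed.

(** Only coordinate 1 is quadratic in the parameter, with coefficient N(e): the point at infinity of
    every such parabola is the apex. *)
Lemma topcoef_curve i :
  topcoef 2 (curve i) (coords 0 (nrm d e2 e3) 0 0 (fun=> 0) i).
Proof.
have t2 : topcoef 1 ((t * e3)%:P + e2%:P * 'X) e2 by exact: topcoef_lin.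
have t3 : topcoef 1 (e3%:P * 'X - (t * e2)%:P) e3.
  by rewrite -polyCN addrC; exact: topcoef_lin.
have widen k p (c x : R) : topcoef k p c -> (k < 2)%N -> topcoef 2 (x%:P * p) 0.
  move=> [sp _] k2; have sx : (size (x%:P * p)%R <= k.+1)%N.
    apply: leq_trans (size_polyMleq _ _) _.
    by have := size_polyC_leq1 x; lia.
  by split; [apply: leq_trans sx _; lia|rewrite nth_default // (leq_trans sx)].
rewrite /curve /coords; case: (val i) => [|[|[|[|k]]]]; try exact: topcoef_const.
- exact: topcoef_nrm.
- exact: widen t2 _.
- exact: widen t3 _.
Qed.

Lemma topcoef_curve_ev D (G : {mpoly int[n.+1]}) : G \is D.-homog ->
  topcoef (2 * D) (ev curve G) (nrm d e2 e3 ^+ D * (gam G)%:~R).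
Proof.
move=> hG; rewrite -(ev_apex _ hG).
exact: (topcoef_ev hG topcoef_curve).
Qed.

End Curve.

Lemma curve_morph (R S : comNzRingType) (phi : {rmorphism R -> S}) n d a t e2 e3
    (z : 'I_n.+1 -> R) :
  map_poly phi \o curve d a t e2 e3 z =1
  curve d (phi a) (phi t) (phi e2) (phi e3) (phi \o z).
Proof.
move=> i; rewrite /curve /coords /=.
have w2E : map_poly phi ((t * e3)%:P + e2%:P * 'X) =
    (phi t * phi e3)%:P + (phi e2)%:P * 'X.
  by rewrite rmorphD rmorphM /= !map_polyC map_polyX /= rmorphM.
have w3E : map_poly phi (e3%:P * 'X - (t * e2)%:P) =
    (phi e3)%:P * 'X - (phi t * phi e2)%:P.
  by rewrite rmorphB rmorphM /= !map_polyC map_polyX /= rmorphM.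
have qE : phi (e2 ^+ 2 + e3 ^+ 2) = phi e2 ^+ 2 + phi e3 ^+ 2.
  by rewrite rmorphD !rmorphXn.
case: (nat_of_ord i) => [|[|[|[|k]]]].
- by rewrite map_polyC /=; congr (_%:P); rewrite rmorphXn rmorphM qE.
- by rewrite (nrm_morph (map_poly phi)) /= w2E w3E.
- by rewrite rmorphM /= w2E map_polyC /=; congr (_%:P * _); rewrite rmorphM qE.
- by rewrite rmorphM /= w3E map_polyC /=; congr (_%:P * _); rewrite rmorphM qE.
- by rewrite map_polyC /=; congr (_%:P); rewrite 2!rmorphM rmorphXn qE.
Qed.

Lemma ev_curve_morph (R S : comNzRingType) (phi : {rmorphism R -> S}) n d a t e2 e3
    (z : 'I_n.+1 -> R) (G : {mpoly int[n.+1]}) :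
  map_poly phi (ev (curve d a t e2 e3 z) G) =
  ev (curve d (phi a) (phi t) (phi e2) (phi e3) (phi \o z)) G.
Proof.
rewrite (ev_morph (map_poly phi)); apply: eq_ev; exact: curve_morph.
Qed.

Lemma horner_ev (R : comNzRingType) (m : nat) (A : 'I_m -> {poly R}) (s : R)
    (G : {mpoly int[m]}) : (ev A G).[s] = ev (fun i => (A i).[s]) G.
Proof. exact: (ev_morph (horner_eval s)). Qed.

Lemma curve_param (R : comNzRingType) n d (e2 e3 : R) (x : 'I_n.+1 -> R) :
  on_model d x ->
  let a := x (inord 0) in let w2 := x (inord 2) in let w3 := x (inord 3) in
  forall i, (curve d a (w2 * e3 - w3 * e2) e2 e3 x i).[w2 * e2 + w3 * e3] =
            (e2 ^+ 2 + e3 ^+ 2) ^+ 2 * a * x i.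
Proof.
move=> hx a w2 w3 i; rewrite -[in RHS](coords_eta x i) -/a -/w2 -/w3 /curve /coords.
have {}hx : a * x (inord 1) = nrm d w2 w3 := hx.
have nrmH (u v : {poly R}) s : (nrm d u v).[s] = nrm d u.[s] v.[s].
  exact: (nrm_morph (horner_eval s)).
case: (val i) => [|[|[|[|k]]]]; rewrite ?nrmH ?hornerE /=.
- by ring.
- rewrite -[RHS]mulrA hx /nrm; ring.
- by ring.
- by ring.
- by [].
Qed.

Section Elimination.
Variables (n : nat) (d : int).

(* The variables of index 0, 1, 2, 3 stand for a, t, e2, e3. *)
Definition elim_poly (G1 G2 : {mpoly int[n.+1]}) : {mpoly int[n.+1]} :=
  let c := curve d 'X_(inord 0) 'X_(inord 1) 'X_(inord 2) 'X_(inord 3) (fun i => 'X_i) in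
  resultant (ev c G1) (ev c G2).

Lemma ev_gen (R : comNzRingType) (x : 'I_n.+1 -> R) (G : {mpoly int[n.+1]}) :
  map_poly (ev x)
   (ev (curve d 'X_(inord 0) 'X_(inord 1) 'X_(inord 2) 'X_(inord 3) (fun i => 'X_i)) G) =
  ev (curve d (x (inord 0)) (x (inord 1)) (x (inord 2)) (x (inord 3)) x) G.
Proof.
pose phi : {rmorphism {mpoly int[n.+1]} -> R} := mmap intr x.
have E i : phi 'X_i = x i := evXU x i.
transitivity (ev (curve d (phi 'X_(inord 0)) (phi 'X_(inord 1)) (phi 'X_(inord 2))
   (phi 'X_(inord 3)) (phi \o (fun i => 'X_i))) G).
  exact: (ev_curve_morph phi).
have -> : phi \o (fun i => 'X_i) = x by apply: funext => i; rewrite /= E.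
by rewrite !E.
Qed.

Lemma ev_elim (R : idomainType) (x : 'I_n.+1 -> R) D1 D2 (G1 G2 : {mpoly int[n.+1]}) :
  G1 \is D1.-homog -> G2 \is D2.-homog ->
  (gam G1)%:~R != 0 :> R -> (gam G2)%:~R != 0 :> R ->
  nrm d (x (inord 2)) (x (inord 3)) != 0 ->
  let c := curve d (x (inord 0)) (x (inord 1)) (x (inord 2)) (x (inord 3)) x in
  ev x (elim_poly G1 G2) = resultant (ev c G1) (ev c G2).
Proof.
move=> h1 h2 g1 g2 ne c; rewrite /c -(ev_gen x G1) -(ev_gen x G2).
pose phi : {rmorphism {mpoly int[n.+1]} -> R} := mmap intr x.
have lead D G : G \is D.-homog -> (gam G)%:~R != 0 :> R ->
    phi (lead_coef (ev (curve d 'X_(inord 0) 'X_(inord 1) 'X_(inord 2) 'X_(inord 3)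
      (fun i => 'X_i)) G)) != 0.
  move=> hG gG.
  have [sz co] := topcoef_curve_ev d ('X_(inord 0) : {mpoly int[n.+1]})
    'X_(inord 1) 'X_(inord 2) 'X_(inord 3) (fun i => 'X_i) hG.
  have phico : phi (nrm d ('X_(inord 2) : {mpoly int[n.+1]}) 'X_(inord 3) ^+ D *
      (gam G)%:~R) != 0.
    rewrite rmorphM rmorph_int mulf_neq0 // rmorphXn expf_neq0 //.
    rewrite (nrm_morph phi); have E i : phi 'X_i = x i := evXU x i.
    by rewrite !E.
  rewrite lead_coefE; set P := ev _ _ in sz co *.
  have -> : size P = (2 * D).+1.
    apply/eqP; rewrite eqn_leq sz ltnNge; apply: contraNN phico => /leq_sizeP P0.
    by rewrite -co P0 // rmorph0.
  by rewrite /= co.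
exact: (resultant_morph (phi := phi)) (lead _ _ h1 g1) (lead _ _ h2 g2).
Qed.

(** The resultant is a combination of the two polynomials over the ring of the parameters.
    Specialised to the data of [x] and to the parameter w.e, the curve yields a multiple of [x] by
    [curve_param], where both forms are divisible by [p]. *)
Lemma elim_dvd D1 D2 (G1 G2 : {mpoly int[n.+1]}) (x : 'I_n.+1 -> int) (e2 e3 p : int) :
  (3 <= n)%N ->
  G1 \is D1.+1.-homog -> G2 \is D2.+1.-homog -> gam G1 != 0 -> gam G2 != 0 ->
  on_model d x -> (p %| ev x G1)%Z -> (p %| ev x G2)%Z ->
  (p %| ev (coords (x (inord 0))
      (x (inord 2) * e3 - x (inord 3) * e2)%R e2 e3 x) (elim_poly G1 G2))%Z.
Proof.
move=> n3 h1 h2 g1 g2 hx p1 p2.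
set y := coords _ _ _ _ _.
pose c := curve d ('X_(inord 0) : {mpoly int[n.+1]}) 'X_(inord 1) 'X_(inord 2)
   'X_(inord 3) (fun i => 'X_i).
have size_gt D G : G \is D.+1.-homog -> gam G != 0 -> (1 < size (ev c G))%N.
  move=> hG gG.
  have [sz co] := topcoef_curve_ev d ('X_(inord 0) : {mpoly int[n.+1]})
    'X_(inord 1) 'X_(inord 2) 'X_(inord 3) (fun i => 'X_i) hG.
  rewrite ltnNge; apply: contraNN gG => small.
  have {co} := co; rewrite nth_default; last by apply: leq_trans small _; lia.
  (* At e = (1, 0) the norm is 1, so the formal leading coefficient specialises to [gam G]. *)
  move=> /(congr1 (ev (coords 0 0 1 0 (fun=> 0) : 'I_n.+1 -> int))).
  rewrite ev0 evM evX ev_nrm !evXU coords2 // coords3 // /nrm.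
  by rewrite expr0n mulr0 subr0 !expr1n mul1r ev_intr intz => <-.
pose phi : {rmorphism {mpoly int[n.+1]} -> int} := mmap intr y.
pose psi (P : {poly {mpoly int[n.+1]}}) : int :=
  (map_poly phi P).[x (inord 2) * e2 + x (inord 3) * e3].
have psiD P P' : psi (P + P') = psi P + psi P' by rewrite /psi rmorphD hornerD.
have psiM P P' : psi (P * P') = psi P * psi P' by rewrite /psi rmorphM hornerM.
have psiC u : psi u%:P = phi u by rewrite /psi map_polyC hornerC.
have [[u v] _ /= /(congr1 psi)] :=
  resultant_in_ideal (size_gt _ _ h1 g1) (size_gt _ _ h2 g2).
rewrite psiC psiD !psiM => E; rewrite [ev y _]E {E}.
have psiG G : psi (ev c G) = (ev (curve d (x (inord 0))
    (x (inord 2) * e3 - x (inord 3) * e2) e2 e3 y) G).[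
    x (inord 2) * e2 + x (inord 3) * e3].
  have -> : psi (ev c G) = (map_poly (ev y) (ev c G)).[
    x (inord 2) * e2 + x (inord 3) * e3] by [].
  rewrite /c (ev_gen y G).
  have [-> -> -> ->] : [/\ y (inord 0) = x (inord 0),
    y (inord 1) = x (inord 2) * e3 - x (inord 3) * e2, y (inord 2) = e2
    & y (inord 3) = e3] by rewrite /y coords0 // coords1 // coords2 // coords3.
  by [].
rewrite !psiG /y.
have ev_at G D : G \is D.-homog -> (p %| ev x G)%Z ->
  (p %| (ev (curve d (x (inord 0)) (x (inord 2) * e3 - x (inord 3) * e2) e2 e3
    (coords (x (inord 0)) (x (inord 2) * e3 - x (inord 3) * e2) e2 e3 x)) G).[
       x (inord 2) * e2 + x (inord 3) * e3])%Z.
  move=> hG pG; rewrite horner_ev.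
  have -> : ev (fun i => (curve d (x (inord 0)) (x (inord 2) * e3 - x (inord 3) * e2)
        e2 e3 (coords (x (inord 0)) (x (inord 2) * e3 - x (inord 3) * e2) e2 e3 x)
        i).[x (inord 2) * e2 + x (inord 3) * e3]) G =
     ev (fun i => (e2 ^+ 2 + e3 ^+ 2) ^+ 2 * x (inord 0) * x i) G.
    apply: eq_ev => i; rewrite -(curve_param e2 e3 hx i); congr (_.[_]).
    by rewrite /curve /coords; case: (val i) => [|[|[|[|k]]]].
  by rewrite (ev_homog_scale _ _ hG) dvdz_mull.
by apply: rpredD; rewrite dvdz_mull //; [exact: ev_at h1 p1|exact: ev_at h2 p2].
Qed.

End Elimination.

(** * Parabolas avoiding the common zeros of the forms *)

Lemma poly_nonzero_nat (K : numDomainType) (p : {poly K}) :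
  p != 0 -> exists2 j : nat, (j < size p)%N & p.[j%:R] != 0.
Proof.
move=> p0; apply: contrapT => no.
have := max_poly_roots (p := p) (rs := [seq i%:R | i <- iota 0 (size p)]) p0.
rewrite size_map size_iota ltnn => absurd; suff: false by []; apply: absurd.
  apply/allP => x /mapP[i]; rewrite mem_iota add0n => /andP[_ ip] ->.
  by apply: contraT => nr; exfalso; apply: no; exists i.
rewrite map_inj_uniq ?iota_uniq // => i j /eqP.
by rewrite eqr_nat => /eqP.
Qed.

Lemma leq_pred2 (x y : nat) : (x <= y)%N -> (x.-1 <= y.-1)%N.
Proof. by move=> xy; rewrite -!subn1 leq_sub2r. Qed.

Lemma size_poly_prod_le (K : nzRingType) (I : Type) (r : seq I) (F : I -> {poly K}) s :
  (forall i, (size (F i) <= s.+1)%N) ->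
  (size (\prod_(i <- r) F i)%R <= (s * size r).+1)%N.
Proof.
move=> Fs; elim: r => [|i r ih]; first by rewrite big_nil size_poly1.
rewrite big_cons /=; apply: leq_trans (size_polyMleq _ _) _.
by apply: (leq_trans (leq_pred2 (leq_add (Fs i) ih))); rewrite mulnS; lia.
Qed.

Lemma base_digits_inj (B k : nat) (f g : 'I_k -> nat) :
  (forall i, f i < B)%N -> (forall i, g i < B)%N ->
  (\sum_i f i * B ^ i = \sum_i g i * B ^ i)%N -> f =1 g.
Proof.
elim: k f g => [|k ih] f g fB gB; first by move=> _ i; have := ltn_ord i.
have split_sum (h : 'I_k.+1 -> nat) : (\sum_i h i * B ^ i =
    (\sum_i h (lift ord0 i) * B ^ i) * B + h ord0)%N.
  rewrite big_ord_recl expn0 muln1 addnC; congr (_ + _)%N.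
  rewrite big_distrl; apply: eq_bigr => i _.
  by rewrite /= /bump /= add1n expnSr mulnA.
rewrite !split_sum => e.
have B0 : (0 < B)%N by exact: leq_ltn_trans (leq0n _) (fB ord0).
have e0 : f ord0 = g ord0.
  by move: (congr1 (modn^~ B) e); rewrite !modnMDl !modn_small.
move: e; rewrite e0 => /addIn/eqP; rewrite eqn_pmul2r // => /eqP e1.
move=> i; case: (unliftP ord0 i) => [j ->|-> //].
exact: (ih (fun i => f (lift ord0 i)) (fun i => g (lift ord0 i))).
Qed.

(* Kronecker substitution. *)
Lemma mpoly_nonzero_point (K : numDomainType) (k : nat) (P : {mpoly K[k]}) :
  P != 0 -> exists v : 'I_k -> K, P.@[v] != 0.
Proof.
move=> P0; pose B := msize P.
pose code (a : 'X_{1..k}) := (\sum_i a i * B ^ i)%N.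
have small a : a \in msupp P -> forall i, (a i < B)%N.
  move=> aP i; apply: leq_ltn_trans (msize_mdeg_lt aP).
  by rewrite mdegE (bigD1 i) //= leq_addr.
pose U : {poly K} := \sum_(a <- msupp P) P@_a *: 'X^(code a).
have UE t : U.[t] = P.@[fun i => t ^+ (B ^ i)].
  rewrite horner_sum mevalE; apply: eq_bigr => a _.
  rewrite hornerZ hornerXn; congr (_ * _); rewrite /code.
  rewrite (big_morph _ (exprD t) (expr0 t)); apply: eq_bigr => i _.
  by rewrite mulnC exprM.
have U0 : U != 0.
  have lP := mlead_supp P0.
  apply/eqP => U0; move/eqP: P0; apply; apply/eqP; rewrite -mleadc_eq0; apply/eqP.
  rewrite -(coef0 K (code (mlead P))) -U0 coef_sum (bigD1_seq (mlead P)) //=.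
  rewrite coefZ coefXn eqxx mulr1 big_seq_cond big1 ?addr0 // => a /andP[aP al].
  rewrite coefZ coefXn; case: eqP => [e|]; last by rewrite mulr0.
  case/eqP: al; apply/mnmP.
  exact: (base_digits_inj (small _ aP) (small _ lP) (esym e)).
have [j _ Uj] := poly_nonzero_nat U0.
by exists (fun i => j%:R ^+ (B ^ i)); rewrite -UE.
Qed.

(** The form in which codimension at least 3 is used. Being a statement about all families of
    polynomials, it is easily carried through changes of variables. *)
Definition small_locus (K : numFieldType) (n : nat) (Z : ('I_n.+1 -> K) -> Prop) :=
  forall l : 'I_n.-1 -> {mpoly K[n.+1]},
  exists2 P : {mpoly K[n.-1]}, P != 0 &
    forall v, Z v -> P.@[fun i => (l i).@[v]] = 0.

Definition cone_locus (n m : nat) (d : int) (G : 'I_m -> {mpoly int[n.+1]})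
  (x : 'I_n.+1 -> algC) : Prop :=
  [/\ exists i, x i != 0, on_model d x & forall k, ev x (G k) = 0].

(* Combinations along the moment curve: the value at t is a polynomial in t, so
   finitely many t decide whether all forms vanish. *)
Definition comb (n m : nat) (G : 'I_m -> {mpoly int[n.+1]}) (t : nat) :
  {mpoly int[n.+1]} := \sum_(k < m) (t%:Z ^+ k) *: G k.

Lemma ev_comb (R : comNzRingType) n m (G : 'I_m -> {mpoly int[n.+1]}) t (x : 'I_n.+1 -> R) :
  ev x (comb G t) = (\poly_(k < m) (if insub k is Some k' then ev x (G k') else 0)).[t%:R].
Proof.
rewrite /comb ev_sum horner_poly; apply: eq_bigr => k _.
by rewrite evZ rmorphXn /= pmulrn valK mulrC.
Qed.

Lemma comb_homog n m (G : 'I_m -> {mpoly int[n.+1]}) t D :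
  (forall k, G k \is D.-homog) -> comb G t \is D.-homog.
Proof. by move=> hG; apply: rpred_sum => k _; apply: rpredZ. Qed.

Lemma comb_dvd n m (G : 'I_m -> {mpoly int[n.+1]}) t (x : 'I_n.+1 -> int) (p : int) :
  (forall k, (p %| ev x (G k))%Z) -> (p %| ev x (comb G t))%Z.
Proof.
move=> h; rewrite /comb ev_sum; apply: rpred_sum => k _.
by rewrite evZ dvdz_mull.
Qed.

(** Outer data violating the algebraic relation give a parabola without common zeros of the [G k].
    At each of the finitely many roots of [comb G t0] along it some [G k] is nonzero, so almost
    every [t] makes [comb G t] nonzero there. The bound on [t] does not depend on [a], [e2], [e3]:
    finitely many resultants serve all keys. *)
Lemma elim_nonzero (n m D : nat) (d : int) (G : 'I_m -> {mpoly int[n.+1]})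
    (t0 : nat) (a e2 e3 : int) :
  (3 <= n)%N -> (forall k, G k \is D.+1.-homog) -> gam (comb G t0) != 0 ->
  small_locus (cone_locus d G) -> a != 0 -> nrm d e2 e3 != 0 ->
  exists2 t : nat, (t < (m * (2 * D + 3)).+1)%N /\ gam (comb G t) != 0 &
   exists x : 'I_n.+1 -> algC,
     [/\ x (inord 0) = a%:~R, x (inord 2) = e2%:~R, x (inord 3) = e3%:~R &
         ev x (elim_poly d (comb G t0) (comb G t)) != 0].
Proof.
move=> n3 hG g0 small a0 ne.
pose q : algC := e2%:~R ^+ 2 + e3%:~R ^+ 2.
have q0 : q != 0.
  rewrite /q -!rmorphXn -rmorphD intr_eq0.
  apply: contraNneq ne => qq; rewrite /nrm.
  have e20 : e2 = 0 by nia.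
  have e30 : e3 = 0 by nia.
  by rewrite e20 e30 !expr0n mulr0 subr0.
(* The n - 1 outer functions x0, det(w, e), x4, ..., xn. *)
pose l (i : 'I_n.-1) : {mpoly algC[n.+1]} := match val i with
  | 0%N => 'X_(inord 0)
  | 1%N => (e3%:~R) *: 'X_(inord 2) - (e2%:~R) *: 'X_(inord 3)
  | k => 'X_(inord k.+2) end.
have [P P0 Pv] := small l.
have i0P : (0 < n.-1)%N by lia.
pose i0 := Ordinal i0P.
have i1P : (1 < n.-1)%N by lia.
pose i1 := Ordinal i1P.
(* The extra factor makes the first coordinate of [o] nonzero, so that [o] can be rescaled to have
   first coordinate [a]. *)
have PX0 : P * 'X_i0 != 0.
  by rewrite mulf_neq0 // -mleadc_eq0 mleadXm mcoeffX eqxx oner_eq0.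
have [o] := mpoly_nonzero_point PX0.
rewrite mevalM mevalXU mulf_eq0 negb_or => /andP[Po o0].
pose s : algC := a%:~R / o i0.
have aC : (a%:~R : algC) != 0 by rewrite intr_eq0.
have s0 : s != 0 by rewrite mulf_neq0 ?invr_eq0.
pose t := s * o i1.
pose x : 'I_n.+1 -> algC := coords a%:~R t e2%:~R e3%:~R
   (fun i => s * o (insubd i0 (i - 2)%N)).
pose c := curve d a%:~R t e2%:~R e3%:~R x.
have noroot w : exists k, ev (fun i => (c i).[w]) (G k) != 0.
  apply: contrapT => /forallNP no.
  pose y i := (c i).[w].
  (* Every point of the curve has outer functions q^2 a times (a, t, x4, ...), that is q^2 a s times
     [o]. After scaling by [b] they equal [o], where [P] does not vanish. *)
  pose b := (q ^+ 2 * a%:~R * s)^-1.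
  have qas : q ^+ 2 * a%:~R * s != 0.
    by apply: mulf_neq0 => //; apply: mulf_neq0 => //; apply: expf_neq0.
  have b0 : b != 0 by rewrite invr_eq0.
  have c0 : y (inord 0) = (q * a%:~R) ^+ 2 by rewrite /y /c /curve coords0 // hornerC.
  have nrmH (u v : {poly algC}) : (nrm d u v).[w] = nrm d u.[w] v.[w].
    exact: (nrm_morph (horner_eval w)).
  pose w2 := t * e3%:~R + e2%:~R * w.
  pose w3 := e3%:~R * w - t * e2%:~R.
  have c1 : y (inord 1) = nrm d w2 w3.
    by rewrite /y /c /curve coords1 // nrmH !hornerE.
  have c2 : y (inord 2) = q * a%:~R * w2.
    by rewrite /y /c /curve coords2 // !hornerE.
  have c3 : y (inord 3) = q * a%:~R * w3.
    by rewrite /y /c /curve coords3 // !hornerE.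
  have cZ k : (3 < k)%N -> (k < n.+1)%N ->
      y (inord k) = q ^+ 2 * a%:~R * (s * o (insubd i0 (k - 2)%N)).
    move=> k3 kn; rewrite /y /c /curve /coords /= inordK //.
    by case: k k3 kn => [|[|[|[|k]]]] //= _ kn; rewrite hornerC /x /coords /= inordK.
  case/eqP: Po; rewrite -[RHS](Pv (fun i => b * y i)); last first.
    split.
    - exists (inord 0); rewrite c0; apply: mulf_neq0 => //; apply: expf_neq0; exact: mulf_neq0.
    - by rewrite /on_model c0 c1 c2 c3 /nrm; ring.
    move=> k; rewrite (ev_homog_scale _ _ (hG k)).
    by have /negP := no k; rewrite negbK => /eqP->; rewrite mulr0.
  apply: meval_eq => i; rewrite /l.
  have bE : b * (q ^+ 2 * a%:~R * s) = 1 by rewrite mulVf.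
  have oE k : o k = b * (q ^+ 2 * a%:~R * s) * o k by rewrite bE mul1r.
  have sE : s * o i0 = a%:~R by rewrite divfK.
  have tE : t = s * o i1 by [].
  case E : (val i) => [|[|k]].
  - have -> : i = i0 by apply: val_inj.
    rewrite mevalXU c0 [LHS]oE.
    transitivity (b * q ^+ 2 * a%:~R * (s * o i0)); first by ring.
    by rewrite sE; ring.
  - have -> : i = i1 by apply: val_inj.
    rewrite mevalB !mevalZ !mevalXU c2 c3 [LHS]oE.
    by rewrite /w2 /w3 tE /q; ring.
  - have kn : (k.+4 < n.+1)%N by have := ltn_ord i; rewrite E; clear; lia.
    have -> : i = insubd i0 k.+2.
      by apply: val_inj; rewrite val_insubd -E ltn_ord.
    by rewrite mevalXU cZ // subn2 /= [LHS]oE; ring.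
pose f := ev c (comb G t0).
have neC : nrm d (e2%:~R : algC) e3%:~R != 0.
  by rewrite -(nrm_morph (intr : {rmorphism int -> algC})) intr_eq0.
have [fsz fco] := topcoef_curve_ev d (a%:~R : algC) t e2%:~R e3%:~R x
  (comb_homog t0 hG).
rewrite -/c -/f in fsz fco.
have f0 : f != 0.
  apply/eqP => f0; move: fco; rewrite f0 coef0 => /esym/eqP.
  by rewrite mulf_eq0 intr_eq0 (negPf g0) expf_eq0 (negPf neC) andbF.
have [rs frs] := closed_field_poly_normal f.
have szrs : (size rs < (2 * D.+1).+1)%N.
  apply: leq_trans fsz; rewrite frs size_scale ?lead_coef_eq0 //.
  by rewrite size_prod_XsubC.
pose h (y : 'I_n.+1 -> algC) : {poly algC} :=
  \poly_(k < m) (if insub k is Some k' then ev y (G k') else 0).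
have h0 y k : ev y (G k) != 0 -> h y != 0.
  move=> hk; apply: contraNneq hk => /(congr1 (fun p : {poly algC} => p`_k)).
  by rewrite coef_poly ltn_ord valK coef0 => ->.
(* As polynomials in t, the first factor is [gam (comb G t)] and the others are the values of
   [comb G t] at the roots of [f] on the curve. There are at most 2 D + 3 factors, each of size at
   most [m]. *)
pose Pi := h (apex algC n) * \prod_(w <- rs) h (fun i => (c i).[w]).
have gE u : ev (apex algC n) (comb G u) = (gam (comb G u))%:~R.
  rewrite /gam (ev_morph (intr : {rmorphism int -> algC})).
  apply: eq_ev => i; rewrite /= /apex /coords.
  by case: (val i) => [|[|[|[|k]]]].
have Pi0 : Pi != 0.
  rewrite mulf_neq0 //.
    apply/eqP => ha; have := gE t0; rewrite ev_comb -/(h _) ha horner0 => /esym/eqP.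
    by rewrite intr_eq0 (negPf g0).
  rewrite prodf_seq_neq0; apply/allP => w _ /=.
  by have [k] := noroot w; exact: h0.
have Pisz : (size Pi <= (m * (2 * D + 3)).+1)%N.
  have szh y : (size (h y) <= m)%N by exact: size_poly.
  have szprod := size_poly_prod_le rs (fun w => leqW (szh (fun i => (c i).[w]))).
  apply: leq_trans (size_polyMleq _ _) _.
  apply: (leq_trans (leq_pred2 (leq_add (szh _) szprod))).
  have bound r k : (r < (2 * D.+1).+1)%N -> ((k + (k * r).+1).-1 <= (k * (2 * D + 3)).+1)%N.
    by clear; nia.
  exact: bound szrs.
have [u uP] := poly_nonzero_nat Pi0.
rewrite hornerM mulf_eq0 negb_or -ev_comb gE intr_eq0 => /andP[gu].
rewrite horner_prod prodf_seq_neq0 => /allP hu.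
exists u; first by split=> //; exact: leq_trans uP Pisz.
exists x; split; rewrite /x ?coords0 ?coords2 ?coords3 // -/x.
have x0 : x (inord 0) = a%:~R by rewrite /x coords0.
have x1 : x (inord 1) = t by rewrite /x coords1.
have x2 : x (inord 2) = e2%:~R by rewrite /x coords2.
have x3 : x (inord 3) = e3%:~R by rewrite /x coords3.
rewrite (ev_elim (comb_homog t0 hG) (comb_homog u hG)) ?intr_eq0 ?x2 ?x3 //.
rewrite x0 x1 -/c -/f resultant_eq0; apply/negP => sz.
have /closed_rootP[w] : size (gcdp f (ev c (comb G u))) != 1%N.
  by rewrite neq_ltn sz orbT.
rewrite root_gcd => /andP[fw /rootP gw].
have wrs : w \in rs.
  by move: fw; rewrite frs rootZ ?lead_coef_eq0 // root_prod_XsubC.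
have /implyP := hu w wrs.
by rewrite -ev_comb -horner_ev gw eqxx => /(_ isT).
Qed.

(** * Bounds for finite sums *)

Section SumBounds.
Variable R : realType.

(* A finite upper bound for the sum of w over {x | P x}, phrased so that it
   also expresses the finiteness of that set when w = 1. *)
Definition sum_le (T : eqType) (P : T -> Prop) (w : T -> R) (W : R) :=
  forall s : seq T, uniq s -> (forall x, x \in s -> P x) -> \sum_(x <- s) w x <= W.

Definition count_le (T : eqType) (P : T -> Prop) (N : R) := sum_le P (fun=> 1) N.

Lemma sum_le_ge0 (T : eqType) (P : T -> Prop) w W : sum_le P w W -> 0 <= W.
Proof. by move=> /(_ [::] isT); rewrite big_nil; apply. Qed.

Lemma sum_leW (T : eqType) (P P' : T -> Prop) w w' W W' : sum_le P' w' W' ->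
  (forall x, P x -> P' x) -> (forall x, P x -> w x <= w' x) -> W' <= W ->
  sum_le P w W.
Proof.
move=> h PP' ww' WW' s us sP; apply: le_trans WW'.
apply: le_trans (h s us _); last by move=> x /sP/PP'.
by rewrite big_seq [leRHS]big_seq; apply: ler_sum => x /sP/ww'.
Qed.

(** Summation over fibres. A relation replaces a map because the label [u] of [x] (a Thue vector, a
    prime) is only known to exist; a choice is made inside. *)
Lemma sum_le_rel (T U : eqType) (P : T -> Prop) (Q : U -> Prop)
    (E : T -> U -> Prop) (w : T -> R) (v : U -> R) (W : R) :
  (forall x, P x -> exists2 u, Q u & E x u) ->
  (forall u, Q u -> sum_le (fun x => P x /\ E x u) w (v u)) ->
  sum_le Q v W -> sum_le P w W.
Proof.
move=> PQ fib QW [|x0 s0]; first by rewrite big_nil => *; exact: sum_le_ge0 QW.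
set s := x0 :: s0 => us sP.
have [u0 _ _] := PQ x0 (sP x0 (mem_head _ _)).
have ex x : exists u, P x -> Q u /\ E x u.
  have [/PQ[u Qu Eu]|nP] := pselect (P x); first by exists u.
  by exists u0.
have [f fP] := choice ex.
pose t := undup (map f s).
have -> : \sum_(x <- s) w x = \sum_(u <- t) \sum_(x <- [seq x <- s | f x == u]) w x.
  under [RHS]eq_bigr do rewrite big_filter big_mkcond /=.
  rewrite exchange_big /= big_seq [RHS]big_seq; apply: eq_bigr => x xs.
  have ft : f x \in t by rewrite mem_undup map_f.
  rewrite (bigD1_seq (f x)) ?undup_uniq //= eqxx big1 ?addr0 // => u.
  by rewrite eq_sym => /negPf->.
apply: le_trans (QW t (undup_uniq _) _); last first.
  by move=> u; rewrite mem_undup => /mapP[x /sP/fP[Qu _] ->].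
rewrite big_seq [leRHS]big_seq; apply: ler_sum => u.
rewrite mem_undup => /mapP[x /sP/fP[Qu _] ux]; apply: fib.
- by rewrite ux.
- exact: filter_uniq.
move=> y; rewrite mem_filter => /andP[/eqP fy ys].
by have [_] := fP y (sP _ ys); rewrite fy; split=> //; exact: sP.
Qed.

Lemma sum_le_const (T : eqType) (P : T -> Prop) (w : T -> R) c N : 0 <= c ->
  count_le P N -> (forall x, P x -> w x <= c) -> sum_le P w (c * N).
Proof.
move=> c0 PN wc s us sP.
apply: (@le_trans _ _ (\sum_(x <- s) c * 1)).
  by rewrite big_seq [leRHS]big_seq; apply: ler_sum => x /sP/wc; rewrite mulr1.
by rewrite -mulr_sumr ler_wpM2l // PN.
Qed.

Lemma count_le_fiber (T U : eqType) (P : T -> Prop) (Q : U -> Prop)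
    (E : T -> U -> Prop) (c N : R) : 0 <= c ->
  (forall x, P x -> exists2 u, Q u & E x u) ->
  (forall u, Q u -> count_le (fun x => P x /\ E x u) c) ->
  count_le Q N -> count_le P (c * N).
Proof.
move=> c0 PQ fib QN; apply: sum_le_rel PQ fib _.
exact: sum_le_const.
Qed.

Lemma sum_le_inj (T U : eqType) (P : T -> Prop) (Q : U -> Prop) (f : T -> U)
    (w : T -> R) (v : U -> R) (W : R) :
  (forall x, P x -> Q (f x)) ->
  (forall x y, P x -> P y -> f x = f y -> x = y) ->
  (forall x, P x -> w x <= v (f x)) ->
  sum_le Q v W -> sum_le P w W.
Proof.
move=> PQ inj wv QW s us sP.
apply: le_trans (QW (map f s) _ _); first 1 last.
- rewrite map_inj_in_uniq // => x y /sP Px /sP Py; exact: inj.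
- by move=> _ /mapP[x /sP/PQ ? ->].
by rewrite big_map [leLHS]big_seq [leRHS]big_seq; apply: ler_sum => x /sP/wv.
Qed.

Lemma sum_le_or (T : eqType) (P Q : T -> Prop) (w : T -> R) W W' :
  sum_le P w W -> sum_le Q w W' -> sum_le (fun x => P x \/ Q x) w (W + W').
Proof.
move=> PW QW s us sPQ; rewrite (bigID (fun x => `[< P x >])) /=.
rewrite -2!(big_filter s); apply: lerD.
  apply: PW; first exact: filter_uniq.
  by move=> x; rewrite mem_filter => /andP[/asboolP].
apply: QW; first exact: filter_uniq.
by move=> x; rewrite mem_filter => /andP[/asboolPn nP /sPQ[]].
Qed.

Lemma sum_le_seq (T : eqType) (P : T -> Prop) (w : T -> R) (ks : seq T) :
  uniq ks -> (forall x, P x -> x \in ks) -> (forall x, 0 <= w x) ->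
  sum_le P w (\sum_(x <- ks) w x).
Proof.
move=> uk Pk w0 s us sP.
have ss : perm_eq s [seq x <- ks | x \in s].
  apply: uniq_perm => //; first exact: filter_uniq.
  move=> x; rewrite mem_filter; case xs : (x \in s) => //=.
  by rewrite (Pk _ (sP _ xs)).
rewrite (perm_big _ ss) big_filter big_mkcond /=.
by apply: ler_sum => x _; case: ifP.
Qed.

Lemma count_le_seq (T : eqType) (P : T -> Prop) (ks : seq T) :
  (forall x, P x -> x \in ks) -> count_le P (size ks)%:R.
Proof.
move=> Pk s us sP; rewrite big_const_seq count_predT iter_addr_0 -mulr_natr mul1r.
by rewrite ler_nat uniq_leq_size // => x /sP/Pk.
Qed.

Lemma count_le1 (T : eqType) (P : T -> Prop) :
  (forall x y, P x -> P y -> x = y) -> count_le P 1.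
Proof.
move=> P1 [|x [|y s]]; rewrite ?big_nil ?big_seq1 //.
move=> /=; rewrite inE negb_or => /andP[/andP[xy _] _] sP.
by case/eqP: xy; apply: P1; apply: sP; rewrite !inE eqxx ?orbT.
Qed.

Lemma count_leE (T : eqType) (P : T -> Prop) N s :
  count_le P N -> uniq s -> (forall x, x \in s -> P x) -> (size s)%:R <= N.
Proof.
move=> h us sP; have := h s us sP.
by rewrite big_const_seq count_predT iter_addr_0 -mulr_natr mul1r.
Qed.

Lemma count_leP (T : eqType) (P : T -> Prop) N :
  (forall s, uniq s -> (forall x, x \in s -> P x) -> (size s)%:R <= N) -> count_le P N.
Proof.
move=> h s us sP.
by rewrite big_const_seq count_predT iter_addr_0 -mulr_natr mul1r h.
Qed.

(** The set may be assumed nonempty, and its elements compared with a base point [x0]. *)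
Lemma sum_le_base (T : eqType) (P : T -> Prop) (w : T -> R) (W : R) : 0 <= W ->
  (forall x0, P x0 -> sum_le P w W) -> sum_le P w W.
Proof.
move=> W0 h [|x s] us sP; first by rewrite big_nil.
by apply: (h x) => //; apply: sP; rewrite mem_head.
Qed.

Lemma count_le_int (L : R) : 0 <= L ->
  count_le (fun i : int => (`|i|%N)%:R <= L) (2 * L + 1).
Proof.
move=> L0; pose t := Num.truncn L.
have tL : t%:R <= L by rewrite truncn_le.
pose ks : seq int := [seq Posz i | i <- iota 0 t.+1] ++ [seq - Posz i.+1 | i <- iota 0 t].
suff h : count_le (fun i : int => (`|i|%N)%:R <= L) (size ks)%:R.
  apply: sum_leW h _ _ _ => //.
  by rewrite size_cat !size_map !size_iota natrD -natr1; lra.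
apply: count_le_seq.
move=> i iL; have it : (`|i| <= t)%N by rewrite truncn_ge_nat.
rewrite mem_cat; clear iL.
case: i it => k kt; apply/orP; [left|right]; apply/mapP.
  by exists k => //; rewrite mem_iota.
by exists k; rewrite ?NegzE // mem_iota.
Qed.

Lemma count_le_class (L : R) (p : nat) (E : int -> Prop) : 0 <= L -> (0 < p)%N ->
  (forall i j, E i -> E j -> (p%:Z %| i - j)%Z) ->
  count_le (fun i => (`|i|%N)%:R <= L /\ E i) (4 * L / p%:R + 1).
Proof.
move=> L0 p0 Ep; have pR : 0 < p%:R :> R by rewrite ltr0n.
apply: sum_le_base => [|i0 [i0L Ei0]].
  by apply: addr_ge0 => //; apply: divr_ge0; [lra|exact: ltW].
apply: (@sum_le_inj _ _ _ (fun j : int => (`|j|%N)%:R <= 2 * L / p%:R)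
  (fun i => ((i - i0) %/ p%:Z)%Z) _ (fun=> 1)); last 1 first.
- have := @count_le_int (2 * L / p%:R) _; rewrite (_ : 2 * (2 * L / p%:R) = 4 * L / p%:R); last by ring.
  by apply; apply: divr_ge0; [lra|exact: ltW].
- move=> i [iL Ei]; have /dvdzP[j ij] := Ep _ _ Ei Ei0.
  rewrite ij mulzK; last by rewrite eqz_nat -lt0n.
  rewrite ler_pdivlMr // -natrM -[p]/(`|p%:Z|%N) -abszM -ij.
  apply: (@le_trans _ _ ((`|i| + `|i0|)%N%:R)); last by rewrite natrD; lra.
  by rewrite ler_nat; clear; lia.
- move=> i j [_ Ei] [_ Ej] e.
  have := divzK (Ep _ _ Ei Ei0); rewrite e (divzK (Ep _ _ Ej Ei0)).
  by move=> /addIr.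
- by [].
Qed.

(** Modulo [p] the polynomial is nonzero of degree at most [t], so its roots fill at most [t]
    residue classes. *)
Lemma count_le_poly_roots (f : {poly int}) (t p : nat) (L : R) : prime p -> 0 <= L ->
  (size f <= t.+1)%N -> ~~ (p%:Z %| f`_t)%Z ->
  count_le (fun i : int => (`|i|%N)%:R <= L /\ (p%:Z %| f.[i])%Z)
    ((4 * L / p%:R + 1) * t%:R).
Proof.
move=> pp L0 sf lf; pose g : {poly 'F_p} := map_poly intr f.
have Fp0 (x : int) : ((x%:~R : 'F_p) == 0) = (p%:Z %| x)%Z.
  by rewrite -(dvdz_pcharf (pchar_Fp pp)).
have gsz : (size g <= t.+1)%N by apply: leq_trans (size_poly _ _) sf.
have g0 : g != 0.
  apply: contraNneq lf => /(congr1 (fun h : {poly 'F_p} => h`_t)).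
  by rewrite coef0 coef_map /= => /eqP; rewrite Fp0.
apply: (@count_le_fiber _ _ _ (fun r : 'F_p => root g r)
   (fun i r => i%:~R = r)); last 1 first.
- apply: count_leP => s us sr; rewrite ler_nat -ltnS.
  by apply: leq_trans (max_poly_roots g0 _ us) gsz; apply/allP.
- apply: addr_ge0 => //; apply: divr_ge0; [lra|exact: ler0n].
- move=> i [_ pi]; exists i%:~R => //.
  by rewrite /root /g horner_map /= Fp0.
move=> r _; apply: sum_leW (count_le_class (E := fun i => i%:~R = r) L0 (prime_gt0 pp) _) _ _ _ => //.
- by move=> i j <- /eqP; rewrite eq_sym -subr_eq0 -rmorphB Fp0.
- by move=> i [[]].
Qed.

(** * Points and zeros in boxes *)

Section Boxes.
Variable m : nat.
Implicit Types (J : seq 'I_m) (S : 'I_m -> int -> Prop) (c : 'I_m -> R)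
  (v : 'rV[int]_m).

Definition in_box J S v0 v :=
  (forall j, j \notin J -> v 0 j = v0 0 j) /\ (forall j, j \in J -> S j (v 0 j)).

Definition rset v j t : 'rV[int]_m := \row_i (if i == j then t else v 0 i).

Lemma in_box_rset J S v0 v j : in_box (j :: J) S v0 v ->
  S j (v 0 j) /\ in_box J S (rset v0 j (v 0 j)) v.
Proof.
move=> [eqv Sv]; split; first by apply: Sv; rewrite mem_head.
split=> i iJ; last by apply: Sv; rewrite inE iJ orbT.
rewrite mxE; case: eqP => [->//|/eqP ij]; apply: eqv.
by rewrite inE negb_or ij.
Qed.

Lemma box_count J S c v0 : (forall j, j \in J -> count_le (S j) (c j)) ->
  count_le (in_box J S v0) (\prod_(j <- J) c j).
Proof.
elim: J v0 => [|j J ih] v0 hS.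
  rewrite big_nil; apply: count_le1 => v w [hv _] [hw _].
  by apply/rowP => i; rewrite hv // hw.
have ih' v := ih v (fun j' j'J => hS j' (mem_behead (s := j :: J) j'J)).
rewrite big_cons mulrC.
apply: (@count_le_fiber _ _ _ (S j) (fun v t => v 0 j = t)).
- exact: sum_le_ge0 (ih' v0).
- by move=> v /in_box_rset[Sv _]; exists (v 0 j).
- move=> t _; apply: sum_leW (ih' (rset v0 j t)) _ _ _ => //.
  by move=> v [/in_box_rset[_ +] vt]; rewrite vt.
- by apply: hS; rewrite mem_head.
Qed.

(** The Schwartz-Zippel recursion: at most [s] values of coordinate [j] are bad, each with the whole
    remaining box, and every other value passes to the bound for [J']. *)
Fixpoint zero_bound (s : nat) J c : R := if J is j :: J' then
  s%:R * \prod_(i <- J') c i + c j * zero_bound s J' c else 0.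

(** The witness [x] may have non-integral free coordinates in [K]; only its frozen coordinates agree
    with [v0]. On the line through [x] in direction [j] the function is a polynomial nonzero at
    [x j]; at an integer value that is not a root, the moved [x] is a witness for the smaller
    box. *)
Lemma box_zero_count (K : numFieldType) (F : ('I_m -> K) -> K) (s : nat) J S c v0
    (x : 'I_m -> K) :
  (forall u w : 'I_m -> K, u =1 w -> F u = F w) ->
  (forall (u : 'I_m -> K) j, exists2 p : {poly K}, (size p <= s.+1)%N &
     forall t, F (fun i => if i == j then t else u i) = p.[t]) ->
  uniq J ->
  (forall j, j \in J -> count_le (S j) (c j)) ->
  (forall j, j \notin J -> x j = (v0 0 j)%:~R) -> F x != 0 ->
  count_le (fun v => in_box J S v0 v /\ F (fun i => (v 0 i)%:~R) = 0)
    (zero_bound s J c).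
Proof.
move=> Fext Fpoly; elim: J v0 x => [|j J ih] v0 x uJ hS xv Fx /=.
  move=> [|v t] _ h; first by rewrite big_nil.
  have [[hv _] /eqP] := h v (mem_head _ _).
  rewrite (Fext _ x) ?(negPf Fx) // => i.
  by rewrite xv // hv.
have /andP[jJ uJ'] := uJ.
have hS' i : i \in J -> count_le (S i) (c i).
  by move=> iJ; apply: hS; rewrite inE iJ orbT.
have [p psz pE] := Fpoly x j.
have p0 : p != 0.
  apply: contraNneq Fx => p0; rewrite -(Fext (fun i => if i == j then x j else x i)).
    by rewrite pE p0 horner0.
  by move=> i; case: eqP => [->|].
have cj := hS j (mem_head _ _).
pose B v := in_box (j :: J) S v0 v /\ root p (v 0 j)%:~R.
pose A v := [/\ in_box (j :: J) S v0 v, ~~ root p (v 0 j)%:~R &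
  F (fun i => (v 0 i)%:~R) = 0].
have cB : count_le B (s%:R * \prod_(i <- J) c i).
  rewrite mulrC.
  apply: (@count_le_fiber _ _ _ (fun t : int => root p t%:~R) (fun v t => v 0 j = t)).
  - exact: (sum_le_ge0 (box_count (v0 := v0) hS')).
  - by move=> v [_ rv]; exists (v 0 j).
  - move=> t _; apply: sum_leW (box_count (v0 := rset v0 j t) hS') _ _ _ => //.
    by move=> v [[/in_box_rset[_ +] _] vt]; rewrite vt.
  apply: count_leP => l ul lr; rewrite ler_nat -ltnS; apply: leq_trans psz.
  rewrite -(size_map (intr : int -> K)); apply: max_poly_roots => //.
    by apply/allP => _ /mapP[t /lr ? ->].
  rewrite map_inj_uniq //; exact: intr_inj.
have cA : count_le A (c j * zero_bound s J c).
  rewrite mulrC.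
  have zb0 : 0 <= zero_bound s J c.
    have prod0 (J' : seq 'I_m) : {subset J' <= J} -> 0 <= \prod_(i <- J') c i.
      move=> sub; rewrite big_seq; apply: prodr_ge0 => i iJ'.
      exact: sum_le_ge0 (hS' i (sub i iJ')).
    have : {subset J <= J} by []; elim: {1 3}J => [|i J' ih'] sub //=.
    have sub' : {subset J' <= J} by move=> k kJ'; apply: sub; rewrite inE kJ' orbT.
    apply: addr_ge0; first by rewrite mulr_ge0 ?prod0.
    by rewrite mulr_ge0 ?ih' //; apply: sum_le_ge0 (hS' i _); apply: sub; rewrite mem_head.
  apply: (@count_le_fiber _ _ _ (fun t => S j t /\ ~~ root p t%:~R)
    (fun v t => v 0 j = t)) => //; last 1 first.
  - by apply: sum_leW cj _ _ _ => // t [].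
  - by move=> v [/in_box_rset[Sv _] rv _]; exists (v 0 j).
  move=> t [_ rt].
  have := ih (rset v0 j t) (fun i => if i == j then t%:~R else x i) uJ' hS'.
  move=> /(_ _ _)/sum_leW; apply=> //; last 1 first.
  - by move=> v [[/in_box_rset[_ +] _ Fv] vt]; rewrite vt.
  - move=> i iJ; rewrite mxE; case: eqP => // /eqP ij.
    by rewrite xv // inE negb_or ij.
  - by rewrite pE.
apply: sum_leW (sum_le_or cB cA) _ _ _ => // v [bv Fv].
by have [rv|nrv] := boolP (root p (v 0 j)%:~R); [left|right].
Qed.

End Boxes.
End SumBounds.

(** * The divisor function *)

Definition tau (m : nat) : nat := size (divisors m).

Lemma tau_primepow_le (p e m : nat) : prime p -> (0 < m)%N -> coprime p m ->
  (tau (m * p ^ e) <= e.+1 * tau m)%N.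
Proof.
move=> pp m0 pm.
have n0 : (0 < m * p ^ e)%N by rewrite muln_gt0 m0 expn_gt0 prime_gt0.
have le : (e = logn p (m * p ^ e))%N.
  by rewrite lognM // ?expn_gt0 ?prime_gt0 // logn_coprime // pfactorK.
pose prods := [seq (q.1 * p ^ q.2)%N | q <- [seq (d, i) | d <- divisors m, i <- iota 0 e.+1]].
have -> : (e.+1 * tau m = size prods)%N.
  by rewrite size_map size_allpairs size_iota mulnC.
rewrite /tau; apply: uniq_leq_size; first exact: divisors_uniq.
move=> d; rewrite -dvdn_divisors // => dn; have d0 := dvdn_gt0 n0 dn.
have [d' pd' dE] := pfactor_coprime pp d0.
apply/mapP; exists (d', logn p d) => //.
apply: (allpairs_f (fun d i => (d, i))); last first.
  by rewrite mem_iota leq0n add0n ltnS (leq_trans (dvdn_leq_log p n0 dn)) // -le.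
rewrite -dvdn_divisors // -(@Gauss_dvdl d' m (p ^ e)).
  by apply: dvdn_trans dn; rewrite dE dvdn_mulr.
by rewrite coprimeXr // coprime_sym.
Qed.

Section DivisorBound.
Variable R : realType.

Lemma powR_ge1 (x eta : R) : 1 <= x -> 0 <= eta -> 1 <= x `^ eta.
Proof. by move=> x1 eta0; rewrite -(powRr0 x); apply: ler_powR. Qed.

(** Prime powers are split off one at a time. A prime p >= [P] satisfies p^eta >= 2, so e + 1 <= 2^e
    <= p^(e eta) costs nothing; each smaller prime costs a factor [A], and [om m] counts those
    dividing [m]. *)
Lemma tau_le_powR (eta : R) : 0 < eta ->
  exists2 C : R, 1 <= C & forall m : nat, (0 < m)%N -> (tau m)%:R <= C * m%:R `^ eta.
Proof.
move=> eta0.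
pose x : R := 2 `^ eta.
have x1 : 1 < x.
  have -> : (1 : R) = 1 `^ eta by rewrite powR1.
  rewrite /x.
  by apply: gt0_ltr_powR; rewrite ?nnegrE //; lra.
pose A : R := 1 + (x - 1)^-1.
have xm0 : 0 < x - 1 by lra.
have A1 : 1 <= A by rewrite lerDl invr_ge0 ltW.
(* Bernoulli's inequality for x = 2^eta; any prime p satisfies p^eta >= x. *)
have bern e : e.+1%:R <= A * x ^+ e.
  have Be : 1 + e%:R * (x - 1) <= x ^+ e.
    elim: e => [|e ih]; first by rewrite mul0r addr0 expr0.
    rewrite exprS; have : x * (1 + e%:R * (x - 1)) <= x * x ^+ e.
      by rewrite ler_wpM2l //; lra.
    apply: le_trans; rewrite -natr1.
    have : 0 <= e%:R * ((x - 1) * (x - 1)) by rewrite !mulr_ge0 // ltW.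
    by lra.
  have x0 : 0 <= x ^+ e by apply: exprn_ge0; lra.
  rewrite /A mulrDl mul1r -natr1.
  have : e%:R <= (x - 1)^-1 * x ^+ e.
    by rewrite mulrC ler_pdivlMr //; lra.
  have : 1 <= x ^+ e by apply: exprn_ege1; lra.
  by lra.
pose P := (Num.truncn ((2 : R) `^ eta^-1)).+1.
have P2 q : (P <= q)%N -> 2 <= q%:R `^ eta :> R.
  move=> Pq.
  have : (2 : R) `^ eta^-1 <= q%:R.
    apply: ltW; apply: lt_le_trans (_ : P%:R <= _); last by rewrite ler_nat.
    by rewrite /P; have /truncn_itv/andP[] := powR_ge0 (2 : R) eta^-1.
  move=> /(ge0_ler_powR (ltW eta0)); rewrite -powRrM mulVf ?gt_eqF // powRr1 //.
  by apply; rewrite ?nnegrE ?powR_ge0 ?ler0n.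
pose om (m : nat) := count (fun q => prime q && (q %| m)%N) (iota 0 P).
suff main m : (0 < m)%N -> (tau m)%:R <= A ^+ om m * m%:R `^ eta.
  exists (A ^+ P); first exact: exprn_ege1.
  move=> m m0; apply: le_trans (main m m0) _.
  rewrite ler_wpM2r ?powR_ge0 // ler_weXn2l //.
  by apply: leq_trans (count_size _ _) _; rewrite size_iota.
elim/ltn_ind: m => m ih m0.
have [->|m1] := eqVneq m 1%N.
  by rewrite powR1 mulr1; apply: exprn_ege1.
have m2 : (1 < m)%N by rewrite ltn_neqAle eq_sym m1.
set p := pdiv m; have pp : prime p := pdiv_prime m2.
have [m' pm' mE] := pfactor_coprime pp m0.
set e := logn p m in mE.
have e0 : (0 < e)%N by rewrite logn_gt0 mem_primes pp m0 pdiv_dvd.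
have m'0 : (0 < m')%N by move: m0; rewrite mE muln_gt0 => /andP[].
have m'm : (m' < m)%N.
  rewrite [ltnRHS]mE -[ltnLHS]muln1 ltn_pmul2l // -[1%N](expn0 p) ltn_exp2l //.
  exact: prime_gt1.
have om_le : ((p < P) + om m' <= om m)%N.
  rewrite /om; have -> : ((p < P)%N = count (pred1 p) (iota 0 P) :> nat).
    by rewrite count_uniq_mem ?iota_uniq // mem_iota.
  rewrite addnC -count_predUI.
  rewrite [X in (_ + X)%N](_ : _ = 0%N) ?addn0; last first.
    apply/eqP; rewrite -leqn0 leqNgt -has_count; apply/hasPn => q _ /=.
    apply/negP => /andP[/andP[_ qm'] /eqP qp]; move: pm'.
    by rewrite -qp prime_coprime ?qm' // qp.
  apply: sub_count => q /= /orP[/andP[-> qm']|/eqP->]; rewrite /= ?pp ?pdiv_dvd //.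
  by rewrite mE dvdn_mulr.
have e_le : e.+1%:R <= A ^+ (p < P)%N * (p ^ e)%:R `^ eta.
  have -> : (p ^ e)%:R `^ eta = (p%:R `^ eta) ^+ e :> R.
    rewrite natrX -[p%:R ^+ _]powR_mulrn ?ler0n // -powRrM mulrC powRrM.
    by rewrite powR_mulrn ?powR_ge0.
  have [pP|pP] := ltnP p P.
    rewrite expr1; apply: le_trans (bern e) _; rewrite ler_wpM2l //; first lra.
    apply: lerXn2r; rewrite ?nnegrE ?powR_ge0 //.
    apply: ge0_ler_powR; rewrite ?nnegrE ?ler0n //; first exact: ltW.
    by rewrite ler_nat prime_gt1.
  rewrite expr0 mul1r; apply: (@le_trans _ _ (2 ^+ e)).
    by rewrite -natrX ler_nat ltn_expl.
  by apply: lerXn2r; rewrite ?nnegrE ?powR_ge0 // P2.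
have tau_le := tau_primepow_le e pp m'0 pm'; rewrite -mE in tau_le.
apply: (@le_trans _ _ ((e.+1)%:R * (tau m')%:R)); first by rewrite -natrM ler_nat.
have -> : m%:R `^ eta = m'%:R `^ eta * (p ^ e)%:R `^ eta :> R.
  by rewrite {1}mE natrM powRM ?ler0n.
apply: (@le_trans _ _ ((A ^+ (p < P)%N * (p ^ e)%:R `^ eta) *
   (A ^+ om m' * m'%:R `^ eta))).
  by apply: ler_pM => //; rewrite ?ler0n ?ih.
rewrite mulrACA -exprD [X in _ * X]mulrC ler_wpM2r ?mulr_ge0 ?powR_ge0 //.
by rewrite ler_weXn2l.
Qed.

Lemma tau_le_poly (C A : nat) (eta : R) : 0 < eta ->
  exists2 K : R, 1 <= K & forall N m : nat, (0 < N)%N -> (0 < m)%N ->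
    (m <= C * N ^ A)%N -> (tau m)%:R <= K * N%:R `^ eta.
Proof.
move=> eta0; have A0 : 0 < A.+1%:R :> R by rewrite ltr0n.
have e0 : 0 < eta / A.+1%:R by rewrite divr_gt0.
have [K0 K01 K0P] := tau_le_powR e0.
exists (K0 * (C.+1)%:R `^ (eta / A.+1%:R)).
  have : 1 <= (C.+1)%:R `^ (eta / A.+1%:R) :> R.
    by apply: powR_ge1; [rewrite ler1n|exact: ltW].
  by move=> h; apply: (le_trans K01); rewrite ler_peMr //; lra.
move=> N m N0 m0 mN; apply: le_trans (K0P m m0) _.
rewrite -mulrA ler_wpM2l //; first lra.
apply: (@le_trans _ _ ((C.+1 * N ^ A.+1)%N%:R `^ (eta / A.+1%:R))).
  apply: ge0_ler_powR; rewrite ?nnegrE ?ler0n //; first exact: ltW.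
  rewrite ler_nat; apply: leq_trans mN _.
  by rewrite leq_mul // leq_pexp2l.
rewrite natrM powRM ?ler0n // natrX -[N%:R ^+ _]powR_mulrn ?ler0n // -powRrM.
by rewrite [_ * (eta / _)]mulrC divfK ?gt_eqF.
Qed.

Lemma ln_le_powR (eta x : R) : 0 < eta -> 0 < x -> ln x <= eta^-1 * x `^ eta.
Proof.
move=> eta0 x0; rewrite mulrC ler_pdivlMr // mulrC -ln_powR.
by apply/ltW/ln_sublinear; rewrite powR_gt0.
Qed.

Lemma harmonic_le_powR (eta : R) : 0 < eta ->
  exists2 K : R, 1 <= K & forall N : nat, (0 < N)%N ->
    \sum_(c <- iota 1 N) (c%:R)^-1 <= K * N%:R `^ eta.
Proof.
move=> eta0; exists (1 + eta^-1); first by rewrite lerDl invr_ge0 ltW.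
have h N : \sum_(c <- iota 1 N.+1) (c%:R)^-1 <= 1 + ln (N.+1%:R : R).
  elim: N => [|N ih]; first by rewrite /= big_seq1 ln1 addr0 invr1.
  have -> : iota 1 N.+2 = iota 1 N.+1 ++ [:: N.+2] by have := iotaD 1 N.+1 1; rewrite addn1 add1n.
  rewrite big_cat big_seq1 [leLHS]/(_ + _).
  have a0 : 0 < N.+1%:R :> R by rewrite ltr0n.
  have b0 : 0 < N.+2%:R :> R by rewrite ltr0n.
  have : ln (N.+1%:R / N.+2%:R : R) <= - (N.+2%:R)^-1.
    have -> : N.+1%:R / N.+2%:R = 1 + - (N.+2%:R)^-1 :> R.
      have b1 : N.+2%:R = N.+1%:R + 1 :> R by rewrite natr1.
      rewrite b1; move: (N.+1%:R : R) a0 => y y0.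
      by field; rewrite gt_eqF //; lra.
    apply: le_ln1Dx; rewrite ltrNl opprK invf_lt1 // ltr1n //.
  rewrite ln_div ?posrE // => key; apply: (le_trans (lerD ih (lexx _))).
  by move: key; move: (ln _) (ln _) (_^-1) => y1 y2 y3; lra.
case=> [//|N] _; apply: le_trans (h N) _.
have N1 : 1 <= N.+1%:R :> R by rewrite ler1n.
have := ln_le_powR eta0 (lt_le_trans ltr01 N1).
by have := powR_ge1 N1 (ltW eta0); rewrite mulrDl mul1r; lra.
Qed.

End DivisorBound.

(** * Thue vectors *)

Lemma nrmE (d u v : int) : nrm d u v = u ^+ 2 - d * v ^+ 2.
Proof. by rewrite /nrm intz. Qed.

Lemma nrm_eq0 (d u v : int) : ~ (exists m : int, d = m ^+ 2) ->
  nrm d u v = 0 -> u = 0 /\ v = 0.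
Proof.
move=> nsq; rewrite nrmE => /eqP; rewrite subr_eq0 => /eqP uv.
have [v0|v0] := eqVneq v 0.
  by split=> //; move/eqP: uv; rewrite v0 expr0n mulr0 expf_eq0 => /eqP.
case: nsq; have /dvdzP[k uk] : (v %| u)%Z.
  by rewrite -(dvdz_pexp2r _ _ (isT : 0 < 2)%N) uv dvdz_mull.
exists k; apply: (mulIf (expf_neq0 2 v0)).
by rewrite -uv uk exprMn.
Qed.

Lemma nrm_bound (d u v : int) (E : nat) : (`|u| <= E)%N -> (`|v| <= E)%N ->
  (`|nrm d u v| <= (1 + `|d|) * (E * E))%N.
Proof.
move=> uE vE; rewrite nrmE.
have h1 : (`|u| * `|u| <= E * E)%N by exact: leq_mul.
have h2 : (`|d| * (`|v| * `|v|) <= `|d| * (E * E))%N.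
  by rewrite leq_mul2l leq_mul ?orbT.
apply: (@leq_trans (`|(u ^+ 2)%R| + `|(d * v ^+ 2)%R|)%N); first (by clear; lia).
by rewrite !abszM mulnDl mul1n leq_add.
Qed.

(** Pigeonhole: if [s] is the integral square root of |a|, two of the (s+1)^2 > |a| pairs with
    entries at most [s] collide modulo [a], and e is their difference. *)
Lemma thue (a u v : int) : a != 0 -> exists e2 e3 : int,
  [/\ (0 < maxn `|e2| `|e3|)%N, (maxn `|e2| `|e3| * maxn `|e2| `|e3| <= `|a|)%N &
      (a %| u * e3 - v * e2)%Z].
Proof.
move=> a0; pose A := `|a|%N; have A0 : (0 < A)%N by rewrite absz_gt0.
have exP : exists s, (s * s <= A)%N by exists 0%N.
have ubP s : (s * s <= A)%N -> (s <= A)%N by nia.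
case: (ex_maxnP exP ubP) => s sA smax.
have sA' : (A < s.+1 * s.+1)%N.
  by rewrite ltnNge; apply/negP => /smax; rewrite ltnn.
pose f (x : 'I_s.+1 * 'I_s.+1) : 'I_A.-1.+1 :=
  inord `|((u * (x.1 : nat)%:Z - v * (x.2 : nat)%:Z) %% a)%Z|.
have /injectivePn[x [y xy fxy]] : ~~ injectiveb f.
  apply/negP => /injectiveP/leq_card; rewrite card_prod !card_ord prednK //.
  by rewrite leqNgt sA'.
exists ((x.2 : nat)%:Z - (y.2 : nat)%:Z), ((x.1 : nat)%:Z - (y.1 : nat)%:Z).
have x1 := ltn_ord x.1; have x2 := ltn_ord x.2.
have y1 := ltn_ord y.1; have y2 := ltn_ord y.2.
have le : (maxn `|(x.2 : nat)%:Z - (y.2 : nat)%:Z| `|(x.1 : nat)%:Z - (y.1 : nat)%:Z|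
    <= s)%N.
  by rewrite geq_max; clear -x1 x2 y1 y2; lia.
split.
- rewrite lt0n; apply: contraNneq xy => m0.
  move/eqP: m0; rewrite -leqn0 geq_max !leqn0 !absz_eq0 !subr_eq0 !eqz_nat.
  move=> /andP[/eqP/val_inj e2 /eqP/val_inj e1].
  by rewrite [x]surjective_pairing [y]surjective_pairing e1 e2.
- by apply: leq_trans sA; exact: leq_mul.
have modlt z : (`|(z %% a)%Z| < A.-1.+1)%N.
  rewrite prednK // /A; have := ltz_mod z a0; have := modz_ge0 z a0.
  by clear; lia.
move: fxy => /(congr1 val); rewrite /= !inordK // => /(congr1 Posz).
rewrite !gez0_abs ?modz_ge0 // => /eqP; rewrite eqz_mod_dvd.
by congr (_ %| _)%Z; ring.
Qed.

(* If (a, b, c w) lies on a b = N(c w), then this divides N(w). *)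
Definition cofac (a c : int) : int := (a %/ gcdz a (c ^+ 2))%Z.

(** Write (u, v) = c w' with w' primitive, g = gcd(a, c^2) and a = a1 g. Then a1 divides N(w'), and
    Thue modulo a1 gives e parallel to w', so a1 divides N(e) and a divides c^2 N(e). The quotient
    is (c^2 / g)(N(e) / a1), whose second factor is at most 1 + |d| in size. The bound on c E comes
    from E^2 <= |a1| <= |N(w')| and c^2 |N(w')| <= (1 + |d|) N^2. *)
Lemma key_vector (d a b u v : int) (N : nat) :
  ~ (exists m : int, d = m ^+ 2) -> a != 0 -> b != 0 -> a * b = nrm d u v ->
  (`|a| <= N)%N -> (`|u| <= N)%N -> (`|v| <= N)%N ->
  exists (c : nat) (e2 e3 : int), let E := maxn `|e2| `|e3| in
  [/\ [/\ (0 < c <= N)%N, (c%:Z %| u)%Z & (c%:Z %| v)%Z],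
      [/\ (0 < E)%N, (E * E <= N)%N & (c * E <= (1 + `|d|) * N)%N],
      [/\ nrm d e2 e3 != 0, (a %| c%:Z ^+ 2 * nrm d e2 e3)%Z &
          (a %| c%:Z * (u * e2 - d * v * e3))%Z],
      [/\ cofac a c != 0, (c%:Z * cofac a c %| u * e3 - v * e2)%Z &
          (E * E <= `|cofac a c|)%N] &
      forall p : nat, prime p -> (1 + `|d| < p)%N -> ~~ (p %| c)%N ->
        ~~ (p%:Z %| (c%:Z ^+ 2 * nrm d e2 e3) %/ a)%Z].
Proof.
move=> nsq a0 b0 hab aN uN vN.
have uv0 : (u != 0) || (v != 0).
  apply: contraNT (mulf_neq0 a0 b0); rewrite negb_or !negbK => /andP[/eqP u0 /eqP v0].
  by rewrite hab u0 v0 nrmE !expr0n mulr0 subr0.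
pose c := gcdn `|u| `|v|.
have c0 : (0 < c)%N by rewrite gcdn_gt0 !absz_gt0.
have cZ : c%:Z != 0 by rewrite eqz_nat -lt0n.
have /dvdzP[u' uE] : (c%:Z %| u)%Z by exact: (dvdn_gcdl `|u| `|v|).
have /dvdzP[v' vE] : (c%:Z %| v)%Z by exact: (dvdn_gcdr `|u| `|v|).
have cop : coprimez u' v'.
  have : gcdz u v = c%:Z by [].
  rewrite uE vE -mulz_gcdl /= => /eqP.
  by rewrite -[X in _ == X]mul1r (inj_eq (mulIf cZ)).
have cN : (c <= N)%N.
  case/orP: uv0 => h; rewrite -absz_gt0 in h.
    by apply: leq_trans uN; rewrite dvdn_leq // dvdn_gcdl.
  by apply: leq_trans vN; rewrite dvdn_leq // dvdn_gcdr.
pose g := gcdz a (c%:Z ^+ 2).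
have g0 : g != 0 by rewrite gcdz_eq0 negb_and a0.
pose a1 := cofac a c.
have aE : a = a1 * g by rewrite /a1 /cofac divzK // dvdz_gcdl.
have /dvdzP[k kE] : (g %| c%:Z ^+ 2)%Z by exact: dvdz_gcdr.
have a10 : a1 != 0 by apply: contraNneq a0 => h; rewrite aE h mul0r.
have cop1 : coprimez a1 k.
  have : gcdz a (c%:Z ^+ 2) = g by [].
  rewrite {1}aE kE -mulz_gcdl => /eqP.
  rewrite -[X in _ == X]gez0_abs // -[X in _ == X]mul1r.
  by rewrite (inj_eq (mulIf _)) // abszE normr_eq0.
have nrm_c : nrm d u v = c%:Z ^+ 2 * nrm d u' v' by rewrite uE vE !nrmE; ring.
have a1n : (a1 %| nrm d u' v')%Z.
  rewrite -(Gauss_dvdzr _ cop1) -(dvdz_mul2r g0) -aE.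
  by rewrite mulrAC -kE -nrm_c -hab dvdz_mulr.
(* A common divisor of a1 and v' divides u'^2, and w' is primitive. Thus v' can be cancelled modulo
   a1 in the identities that carry divisibility from w' to e. *)
have cop2 : coprimez a1 v'.
  have hu : (gcdz a1 v' %| u' ^+ 2)%Z.
    have -> : u' ^+ 2 = nrm d u' v' + d * v' * v' by rewrite nrmE; ring.
    apply: rpredD; first exact: dvdz_trans (dvdz_gcdl _ _) a1n.
    by rewrite dvdz_mull // dvdz_gcdr.
  have : (gcdz a1 v' %| gcdz (u' ^+ 2) v')%Z by rewrite dvdz_gcd hu dvdz_gcdr.
  have /eqP-> : coprimez (u' ^+ 2) v' by rewrite coprimez_pexpl.
  by rewrite dvdz1.
have [e2 [e3 [E0 EE det]]] := thue u' v' a10.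
exists c, e2, e3 => /=; set E := maxn _ _ in E0 EE *.
have ne0 : nrm d e2 e3 != 0.
  apply/eqP => /(nrm_eq0 nsq)[e20 e30]; move: E0; rewrite /E e20 e30.
  by rewrite maxnn.
have a1e : (a1 %| nrm d e2 e3)%Z.
  rewrite -(Gauss_dvdzr _ (_ : coprimez a1 (v' ^+ 2))) ?coprimez_pexpr //.
  have -> : v' ^+ 2 * nrm d e2 e3 =
      (v' * e2 - u' * e3) * (v' * e2 + u' * e3) + e3 ^+ 2 * nrm d u' v'.
    by rewrite !nrmE; ring.
  apply: rpredD; last by rewrite dvdz_mull.
  by rewrite dvdz_mulr // -opprB rpredN.
have a1t : (a1 %| u' * e2 - d * v' * e3)%Z.
  rewrite -(Gauss_dvdzr _ cop2).
  have -> : v' * (u' * e2 - d * v' * e3) = u' * - (u' * e3 - v' * e2) +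
     e3 * nrm d u' v' by rewrite nrmE; ring.
  by apply: rpredD; rewrite dvdz_mull // rpredN.
have nuv0 : nrm d u' v' != 0.
  apply: contraNneq (mulf_neq0 a0 b0) => h.
  by rewrite hab nrm_c h mulr0.
have E_le_a1 : (E * E <= `|a1|)%N by [].
have sqle x y : (x * x <= y * y)%N -> (x <= y)%N by clear; nia.
split.
- by rewrite c0 cN uE vE !dvdz_mull.
- split=> //.
    apply: leq_trans EE _; apply: leq_trans aN.
    by rewrite aE abszM leq_pmulr // absz_gt0.
  have n1 : (`|a1| <= `|nrm d u' v'|)%N by rewrite dvdn_leq // absz_gt0.
  have n2 : (c * c * `|nrm d u' v'| <= (1 + `|d|) * (N * N))%N.
    have := nrm_bound d uN vN; by rewrite nrm_c !abszM.
  apply: sqle; rewrite mulnACA [X in (_ <= X)%N]mulnACA.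
  apply: (@leq_trans (c * c * `|nrm d u' v'|)).
    by rewrite leq_mul2l (leq_trans EE n1) orbT.
  by apply: leq_trans n2 _; rewrite leq_mul2r; apply/orP; right; clear; nia.
- split=> //.
    have -> : c%:Z ^+ 2 * nrm d e2 e3 = k * (nrm d e2 e3 * g) by rewrite kE; ring.
    by rewrite [X in (X %| _)%Z]aE dvdz_mull // dvdz_mul.
  have -> : c%:Z * (u * e2 - d * v * e3) = (u' * e2 - d * v' * e3) * c%:Z ^+ 2.
    by rewrite uE vE; ring.
  by rewrite [X in (X %| _)%Z]aE dvdz_mul // dvdz_gcdr.
- split=> //.
  have -> : u * e3 - v * e2 = c%:Z * (u' * e3 - v' * e2) by rewrite uE vE; ring.
  by rewrite dvdz_mul.
move=> p pp pd pc.
have /dvdzP[m mE] := a1e.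
have -> : c%:Z ^+ 2 * nrm d e2 e3 = k * m * a.
  by rewrite mE kE aE; ring.
rewrite mulzK // dvdzE abszM Euclid_dvdM // negb_or; apply/andP; split.
  apply: contraNN pc => pk.
  have : (p %| `|(c%:Z ^+ 2)%R|)%N by rewrite kE abszM dvdn_mulr.
  by rewrite abszX Euclid_dvdX // => /andP[].
have m0 : (0 < `|m|)%N.
  by rewrite absz_gt0; apply: contraNneq ne0 => h; rewrite mE h mul0r.
apply/negP => /(dvdn_leq m0) pm.
have e2E : (`|e2| <= E)%N by exact: leq_maxl.
have e3E : (`|e3| <= E)%N by exact: leq_maxr.
have := nrm_bound d e2E e3E; rewrite mE abszM => h.
have : (`|m| * `|a1| <= (1 + `|d|) * `|a1|)%N.
  by apply: leq_trans h _; rewrite leq_mul2l EE orbT.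
rewrite leq_pmul2r ?absz_gt0 // leqNgt => /negP; apply.
exact: leq_trans pd pm.
Qed.

(** What [key_vector] says about the key (c, e, a) alone; what it says about the point itself is
    [key_rel]. *)
Definition key_ok (d : int) (N c : nat) (e2 e3 a : int) : Prop :=
  let E := maxn `|e2| `|e3| in
  [/\ [/\ (0 < c <= N)%N, a != 0 & (`|a| <= N)%N],
      [/\ (0 < E)%N, (E * E <= N)%N & (c * E <= (1 + `|d|) * N)%N],
      nrm d e2 e3 != 0 /\ (a %| c%:Z ^+ 2 * nrm d e2 e3)%Z,
      cofac a c != 0 /\ (E * E <= `|cofac a c|)%N &
      forall p : nat, prime p -> (1 + `|d| < p)%N -> ~~ (p %| c)%N ->
        ~~ (p%:Z %| (c%:Z ^+ 2 * nrm d e2 e3) %/ a)%Z].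

Local Notation pt y k := (y 0%R (inord k%N)).

(** * Points sharing a Thue vector *)

Section Fibers.
Variables (R : realType) (n : nat) (d : int) (N c : nat) (e2 e3 a : int).
Hypothesis n3 : (3 <= n)%N.
Hypothesis ok : key_ok d N c e2 e3 a.

Let E := maxn `|e2| `|e3|.
Let lam := (egcdz e2 e3).
(** Up to a constant, the number of points of the box on one parabola, along which the plane
    coordinates advance by multiples of c e. *)
Let X : R := N%:R / (c%:R * E%:R).

Definition key_rel (y : 'rV[int]_n.+1) : Prop :=
  [/\ forall i, (`|(y 0 i)%R| <= N)%N, on_model d (y 0), pt y 0 = a &
   [/\ (c%:Z %| pt y 2)%Z, (c%:Z %| pt y 3)%Z,
       (a %| c%:Z * (pt y 2 * e2 - d * pt y 3 * e3))%Z &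
       (c%:Z * cofac a c %| pt y 2 * e3 - pt y 3 * e2)%Z]].

(* These coordinates determine the parabola on which y lies. *)
Definition key_outer (y : 'rV[int]_n.+1) : 'rV[int]_n.+1 :=
  \row_i coords a (pt y 2 * e3 - pt y 3 * e2) e2 e3 (y 0) i.

(* For fixed outer data the points w / c lie on a line parallel to e; this
   residue selects a coset of the multiples of e, which is needed because e
   may fail to be primitive. *)
Definition key_class (y : 'rV[int]_n.+1) : nat :=
  `|((lam.1 * (pt y 2 %/ c%:Z)%Z + lam.2 * (pt y 3 %/ c%:Z)%Z)
    %% gcdz e2 e3)%Z|%N.

Lemma key_cE_gt0 : 0 < c%:R * E%:R :> R.
Proof.
by have [[/andP[c0 _] _ _] [E0 _ _] _ _ _] := ok; rewrite mulr_gt0 // ltr0n.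
Qed.

Lemma key_X_ge0 : 0 <= X.
Proof. by rewrite divr_ge0 // ltW // key_cE_gt0. Qed.

Lemma key_X_large : 1 <= (1 + `|d|)%:R * X.
Proof.
have [_ [_ _ cE] _ _ _] := ok.
by rewrite mulrA ler_pdivlMr ?key_cE_gt0 // mul1r -!natrM ler_nat.
Qed.

Lemma key_gcd_neq0 : gcdz e2 e3 != 0.
Proof.
have [_ [E0 _ _] _ _ _] := ok; rewrite gcdz_eq0 negb_and.
by apply: contraTT E0; rewrite negb_or !negbK => /andP[/eqP-> /eqP->]; rewrite maxnn.
Qed.

Lemma key_class_lt y : (key_class y < `|gcdz e2 e3|)%N.
Proof.
have g0 := key_gcd_neq0; have := ltz_mod (lam.1 * (pt y 2 %/ c%:Z)%Z +
  lam.2 * (pt y 3 %/ c%:Z)%Z) g0.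
have := modz_ge0 (lam.1 * (pt y 2 %/ c%:Z)%Z +
  lam.2 * (pt y 3 %/ c%:Z)%Z) g0.
by rewrite /key_class; move: (modz _ _) => z; clear; lia.
Qed.

(** Equal determinants make the difference of the two vectors w / c parallel to e. Since lam.e =
    gcd(e), equal classes make lam times this difference a multiple i gcd(e), which forces the
    difference to be i e. *)
Lemma key_fiber_line y y' : key_rel y -> key_rel y' ->
  key_outer y = key_outer y' -> key_class y = key_class y' ->
  exists i : int, [/\ pt y 2 = pt y' 2 + c%:Z * e2 * i,
    pt y 3 = pt y' 3 + c%:Z * e3 * i &
    forall j : 'I_n.+1, (3 < j)%N -> y 0 j = y' 0 j].
Proof.
move=> [_ _ _ [/dvdzP[u uE] /dvdzP[v vE] _ _]].
move=> [_ _ _ [/dvdzP[u' u'E] /dvdzP[v' v'E] _ _]] oo.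
have [[/andP[c0 _] _ _] _ _ _ _] := ok.
have cZ : c%:Z != 0 by rewrite eqz_nat -lt0n.
rewrite /key_class uE vE u'E v'E !mulzK // => kk.
have g0 := key_gcd_neq0.
have lamE : lam.1 * e2 + lam.2 * e3 = gcdz e2 e3.
  by rewrite /lam; case: egcdzP => x1 x2 /= ->.
have /dvdzP[i iE] : (gcdz e2 e3 %| (lam.1 * u + lam.2 * v) - (lam.1 * u' + lam.2 * v'))%Z.
  rewrite -eqz_mod_dvd; apply/eqP; move/(congr1 Posz): kk.
  by rewrite !gez0_abs ?modz_ge0.
have det : (u - u') * e3 = (v - v') * e2.
  have := congr1 (fun x : 'rV[int]_n.+1 => x 0 (inord 1)) oo.
  rewrite !mxE !coords1 // uE vE u'E v'E => h.
  by apply: (mulfI cZ); move: h; clear; lia.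
exists i; split.
- suff -> : u = u' + e2 * i by ring.
  apply: (mulfI g0); rewrite -lamE.
  have -> : (lam.1 * e2 + lam.2 * e3) * (u' + e2 * i) =
     (lam.1 * e2 + lam.2 * e3) * u' + e2 * (i * gcdz e2 e3) by rewrite -lamE; ring.
  rewrite -iE; have : lam.2 * ((u - u') * e3) = lam.2 * ((v - v') * e2) by rewrite det.
  move=> h; apply/eqP; rewrite -subr_eq0.
  by move/eqP: h; rewrite -subr_eq0 => /eqP h; apply/eqP; rewrite -[RHS]h; ring.
- suff -> : v = v' + e3 * i by ring.
  apply: (mulfI g0); rewrite -lamE.
  have -> : (lam.1 * e2 + lam.2 * e3) * (v' + e3 * i) =
     (lam.1 * e2 + lam.2 * e3) * v' + e3 * (i * gcdz e2 e3) by rewrite -lamE; ring.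
  rewrite -iE; have : lam.1 * ((v - v') * e2) = lam.1 * ((u - u') * e3) by rewrite det.
  move=> h; apply/eqP; rewrite -subr_eq0.
  by move/eqP: h; rewrite -subr_eq0 => /eqP h; apply/eqP; rewrite -[RHS]h; ring.
- move=> j j3; have := congr1 (fun x : 'rV[int]_n.+1 => x 0 j) oo.
  by rewrite !mxE /coords /=; case: (nat_of_ord j) j3 => [|[|[|[|k]]]].
Qed.

Lemma key_fiber_step y y' (i : int) : key_rel y -> key_rel y' ->
  pt y 2 = pt y' 2 + c%:Z * e2 * i ->
  pt y 3 = pt y' 3 + c%:Z * e3 * i ->
  (`|i|%N)%:R <= 2 * X.
Proof.
move=> [yN _ _ _] [y'N _ _ _] h2 h3.
have b2 := yN (inord 2); have b2' := y'N (inord 2).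
have b3 := yN (inord 3); have b3' := y'N (inord 3).
have d2 : (c * `|e2| * `|i| <= 2 * N)%N.
  by rewrite -[c]/(`|c%:Z|%N) -!abszM; move: h2 b2 b2'; clear; lia.
have d3 : (c * `|e3| * `|i| <= 2 * N)%N.
  by rewrite -[c]/(`|c%:Z|%N) -!abszM; move: h3 b3 b3'; clear; lia.
rewrite mulrA ler_pdivlMr ?key_cE_gt0 // -!natrM ler_nat mulnC /E.
by rewrite maxnMr maxnMl geq_max d2 d3.
Qed.

Lemma key_outer_eq0 y y' : key_rel y -> key_rel y' ->
  pt y 2 = pt y' 2 -> pt y 3 = pt y' 3 ->
  (forall j : 'I_n.+1, (3 < j)%N -> y 0 j = y' 0 j) -> y = y'.
Proof.
move=> [_ hy ya _] [_ hy' y'a _] h2 h3 hj.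
have [[_ a0 _] _ _ _ _] := ok.
have h1 : pt y 1 = pt y' 1.
  by move: hy hy'; rewrite /on_model ya y'a h2 h3 => <- /(mulfI a0).
apply/rowP => j; have [j3|j3] := ltnP 3 j; first exact: hj.
rewrite -(coords_eta (y 0)) -(coords_eta (y' 0)) ya y'a h1 h2 h3 /coords /=.
by case: (nat_of_ord j) j3 => [|[|[|[|k]]]].
Qed.

Lemma key_fiber_count o r :
  count_le (fun y => [/\ key_rel y, key_outer y = o & key_class y = r]) (4 * X + 1).
Proof.
have X0 := key_X_ge0.
apply: sum_le_base => [|y0 [ry0 oy0 cy0]]; first lra.
rewrite -[4 * X + 1]mul1r.
apply: (@count_le_fiber _ 'rV[int]_n.+1 int _ (fun i : int => (`|i|%N)%:R <= 2 * X) (fun y i =>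
  [/\ pt y 2 = pt y0 2 + c%:Z * e2 * i,
    pt y 3 = pt y0 3 + c%:Z * e3 * i &
    forall j : 'I_n.+1, (3 < j)%N -> y 0 j = y0 0 j])) => //.
- move=> y [ry oy cy].
  have [i [h2 h3 hj]] := key_fiber_line ry ry0 (etrans oy (esym oy0)) (etrans cy (esym cy0)).
  by exists i => //; exact: key_fiber_step h2 h3.
- move=> i _; apply: count_le1 => y y' [[ry _ _] [h2 h3 hj]] [[ry' _ _] [h2' h3' hj']].
  apply: key_outer_eq0 => //; first by rewrite h2 h2'.
  - by rewrite h3 h3'.
  - by move=> j j3; rewrite hj // hj'.
apply: sum_leW (count_le_int (_ : 0 <= 2 * X)) _ _ _ => //; lra.
Qed.

(** From a base point [y0], coordinate 1 moves as y1 + 2 b i + mm i^2, where b = c (w2 e2 - d w3 e3)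
    / a and mm = c^2 N(e) / a are integers by [key_rel] and [key_ok]. Along this parabola [F] has
    formal leading coefficient mm^D [gam F], which is prime to [p]. *)
Lemma key_fiber_prime_count D (F : {mpoly int[n.+1]}) o r (p : nat) :
  F \is D.-homog -> prime p -> (1 + `|d| < p)%N -> ~~ (p %| c)%N ->
  ~~ (p%:Z %| gam F)%Z ->
  count_le (fun y => [/\ key_rel y, key_outer y = o, key_class y = r &
     (p%:Z %| ev (y 0%R) F)%Z]) ((8 * X / p%:R + 1) * (2 * D)%:R).
Proof.
move=> hF pp pd pc pg.
have X0 := key_X_ge0.
have [[_ a0 _] _ [_ ae] _ mp] := ok.
have pR : 0 < p%:R :> R by rewrite ltr0n prime_gt0.
apply: sum_le_base => [|y0 [ry0 oy0 cy0 _]].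
  by rewrite mulr_ge0 // addr_ge0 // divr_ge0 //; lra.
have [_ hy0 y0a [_ _ /dvdzP[b bE] _]] := ry0.
pose mm := ((c%:Z ^+ 2 * nrm d e2 e3) %/ a)%Z.
have mE : mm * a = c%:Z ^+ 2 * nrm d e2 e3 by rewrite divzK.
pose pol : 'I_n.+1 -> {poly int} := coords a%:P
  ((pt y0 1)%:P + (2 * b)%:P * 'X + mm%:P * 'X * 'X)
  ((pt y0 2)%:P + (c%:Z * e2)%:P * 'X) ((pt y0 3)%:P + (c%:Z * e3)%:P * 'X)
  (fun j => (y0 0 j)%:P).
have tpol i : topcoef 2 (pol i) (coords 0 mm 0 0 (fun=> 0) i).
  have t1 (x z : int) : topcoef 2 (x%:P + z%:P * 'X) 0.
    split; last by rewrite coefD coefC coefMX coefC.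
    by have [s _] := topcoef_lin x z; apply: leq_trans s _.
  rewrite /pol /coords; case: (val i) => [|[|[|[|k]]]] //; try exact: topcoef_const.
  rewrite -[mm in topcoef _ _ mm]add0r; apply: topcoefD; first exact: t1.
  split; last by rewrite !coefMX /= coefC.
  apply: leq_trans (size_polyMleq _ _) _; rewrite size_polyX.
  have : (size (mm%:P * 'X : {poly int})%R <= 2)%N.
    by have [] := topcoef_lin 0 mm; rewrite polyC0 add0r.
  by move: (size _) => k; clear; lia.
have [fsz fco] := topcoef_ev hF tpol.
rewrite (ev_apex _ hF) intz in fco.
have fp : ~~ (p%:Z %| (ev pol F)`_(2 * D))%Z.
  rewrite fco dvdzE abszM Euclid_dvdM // negb_or; apply/andP; split=> //.
  by rewrite abszX; apply: contraNN (mp p pp pd pc); rewrite Euclid_dvdX // => /andP[].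
rewrite -[(8 * X / p%:R + 1) * _]mul1r.
apply: (@count_le_fiber _ 'rV[int]_n.+1 int _ (fun i : int => (`|i|%N)%:R <= 2 * X /\
    (p%:Z %| (ev pol F).[i])%Z) (fun y i =>
  [/\ pt y 2 = pt y0 2 + c%:Z * e2 * i,
    pt y 3 = pt y0 3 + c%:Z * e3 * i &
    forall j : 'I_n.+1, (3 < j)%N -> y 0 j = y0 0 j])) => //.
- move=> y [ry oy cy py].
  have [i [h2 h3 hj]] := key_fiber_line ry ry0 (etrans oy (esym oy0)) (etrans cy (esym cy0)).
  exists i => //; split; first exact: key_fiber_step h2 h3.
  rewrite horner_ev.
  suff -> : ev (fun j => (pol j).[i]) F = ev (y 0) F by [].
  apply: eq_ev => j; rewrite -(coords_eta (y 0)) /pol.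
  have [_ hy ya _] := ry.
  have y1 : pt y 1 = pt y0 1 + 2 * b * i + mm * i * i.
    apply: (mulfI a0); move: hy hy0; rewrite /on_model ya y0a h2 h3 => ->.
    rewrite !mulrDr => ->.
    have -> : a * (mm * i * i) = (mm * a) * i * i by ring.
    have -> : a * (2 * b * i) = 2 * (b * a) * i by ring.
    by rewrite mE -bE !nrmE; ring.
  rewrite ya y1 h2 h3 /coords; case E1 : (val j) => [|[|[|[|k]]]]; rewrite !hornerE //.
  by rewrite hj //; move: E1 => /= ->.
- move=> i _; apply: count_le1 => y y' [[ry _ _ _] [h2 h3 hj]] [[ry' _ _ _] [h2' h3' hj']].
  apply: key_outer_eq0 => //; first by rewrite h2 h2'.
  - by rewrite h3 h3'.
  - by move=> j j3; rewrite hj // hj'.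
have L0 : 0 <= 2 * X by lra.
apply: sum_leW (count_le_poly_roots pp L0 fsz fp) _ _ _ => //.
by rewrite (_ : 4 * (2 * X) = 8 * X) //; ring.
Qed.

End Fibers.

(** * Counting the points with a given key *)

Lemma ev_bound (m : nat) (H : {mpoly int[m]}) :
  exists C : nat, forall (N : nat) (x : 'I_m -> int), (0 < N)%N ->
    (forall i, (`|x i| <= N)%N) -> (`|ev x H| <= C * N ^ msize H)%N.
Proof.
exists (\sum_(a <- msupp H) `|H@_a|)%N => N x N0 xN.
rewrite evE big_distrl /= big_seq.
have -> : (\sum_(a <- msupp H) `|H@_a| * N ^ msize H =
    \sum_(a <- msupp H | a \in msupp H) `|H@_a| * N ^ msize H)%N.
  by rewrite [LHS]big_seq.
apply: (big_ind2 (fun (z : int) (k : nat) => `|z| <= k)%N) => //.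
  by move=> z k z' k'; clear; lia.
move=> a aH; rewrite intz abszM leq_mul //.
apply: (@leq_trans (N ^ mdeg a)%N); last first.
  by rewrite leq_pexp2l // ltnW // msize_mdeg_lt.
rewrite mdegE; elim/big_rec2: _ => [|i k z _ ih]; first by rewrite expn0.
rewrite expnD abszM leq_mul // abszX.
by case: (a i) => [|b]; rewrite ?expn0 // leq_exp2r.
Qed.

Lemma ev_line (K : comNzRingType) (m : nat) (H : {mpoly int[m]}) (u : 'I_m -> K) j :
  exists2 p : {poly K}, (size p <= (msize H).+1)%N &
    forall t, ev (fun i => if i == j then t else u i) H = p.[t].
Proof.
pose A i : {poly K} := if i == j then 'X else (u i)%:P.
exists (ev A H); last first.
  move=> t; rewrite horner_ev; apply: eq_ev => i; rewrite /A.
  by case: (i == j); rewrite ?hornerX ?hornerC.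
rewrite evE big_seq; apply: (big_ind (fun p : {poly K} => size p <= (msize H).+1)%N).
- by rewrite size_poly0.
- by move=> p q hp hq; apply: leq_trans (size_polyD _ _) _; rewrite geq_max hp hq.
move=> a aS; have aH : (mdeg a < msize H)%N := msize_mdeg_lt aS.
apply: (@leq_trans (mdeg a).+1); last by rewrite ltnS ltnW.
have -> : (H@_a)%:~R = ((H@_a)%:~R)%:P :> {poly K} by rewrite rmorph_int.
have prodM (p q : {poly K}) k l : (size p <= k.+1)%N -> (size q <= l.+1)%N ->
    (size (p * q)%R <= (k + l).+1)%N.
  move=> hp hq; apply: leq_trans (size_polyMleq _ _) _.
  by apply: (leq_trans (leq_pred2 (leq_add hp hq))); clear; lia.
rewrite -[mdeg a]add0n; apply: (@prodM _ _ _ _); first by rewrite size_polyC leq_b1.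
rewrite mdegE; elim/big_rec2: _ => [|i k p _ ih]; first by rewrite size_poly1.
apply: (@prodM _ _ _ _ _ ih); elim: (a i) => [|b ihb]; first by rewrite expr0 size_poly1.
rewrite exprS; apply: (@prodM _ _ 1%N b _ ihb).
by rewrite /A; case: ifP => _; rewrite ?size_polyX // (leq_trans (size_polyC_leq1 _)).
Qed.

Definition free_idx (n : nat) : seq 'I_n.+1 := [seq j : 'I_n.+1 <- enum 'I_n.+1 | (3 < j)%N].

Lemma size_free_idx (n : nat) : (3 <= n)%N -> size (free_idx n) = (n - 3)%N.
Proof.
move=> n3; rewrite size_filter -(count_map val) val_enum_ord.
have -> : n.+1 = (4 + (n - 3))%N by lia.
rewrite iotaD count_cat /= add0n.
have -> : count (fun x => 3 < x)%N (iota 4 (n - 3)) = count predT (iota 4 (n - 3)).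
  by apply: eq_in_count => x; rewrite mem_iota => /andP[].
by rewrite count_predT size_iota.
Qed.

Lemma mem_free_idx n (j : 'I_n.+1) : (j \in free_idx n) = (3 < j)%N.
Proof. by rewrite mem_filter mem_enum andbT. Qed.

Lemma ord_cases n (j : 'I_n.+1) :
  [\/ (3 < j)%N, j = inord 0, j = inord 1 | j = inord 2 \/ j = inord 3].
Proof.
have E k : val j = k -> j = inord k.
  by move=> e; apply: val_inj; rewrite /= inordK -e //= ltn_ord.
have [j3|j3] := ltnP 3 j; first by constructor 1.
case e : (val j) j3 => [|[|[|[|k]]]] // _.
- by constructor 2; exact: E.
- by constructor 3; exact: E.
- by constructor 4; left; exact: E.
- by constructor 4; right; exact: E.
Qed.

Lemma notin_free_cons n (j : 'I_n.+1) : (3 <= n)%N ->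
  j \notin inord 1 :: free_idx n -> [\/ j = inord 0, j = inord 2 | j = inord 3].
Proof.
move=> n3; rewrite inE negb_or mem_free_idx => /andP[j1 j3].
case: (ord_cases j) => [||e|[]]; rewrite ?(negPf j3) //.
- by constructor 1.
- by rewrite e eqxx in j1.
- by constructor 2.
- by constructor 3.
Qed.

Lemma free_idx_neq1 n j : (3 <= n)%N -> j \in free_idx n -> (j == inord 1) = false.
Proof.
move=> n3; rewrite mem_free_idx => j3; apply/eqP => e; move: j3.
by rewrite e inordK //; lia.
Qed.

Lemma prod_seq_const (R : comNzRingType) (I : eqType) (J : seq I) (c : I -> R) x :
  (forall j, j \in J -> c j = x) -> \prod_(j <- J) c j = x ^+ size J.
Proof.
move=> h; rewrite big_seq (eq_bigr (fun=> x)); last by move=> j /h.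
by rewrite -big_seq big_const_seq count_predT iter_mulr_1.
Qed.

(** The factor [x] on the left avoids the exponent [size J - 1]. *)
Lemma zero_bound_const (R : realType) (m s : nat) (J : seq 'I_m) (c : 'I_m -> R) x :
  (forall j, j \in J -> c j = x) ->
  zero_bound s J c * x = s%:R * (size J)%:R * x ^+ size J.
Proof.
elim: J => [|j J ih] h /=; first by rewrite mul0r mulr0 mul0r.
have hJ i : i \in J -> c i = x by move=> iJ; apply: h; rewrite inE iJ orbT.
rewrite mulrDl (prod_seq_const hJ) h ?mem_head // -[x * _ * x]mulrA ih //.
by rewrite exprS -natr1; ring.
Qed.

Section KeyCount.
Variables (R : realType) (n m D : nat) (d : int) (G : 'I_m -> {mpoly int[n.+1]}).
Variable t0 : nat.
Hypothesis n3 : (3 <= n)%N.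
Hypothesis hG : forall k, G k \is D.+1.-homog.
Hypothesis g0 : gam (comb G t0) != 0.
Hypothesis small : small_locus (cone_locus d G).

Definition elim_comb (t : nat) := elim_poly d (comb G t0) (comb G t).
Definition elim_range : nat := (m * (2 * D + 3)).+1.
Definition elim_size : nat := \max_(t < elim_range) msize (elim_comb t).

Definition sieve_at (M : R) (y : 'rV[int]_n.+1) (p : nat) : Prop :=
  [/\ prime p, M < p%:R & forall k, (p%:Z %| ev (y 0%R) (G k))%Z].

Definition pair_gcd (e2 e3 : int) : R := (gcdn `|e2| `|e3|)%:R.
Definition key_ratio (N c : nat) (e2 e3 : int) : R :=
  N%:R / (c%:R * (maxn `|e2| `|e3|)%:R).

(** The outer data fill a box. Coordinate 1 carries the determinant, a multiple of c [cofac a c],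
    hence of an integer of size at least c E^2, and it is at most 2 N E; this leaves 8 X + 1 values.
    The other free coordinates take at most 2 N + 1 <= 3 N values. *)
Lemma key_count_zero (N c : nat) (e2 e3 a : int) (t : nat) :
  key_ok d N c e2 e3 a -> (0 < N)%N -> (t < elim_range)%N ->
  (exists x : 'I_n.+1 -> algC, [/\ x (inord 0) = a%:~R, x (inord 2) = e2%:~R,
     x (inord 3) = e3%:~R & ev x (elim_comb t) != 0]) ->
  let X := key_ratio N c e2 e3 in
  let J := inord 1 :: free_idx n in
  let cc j := if j == inord 1 then 8 * X + 1 else 3 * N%:R in
  let v0 : 'rV[int]_n.+1 := \row_i coords a 0 e2 e3 (fun=> 0) i in
  let S j (z : int) := if j == inord 1 then
      (c%:Z * cofac a c %| z)%Z /\ (`|z| <= 2 * N * maxn `|e2| `|e3|)%N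
    else (`|z| <= N)%N in
  [/\ count_le (fun v => in_box J S v0 v /\ ev (v 0) (elim_comb t) = 0)
        (zero_bound elim_size J cc),
      count_le (in_box J S v0) (\prod_(j <- J) cc j),
      forall y, key_rel d N c e2 e3 a y -> in_box J S v0 (key_outer e2 e3 a y) &
      forall v, in_box J S v0 v -> forall i, (`|v 0%R i| <= 2 * N ^ 2)%N].
Proof.
move=> ok N0 tr [x [x0 x2 x3 xH]] X J cc v0 S.
have [[/andP[c0 cN] a0 aN] [E0 EE cE] _ [q0 qE] _] := ok.
set E := maxn `|e2| `|e3| in E0 EE cE qE.
have cS j : j \in J -> count_le (S j) (cc j).
  rewrite /S /cc inE; case: eqP => [_ _|_ _].
    have q1 : (0 < `|(c%:Z * cofac a c)%R|)%N.
      by rewrite absz_gt0 mulf_neq0 // eqz_nat -lt0n.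
    have L0 : 0 <= (2 * N * E)%N%:R :> R by [].
    have h := count_le_class (E := fun z : int => (c%:Z * cofac a c %| z)%Z) L0 q1 _.
    apply: sum_leW (h _) _ _ _ => //.
    - move=> i j' hi hj; rewrite dvdzE /= -dvdzE; exact: rpredB.
    - by move=> z [zd zb]; rewrite ler_nat.
    rewrite lerD2r ler_pdivrMr ?ltr0n //.
    have cE0 : 0 < c%:R * E%:R :> R by rewrite mulr_gt0 // ltr0n.
    apply: (@le_trans _ _ (8 * X * (c * (E * E))%N%:R)); last first.
      rewrite ler_wpM2l ?ler_nat ?abszM ?leq_mul //.
      by rewrite mulr_ge0 // divr_ge0 // ltW.
    rewrite /X /key_ratio -/E !natrM.
    suff -> : 8 * (N%:R / (c%:R * E%:R)) * (c%:R * (E%:R * E%:R)) = 8 * N%:R * E%:R :> R.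
      by rewrite (_ : 4 * (2%:R * N%:R * E%:R) = 8 * N%:R * E%:R) //; ring.
    by field; rewrite !pnatr_eq0 -!lt0n c0 E0.
  apply: sum_leW (count_le_int (_ : 0 <= N%:R)) _ _ _ => //.
  - by move=> z zN; rewrite ler_nat.
  - by have : 1 <= N%:R :> R by [rewrite ler1n]; lra.
have uJ : uniq J.
  rewrite /J /= filter_uniq ?enum_uniq // andbT; apply/negP => /(free_idx_neq1 n3).
  by rewrite eqxx.
split.
- have sz : (msize (elim_comb t) <= elim_size)%N.
    exact: (leq_bigmax (F := fun t : 'I_elim_range => msize (elim_comb t)) (Ordinal tr)).
  have := @box_zero_count R n.+1 algC (fun z => ev z (elim_comb t)) elim_size J S cc v0 x.
  move=> h; apply: sum_leW (h _ _ uJ cS _ xH) _ _ _ => //.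
  + by move=> u w uw; exact: eq_ev.
  + move=> u j; have [p psz pE] := ev_line (elim_comb t) u j.
    by exists p => //; apply: leq_trans psz _; rewrite ltnS.
  + move=> j /(notin_free_cons n3)[] ->; rewrite mxE ?coords0 ?coords2 ?coords3 //.
  + move=> v [bv H0]; split=> //.
    have := ev_morph (intr : {rmorphism int -> algC}) (v 0) (elim_comb t).
    by rewrite H0 rmorph0 => <-.
- exact: box_count.
- move=> y [yN _ ya [_ _ _ qd]]; split=> j.
    move=> /(notin_free_cons n3)[] ->; rewrite !mxE ?coords0 ?coords2 ?coords3 //.
  rewrite /S inE; case: eqP => [-> _|_ /=].
    rewrite mxE coords1 //; split=> //.
    have b2 := yN (inord 2); have b3 := yN (inord 3).
    have e2E : (`|e2| <= E)%N by exact: leq_maxl.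
    have e3E : (`|e3| <= E)%N by exact: leq_maxr.
    have p2 : (`|(pt y 2 * e3)%R| <= N * E)%N by rewrite abszM leq_mul.
    have p3 : (`|(pt y 3 * e2)%R| <= N * E)%N by rewrite abszM leq_mul.
    by move: p2 p3; clear; lia.
  rewrite mem_free_idx mxE /coords /= => j3; move: (yN j).
  by case: (nat_of_ord j) j3 => [|[|[|[|k]]]].
move=> v [bv Sv] i.
have EN : (E <= N)%N by apply: leq_trans EE; rewrite leq_pmulr.
have e2E : (`|e2| <= E)%N by exact: leq_maxl.
have e3E : (`|e3| <= E)%N by exact: leq_maxr.
have NN : (N <= 2 * N ^ 2)%N by move: N0; clear; nia.
have [iJ|iJ] := boolP (i \in J).
  have := Sv i iJ; rewrite /S; case: eqP => _.
    move=> [_ h]; apply: leq_trans h _; rewrite -mulnA leq_mul2l /= -mulnn.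
    by rewrite leq_mul2l EN orbT.
  by move=> h; exact: leq_trans h NN.
rewrite bv // mxE; apply: leq_trans NN.
by case/(notin_free_cons n3): iJ => ->; rewrite ?coords0 ?coords2 ?coords3 //;
  apply: leq_trans EN.
Qed.

End KeyCount.

Section KeyCountTotal.
Variables (R : realType) (n m D : nat) (d : int) (G : 'I_m -> {mpoly int[n.+1]}).
Variable t0 : nat.
Hypothesis n3 : (3 <= n)%N.
Hypothesis hG : forall k, G k \is D.+1.-homog.
Hypothesis g0 : gam (comb G t0) != 0.
Hypothesis small : small_locus (cone_locus d G).

Lemma count_le_lt (g : nat) : count_le (fun r : nat => (r < g)%N) (g%:R : R).
Proof.
rewrite -{2}(size_iota 0 g); apply: count_le_seq => r rg.
by rewrite mem_iota.
Qed.

Lemma count_le_pair (A B : eqType) (P : A -> Prop) (Q : B -> Prop) (a b : R) :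
  count_le P a -> count_le Q b -> count_le (fun u : A * B => P u.1 /\ Q u.2) (b * a).
Proof.
move=> Pa Qb.
apply: (@count_le_fiber _ _ _ _ P (fun u x => u.1 = x)) => //.
- exact: sum_le_ge0 Qb.
- by move=> u [Pu _]; exists u.1.
move=> x _; apply: (@sum_le_inj _ _ _ _ Q snd _ (fun=> 1)) => //.
- by move=> u [[]].
- by move=> [u1 u2] [w1 w2] [_ /= ->] [_ /= ->] ->.
Qed.

(** Points are split by whether the resultant vanishes at their outer data. If it does,
    [box_zero_count] makes the outer data rare and whole fibres are counted. If not, p is one of at
    most [T] divisors of its value and [key_fiber_prime_count] applies. The classes modulo gcd(e)
    give the factor [pair_gcd]. *)
Lemma key_count : exists2 K : R, 0 <= K &
  forall (N c : nat) (e2 e3 a : int) (M T : R),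
  key_ok d N c e2 e3 a -> (0 < N)%N -> 1 <= T -> (1 + `|d|)%:R <= M ->
  (`|gam (comb G t0)|%N)%:R <= M ->
  (forall t (x : 'I_n.+1 -> int), (t < elim_range m D)%N ->
     (forall i, (`|x i| <= 2 * N ^ 2)%N) -> ev x (elim_comb d G t0 t) != 0 ->
     (tau `|ev x (elim_comb d G t0 t)|)%:R <= T) ->
  let X := key_ratio R N c e2 e3 in
  count_le (fun y => key_rel d N c e2 e3 a y /\
      exists2 p, sieve_at G M y p & ~~ (p %| c)%N)
    (K * T * pair_gcd R e2 e3 * N%:R ^+ (n - 3) * (X + X ^+ 2 / M + X ^+ 2 / N%:R)).
Proof.
pose kap : R := (1 + `|d|)%:R.
pose s : R := (elim_size D d G t0)%:R.
pose k : R := (n - 3)%:R.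
(* The two summands are the constants of [leB] and [leA], where each [+ 1] added to a multiple of
   [X] is replaced by [kap * X], which is at least 1. *)
pose K := 3 ^+ (n - 3) * (s * (4 + kap) * (1 + (8 + kap) * k) +
   (8 + kap) * (2 * D.+1)%:R * 8).
have kap0 : 0 <= kap by []. have s0 : 0 <= s by []. have k0 : 0 <= k by [].
have D0 : 0 <= (2 * D.+1)%:R :> R by [].
exists K.
  rewrite mulr_ge0 ?exprn_ge0 // addr_ge0 // !mulr_ge0 ?addr_ge0 ?mulr_ge0 ?addr_ge0 //.
move=> N c e2 e3 a M T ok N0 T1 dM gM tauT X.
have M0 : 0 < M by apply: lt_le_trans dM; rewrite ltr0n.
have X0 : 0 <= X := key_X_ge0 R ok.
have X1 : 1 <= kap * X := key_X_large R ok.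
have [[_ a0 _] _ [ne _] _ _] := ok.
have [t [tr gt] xP] := elim_nonzero n3 hG g0 small a0 ne.
have [czero cbox inbox bnd] := @key_count_zero R n m D d G t0 n3 N c e2 e3 a t ok N0 tr xP.
move: czero cbox inbox bnd; rewrite -/X.
set J := inord 1 :: _; set cc := (fun j => if _ then 8 * X + 1 else _).
set v0 := \row_i _; set S := (fun j (z : int) => if _ then _ /\ _ else _) => czero cbox inbox bnd.
pose g := `|gcdz e2 e3|%N.
have gE : pair_gcd R e2 e3 = g%:R by [].
have ccJ j : j \in free_idx n -> cc j = 3 * N%:R.
  by move=> jJ; rewrite /cc (free_idx_neq1 n3 jJ).
have prodE : \prod_(j <- J) cc j = (8 * X + 1) * (3 * N%:R) ^+ (n - 3).
  by rewrite big_cons (prod_seq_const ccJ) size_free_idx // /cc eqxx.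
have XM1 : 0 <= 8 * X / M + 1.
  by apply: addr_ge0 => //; apply: divr_ge0; [exact: mulr_ge0|exact: ltW].
have NR0 : 0 < N%:R :> R by rewrite ltr0n.
have zbE : zero_bound (elim_size D d G t0) J cc = (3 * N%:R) ^+ (n - 3) *
    (s + (8 * X + 1) * s * k / (3 * N%:R)).
  have N3 : 3 * N%:R != 0 :> R by rewrite gt_eqF //; lra.
  have := zero_bound_const (elim_size D d G t0) ccJ.
  rewrite size_free_idx // => h.
  rewrite /J /= (prod_seq_const ccJ) size_free_idx // {1}/cc eqxx.
  by rewrite -[zero_bound _ _ _](mulfK N3) h -/s -/k; ring.
pose PB (y : 'rV[int]_n.+1) := key_rel d N c e2 e3 a y /\
  ev (key_outer e2 e3 a y 0) (elim_comb d G t0 t) = 0.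
have cB : count_le PB ((4 * X + 1) * (g%:R * zero_bound (elim_size D d G t0) J cc)).
  apply: (@count_le_fiber _ _ _ _ (fun u : 'rV[int]_n.+1 * nat =>
      (in_box J S v0 u.1 /\ ev (u.1 0) (elim_comb d G t0 t) = 0) /\ (u.2 < g)%N)
      (fun y u => key_outer e2 e3 a y = u.1 /\ key_class c e2 e3 y = u.2)).
  - lra.
  - move=> y [ry Hy]; exists (key_outer e2 e3 a y, key_class c e2 e3 y) => //=.
    by split; [split=> //; exact: inbox|exact: key_class_lt ok y].
  - move=> [o r] _; apply: sum_leW (key_fiber_count R n3 ok (o := o) (r := r)) _ _ _ => //.
    by move=> y [[ry _] [/= oy cy]].
  exact: (count_le_pair czero (count_le_lt (g := g))).
pose PA (y : 'rV[int]_n.+1) := [/\ key_rel d N c e2 e3 a y,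
  ev (key_outer e2 e3 a y 0) (elim_comb d G t0 t) != 0 &
  exists2 p, sieve_at G M y p & ~~ (p %| c)%N].
(* The label is now (outer data, class, prime): the fibre over it is counted first, then the primes
   over given outer data, then the outer data. *)
have cA : count_le PA (((8 * X / M + 1) * (2 * D.+1)%:R) *
    (T * (g%:R * \prod_(j <- J) cc j))).
  apply: (@count_le_fiber _ _ _ _ (fun u : 'rV[int]_n.+1 * nat * nat =>
      [/\ in_box J S v0 u.1.1 /\ (u.1.2 < g)%N,
         ev (u.1.1 0) (elim_comb d G t0 t) != 0 /\ prime u.2,
         (u.2%:Z %| ev (u.1.1 0%R) (elim_comb d G t0 t))%Z,
         M < u.2%:R & ~~ (u.2 %| c)%N])
      (fun y u => [/\ key_outer e2 e3 a y = u.1.1, key_class c e2 e3 y = u.1.2 &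
         forall k, (u.2%:Z %| ev (y 0%R) (G k))%Z])).
  - exact: mulr_ge0.
  - move=> y [ry Hy [p [pp Mp pG] pc]].
    exists (key_outer e2 e3 a y, key_class c e2 e3 y, p) => //=.
    split=> //; [by split; [exact: inbox|exact: key_class_lt ok y]|].
    have [_ hy ya _] := ry.
    have := elim_dvd e2 e3 n3 (comb_homog t0 hG) (comb_homog t hG) g0 gt hy
      (comb_dvd t0 pG) (comb_dvd t pG).
    rewrite ya; suff -> : ev (coords a (y 0 (inord 2) * e3 - y 0 (inord 3) * e2) e2 e3
      (y 0)) (elim_poly d (comb G t0) (comb G t)) =
      ev (key_outer e2 e3 a y 0) (elim_comb d G t0 t) by [].
    by apply: eq_ev => i; rewrite mxE.
  - move=> [[o r] p] [_ [_ pp] _ Mp pc] /=.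
    have pd : (1 + `|d| < p)%N by rewrite -(ltr_nat R) (le_lt_trans dM).
    have pg : ~~ (p%:Z %| gam (comb G t0))%Z.
      apply/negP => /dvdn_leq; rewrite absz_gt0 g0 => /(_ isT) /= pg.
      by have := le_lt_trans gM Mp; rewrite ltr_nat ltnNge pg.
    have := key_fiber_prime_count R n3 ok (o := o) (r := r) (comb_homog t0 hG) pp pd pc pg.
    move=> h; apply: sum_leW h _ _ _ => //.
      by move=> y [[ry _ _] [/= oy cy yG]]; split=> //; exact: comb_dvd.
    apply: ler_wpM2r => //; rewrite lerD2r; apply: ler_wpM2l; first exact: mulr_ge0.
    by rewrite lef_pV2 ?posrE ?ltr0n ?prime_gt0 // ltW.
  apply: (@count_le_fiber _ _ _ _ (fun u : 'rV[int]_n.+1 * nat =>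
      in_box J S v0 u.1 /\ (u.2 < g)%N /\ ev (u.1 0) (elim_comb d G t0 t) != 0)
      (fun u w => u.1 = w)).
  - by apply: le_trans T1.
  - by move=> [u p] [[? ?] [? _] _ _ _]; exists u.
  - move=> [o r] [/= ob [_ oH]].
    have tT := tauT t (o 0) tr (bnd o ob) oH.
    apply: (@sum_leW _ _ _ (fun u : 'rV[int]_n.+1 * nat * nat => u.2 \in divisors `|ev (o 0) (elim_comb d G t0 t)| /\ u.1 = (o, r)) _ (fun=> 1) _ _ _ _ _ tT) => //.
      apply: (@sum_le_inj _ _ _ _ (fun p => p \in divisors `|ev (o 0) (elim_comb d G t0 t)|) snd _ (fun=> 1)) => //.
      - by move=> u [].
      - by move=> [u1 u2] [w1 w2] [_ /= ->] [_ /= ->] ->.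
      exact: count_le_seq.
    move=> [[o' r'] p] [[_ _ /= pd _ _] /= [eo <-]]; split; last by rewrite eo.
    by move: oH pd; rewrite -eo /= => oH pd; rewrite -dvdn_divisors ?absz_gt0.
  have h := count_le_pair cbox (count_le_lt (g := g)).
  apply: sum_leW h _ _ _ => //.
  by move=> u [ub [ur _]].
apply: sum_leW (sum_le_or cB cA) _ _ _ => //.
  move=> y [ry sv]; have [H0|H0] := eqVneq (ev (key_outer e2 e3 a y 0) (elim_comb d G t0 t)) 0.
    by left.
  by right.
rewrite prodE zbE gE exprMn.
have XM0 : 0 <= X ^+ 2 / M by rewrite divr_ge0 ?exprn_ge0 // ltW.
have XN0 : 0 <= X ^+ 2 / N%:R by rewrite divr_ge0 ?exprn_ge0.
have g0' : 0 <= g%:R :> R by [].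
have P0 : 0 <= 3 ^+ (n - 3) * N%:R ^+ (n - 3) :> R by rewrite mulr_ge0 ?exprn_ge0.
set P := 3 ^+ (n - 3) * N%:R ^+ (n - 3) in P0 *.
have e4 : 4 * X + 1 <= (4 + kap) * X by lra.
have e8 : 8 * X + 1 <= (8 + kap) * X by lra.
have leB : (4 * X + 1) * (g%:R * (P * (s + (8 * X + 1) * s * k / (3 * N%:R)))) <=
    g%:R * P * (s * (4 + kap) * (X + (8 + kap) * k * (X ^+ 2 / N%:R))).
  apply: (@le_trans _ _ (((4 + kap) * X) *
      (g%:R * (P * (s + ((8 + kap) * X) * s * k / N%:R))))).
    apply: ler_pM => //; first lra.
      apply: mulr_ge0 => //; apply: mulr_ge0 => //; apply: addr_ge0 => //.
      apply: divr_ge0; last exact: mulr_ge0.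
      by apply: mulr_ge0 => //; apply: mulr_ge0 => //; lra.
    apply: ler_wpM2l => //; apply: ler_wpM2l => //; rewrite lerD2l; apply: ler_pM.
    - by apply: mulr_ge0 => //; apply: mulr_ge0 => //; lra.
    - by rewrite invr_ge0 mulr_ge0.
    - by apply: ler_wpM2r => //; exact: ler_wpM2r.
    by rewrite lef_pV2 ?posrE //; lra.
  by rewrite le_eqVlt; apply/orP; left; apply/eqP; ring.
have leA : (8 * X / M + 1) * (2 * D.+1)%:R * (T * (g%:R * ((8 * X + 1) * P))) <=
    g%:R * P * T * ((8 + kap) * (2 * D.+1)%:R * (X + 8 * (X ^+ 2 / M))).
  apply: (@le_trans _ _ ((8 * X / M + 1) * (2 * D.+1)%:R *
     (T * (g%:R * (((8 + kap) * X) * P))))).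
    apply: ler_wpM2l; first exact: mulr_ge0.
    apply: ler_wpM2l; first lra.
    by apply: ler_wpM2l => //; exact: ler_wpM2r.
  by rewrite le_eqVlt; apply/orP; left; apply/eqP; ring.
apply: (le_trans (lerD leB leA)).
rewrite /K.
have -> : 3 ^+ (n - 3) * (s * (4 + kap) * (1 + (8 + kap) * k) +
   (8 + kap) * (2 * D.+1)%:R * 8) * T * g%:R * N%:R ^+ (n - 3) *
   (X + X ^+ 2 / M + X ^+ 2 / N%:R) =
   g%:R * P * (s * (4 + kap) * (1 + (8 + kap) * k) * (X + X ^+ 2 / M + X ^+ 2 / N%:R)) * T
   + g%:R * P * T * ((8 + kap) * (2 * D.+1)%:R * (8 * (X + X ^+ 2 / M + X ^+ 2 / N%:R))).
  by rewrite /P; ring.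
set x2M := X ^+ 2 / M in XM0 *; set x2N := X ^+ 2 / N%:R in XN0 *.
have gP : 0 <= g%:R * P by rewrite mulr_ge0.
have k8 : 0 <= (8 + kap) * k by apply: mulr_ge0 => //; exact: addr_ge0.
have s4 : 0 <= s * (4 + kap) by apply: mulr_ge0 => //; exact: addr_ge0.
have X3 : 0 <= X + x2M + x2N by apply: addr_ge0 => //; exact: addr_ge0.
apply: lerD.
  apply: (@le_trans _ _ (g%:R * P * (s * (4 + kap) * (1 + (8 + kap) * k) * (X + x2M + x2N)))).
    apply: ler_wpM2l => //; rewrite -[leRHS]mulrA; apply: ler_wpM2l => //.
    move: ((8 + kap) * k) k8 => w w0.
    have h1 : 0 <= w * X by exact: mulr_ge0.
    have h2 : 0 <= w * x2M by exact: mulr_ge0.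
    by rewrite mulrDl mul1r !mulrDr; lra.
  apply: ler_peMr => //; apply: mulr_ge0 => //; apply: mulr_ge0 => //.
  by apply: mulr_ge0 => //; exact: addr_ge0.
apply: ler_wpM2l; first by apply: mulr_ge0 => //; lra.
by apply: ler_wpM2l; [apply: mulr_ge0 => //; exact: addr_ge0|lra].
Qed.

End KeyCountTotal.

(** * Summation over the Thue vectors *)

Section SumAlgebra.
Variables (R : realType) (T : eqType).
Implicit Types (P : T -> Prop) (w : T -> R).

Lemma sum_leD P w w' W W' : sum_le P w W -> sum_le P w' W' ->
  sum_le P (fun x => w x + w' x) (W + W').
Proof. by move=> h h' s us sP; rewrite big_split lerD ?h ?h'. Qed.

Lemma sum_leZ P w W c : 0 <= c -> sum_le P w W -> sum_le P (fun x => c * w x) (c * W).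
Proof. by move=> c0 h s us sP; rewrite -mulr_sumr ler_wpM2l // h. Qed.

End SumAlgebra.

Section GcdSums.
Variable R : realType.

Lemma count_le_multiples (E g : nat) : (0 < g)%N -> (g <= E)%N ->
  count_le (fun i : int => (`|i| <= E)%N /\ (g%:Z %| i)%Z) (5 * E%:R / g%:R : R).
Proof.
move=> g0 gE; have gR : 0 < g%:R :> R by rewrite ltr0n.
have h := count_le_class (L := E%:R) (E := fun i : int => (g%:Z %| i)%Z)
   (ler0n R E) g0 (fun i j => @rpredB _ _ _ _).
apply: sum_leW h _ _ _ => //.
  by move=> i [iE gi]; rewrite ler_nat.
have : 1 <= E%:R / g%:R :> R by rewrite ler_pdivlMr // mul1r ler_nat.
by rewrite -!mulrA; move: (E%:R / g%:R) => x; lra.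
Qed.

(** The gcd g divides E. Each of the four sides of the square max(|e2|, |e3|) = E has at most 5 E /
    g points divisible by g; weighted by g this gives 20 E for each of the at most [T] divisors. *)
Lemma sum_le_gcd (E : nat) (T : R) : (0 < E)%N -> (tau E)%:R <= T ->
  sum_le (fun e : int * int => maxn `|e.1| `|e.2| = E)
    (fun e => pair_gcd R e.1 e.2) (20 * E%:R * T).
Proof.
move=> E0 ET.
have dE : count_le (fun g : nat => g \in divisors E) T.
  have h : count_le (fun g : nat => g \in divisors E) ((size (divisors E))%:R : R).
    exact: count_le_seq.
  by apply: sum_leW h _ _ ET.
have E0R : 0 <= 20 * E%:R :> R by rewrite mulr_ge0.
apply: (@sum_le_rel _ _ _ _ (fun g : nat => g \in divisors E)
  (fun e g => gcdn `|e.1| `|e.2| = g) _ (fun=> 20 * E%:R)); last first.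
- exact: sum_le_const.
- move=> g; rewrite -dvdn_divisors // => gE.
  have g0 : (0 < g)%N := dvdn_gt0 E0 gE.
  have gle : (g <= E)%N by rewrite dvdn_leq.
  have gR : 0 < g%:R :> R by rewrite ltr0n.
  have cm := count_le_multiples g0 gle.
  have -> : 20 * E%:R = g%:R * (5 * E%:R / g%:R + 5 * E%:R / g%:R + (5 * E%:R / g%:R +
     5 * E%:R / g%:R)) :> R by field; rewrite gt_eqF.
  have c1 (x : int) : count_le (fun e : int * int => e.1 = x /\
      ((`|e.2| <= E)%N /\ (g%:Z %| e.2)%Z)) (5 * E%:R / g%:R : R).
    apply: (@sum_le_inj _ _ _ _ _ snd _ (fun=> 1) _ _ _ _ cm) => //.
      by move=> e [].
    by move=> [u v] [u' v'] [/= -> _] [/= -> _] ->.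
  have c2 (x : int) : count_le (fun e : int * int => e.2 = x /\
      ((`|e.1| <= E)%N /\ (g%:Z %| e.1)%Z)) (5 * E%:R / g%:R : R).
    apply: (@sum_le_inj _ _ _ _ _ fst _ (fun=> 1) _ _ _ _ cm) => //.
      by move=> e [].
    by move=> [u v] [u' v'] [/= -> _] [/= -> _] ->.
  apply: (sum_le_const (ltW gR)); last first.
    by move=> e [_ <-].
  have h := sum_le_or (sum_le_or (c1 E%:Z) (c1 (- E%:Z))) (sum_le_or (c2 E%:Z) (c2 (- E%:Z))).
  apply: sum_leW h _ _ _ => // -[u v] /= [uvE uvg].
  have gu : (g%:Z %| u)%Z by rewrite -uvg dvdzE /= dvdn_gcdl.
  have gv : (g%:Z %| v)%Z by rewrite -uvg dvdzE /= dvdn_gcdr.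
  have uE : (`|u| <= E)%N by rewrite -uvE leq_maxl.
  have vE : (`|v| <= E)%N by rewrite -uvE leq_maxr.
  have [e|e] : `|u|%N = E \/ `|v|%N = E by move: uvE; clear; lia.
    have [->|->] : u = E%:Z \/ u = - E%:Z by move: e; clear; lia.
      by left; left.
    by left; right.
  have [->|->] : v = E%:Z \/ v = - E%:Z by move: e; clear; lia.
    by right; left.
  by right; right.
- move=> [u v] /= uvE; exists (gcdn `|u| `|v|) => //.
  rewrite -dvdn_divisors // -uvE; rewrite /maxn; case: ifP => _.
    exact: dvdn_gcdr.
  exact: dvdn_gcdl.
Qed.

Lemma count_le_sqrt (N : nat) :
  count_le (fun E : nat => (0 < E)%N /\ (E * E <= N)%N) (Num.sqrt N%:R : R).
Proof.
pose t := Num.truncn (Num.sqrt N%:R : R).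
have h : count_le (fun E : nat => (0 < E)%N /\ (E * E <= N)%N) ((size (iota 1 t))%:R : R).
  apply: count_le_seq => E [E0 EN]; rewrite mem_iota E0 add1n ltnS.
  rewrite truncn_ge_nat ?sqrtr_ge0 // -[leLHS]ger0_norm // -sqrtr_sqr.
  by rewrite ler_wsqrtr // expr2 -natrM ler_nat.
apply: sum_leW h _ _ _ => //.
by rewrite size_iota truncn_le sqrtr_ge0.
Qed.

Lemma count_le_int_divisors (k : int) (T : R) : k != 0 -> (tau `|k|)%:R <= T ->
  count_le (fun a : int => (a %| k)%Z) (2 * T).
Proof.
move=> k0 kT; have kn : (0 < `|k|)%N by rewrite absz_gt0.
have h : count_le (fun a : int => (a %| k)%Z)
    ((size ([seq Posz x | x <- divisors `|k|] ++ [seq - Posz x | x <- divisors `|k|]))%:R : R).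
  apply: count_le_seq => a; rewrite dvdzE => ak; rewrite mem_cat.
  have ad : `|a|%N \in divisors `|k| by rewrite -dvdn_divisors.
  have [a0|a0] := lerP 0 a; apply/orP; [left|right]; apply/mapP; exists `|a|%N => //.
    by rewrite gez0_abs.
  by rewrite lez0_abs ?opprK // ltW.
apply: sum_leW h _ _ _ => //.
by rewrite size_cat !size_map natrD -/(tau _); lra.
Qed.

Lemma sum_inv_le (N : nat) (T : R) : \sum_(c <- iota 1 N) (c%:R)^-1 <= T ->
  sum_le (fun c : nat => (0 < c <= N)%N) (fun c => (c%:R)^-1 : R) T.
Proof.
move=> NT.
have h : sum_le (fun c : nat => (0 < c <= N)%N) (fun c => (c%:R)^-1 : R)
    (\sum_(c <- iota 1 N) (c%:R)^-1).
  apply: sum_le_seq; first exact: iota_uniq.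
    by move=> c /andP[c0 cN]; rewrite mem_iota c0 add1n ltnS.
  by move=> c; rewrite invr_ge0.
by apply: sum_leW h _ _ NT.
Qed.

(** The vectors of norm E contribute 20 T E (X + X^2 / M + X^2 / N). Here E X = N / c does not
    depend on E, so summing over E <= sqrt N costs the factor sqrt N, whereas the terms E X^2 decay
    like 1 / E and 1 / c^2 and cost only harmonic sums. *)
Lemma sum_le_keys (N : nat) (M T : R) : (0 < N)%N -> 1 <= M -> 1 <= T ->
  (forall k : nat, (0 < k <= N)%N -> (tau k)%:R <= T) ->
  \sum_(c <- iota 1 N) (c%:R)^-1 <= T ->
  sum_le (fun u : nat * (int * int) => [/\ (0 < u.1 <= N)%N,
     (0 < maxn `|u.2.1| `|u.2.2|)%N &
     (maxn `|u.2.1| `|u.2.2| * maxn `|u.2.1| `|u.2.2| <= N)%N])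
   (fun u => let X := key_ratio R N u.1 u.2.1 u.2.2 in
      pair_gcd R u.2.1 u.2.2 * (X + X ^+ 2 / M + X ^+ 2 / N%:R))
   (40 * T ^+ 3 * (N%:R ^+ 2 / M + N%:R * Num.sqrt N%:R)).
Proof.
move=> N0 M1 T1 tauT hT.
have M0 : 0 < M by lra.
have NR : 0 < N%:R :> R by rewrite ltr0n.
have N1 : 1 <= N%:R :> R by rewrite ler1n.
have T0 : 0 <= T by lra.
have sq1 : 1 <= Num.sqrt N%:R :> R by rewrite -[leLHS]sqrtr1 ler_wsqrtr.
pose Z : R := M^-1 + (N%:R)^-1.
have Z0 : 0 <= Z by rewrite addr_ge0 // invr_ge0 // ltW.
pose v2 (cE : nat * nat) : R := 20 * T * (N%:R * (cE.1%:R)^-1 +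
   (N%:R ^+ 2 * Z * (cE.1%:R)^-1 ^+ 2) * (cE.2%:R)^-1).
pose v3 (c : nat) : R := 20 * T * (N%:R * (c%:R)^-1 * Num.sqrt N%:R +
   (N%:R ^+ 2 * Z * (c%:R)^-1 ^+ 2) * T).
have hinv := sum_inv_le hT.
apply: (@sum_le_rel _ _ _ _ (fun cE : nat * nat =>
   (0 < cE.1 <= N)%N /\ ((0 < cE.2)%N /\ (cE.2 * cE.2 <= N)%N))
   (fun u cE => u.1 = cE.1 /\ maxn `|u.2.1| `|u.2.2| = cE.2) _ v2).
- move=> [c [e2 e3]] /= [cN E0 EE]; exists (c, maxn `|e2| `|e3|) => //.
- move=> [c E] [/= cN [E0 EE]].
  have EN : (0 < E <= N)%N by rewrite E0 (leq_trans _ EE) // leq_pmulr.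
  have cR : 0 < c%:R :> R by rewrite ltr0n; case/andP: cN.
  have ER : 0 < E%:R :> R by rewrite ltr0n.
  pose X : R := N%:R / (c%:R * E%:R).
  pose y : R := X + X ^+ 2 / M + X ^+ 2 / N%:R.
  have y0 : 0 <= y.
    have X0 : 0 <= X by rewrite divr_ge0 // mulr_ge0 // ltW.
    apply: addr_ge0; first apply: addr_ge0 => //.
      by apply: divr_ge0; [exact: exprn_ge0|exact: ltW].
    by apply: divr_ge0; [exact: exprn_ge0|exact: ltW].
  have h := sum_leZ y0 (sum_le_gcd E0 (tauT E EN)).
  have hv2 : v2 (c, E) = y * (20 * E%:R * T).
    by rewrite /v2 /y /X /Z /=; field; rewrite !gt_eqF.
  rewrite hv2.
  apply: (@sum_le_inj _ _ _ _ _ snd _ _ _ _ _ _ h) => /=.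
  + by move=> [c' [e2 e3]] /= [_ [_ ->]].
  + by move=> [c' e] [c'' e'] [_ [/= -> _]] [_ [/= -> _]] ->.
  + move=> [c' [e2 e3]] /= [_ [-> eE]].
    by rewrite /key_ratio eE -/X -/y mulrC.
apply: (@sum_le_rel _ _ _ _ (fun c : nat => (0 < c <= N)%N) (fun cE c => cE.1 = c) _ v3).
- by move=> [c E] [/= cN _]; exists c.
- move=> c cN.
  have c0 : 0 <= (c%:R)^-1 :> R by rewrite invr_ge0.
  pose Bc : R := N%:R ^+ 2 * Z * (c%:R)^-1 ^+ 2.
  have Bc0 : 0 <= Bc by rewrite mulr_ge0 ?exprn_ge0 // mulr_ge0 ?exprn_ge0.
  pose QE (E : nat) := (0 < E)%N /\ (E * E <= N)%N.
  have s1 : sum_le QE (fun=> N%:R * (c%:R)^-1 : R) (N%:R * (c%:R)^-1 * Num.sqrt N%:R).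
    have c1 : 0 <= N%:R * (c%:R)^-1 :> R by rewrite mulr_ge0.
    exact: (@sum_le_const R _ QE (fun=> N%:R * (c%:R)^-1) _ _ c1
      (@count_le_sqrt N) (fun _ _ => lexx _)).
  have s2 : sum_le QE (fun E => Bc * (E%:R)^-1) (Bc * T).
    apply: sum_leZ => //; apply: sum_leW hinv _ _ _ => // E [E0 EE].
    by rewrite E0 (leq_trans _ EE) // leq_pmulr.
  have T20 : 0 <= 20 * T by rewrite mulr_ge0.
  have h := sum_leZ T20 (sum_leD s1 s2).
  apply: (@sum_le_inj _ _ _ _ _ snd _ _ _ _ _ _ h) => /=.
  + by move=> [c' E] [[/= _ q] _].
  + by move=> [c' E] [c'' E'] [_ /= ->] [_ /= ->] ->.
  + by move=> [c' E] [_ /= ->].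
have T20 : 0 <= 20 * T by rewrite mulr_ge0.
have A0 : 0 <= N%:R * Num.sqrt N%:R :> R by rewrite mulr_ge0 // sqrtr_ge0.
have B0 : 0 <= N%:R ^+ 2 * Z * T by rewrite mulr_ge0 // mulr_ge0 // exprn_ge0.
have h := sum_leZ T20 (sum_leZ (addr_ge0 A0 B0) hinv).
apply: sum_leW h _ _ _ => //.
  move=> c /andP[c0 _]; rewrite /v3; apply: ler_wpM2l => //.
  have cR : 1 <= c%:R :> R by rewrite ler1n.
  have i0 : 0 <= (c%:R)^-1 :> R by rewrite invr_ge0.
  have i1 : (c%:R)^-1 <= 1 :> R by rewrite invf_le1 //; lra.
  have i2 : (c%:R)^-1 ^+ 2 <= (c%:R)^-1 :> R by rewrite expr2 ler_piMr.
  rewrite mulrDl lerD //; first by rewrite mulrAC.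
  rewrite -[leLHS]mulrA -[leRHS]mulrA; apply: ler_wpM2l.
    by apply: mulr_ge0 => //; exact: exprn_ge0.
  by rewrite mulrC; apply: ler_wpM2l.
have e1 : N%:R ^+ 2 * Z = N%:R ^+ 2 / M + N%:R by rewrite /Z; field; rewrite !gt_eqF.
rewrite e1; set q := N%:R ^+ 2 / M; set r := N%:R * Num.sqrt N%:R in A0 *.
have q0 : 0 <= q by rewrite divr_ge0 ?exprn_ge0 // ltW.
have Nr : N%:R <= r by rewrite /r ler_peMr // ltW.
have T2 : T <= T ^+ 2 by rewrite expr2 ler_peMr.
have T3 : T ^+ 2 <= T ^+ 3 by rewrite [leRHS]exprSr ler_peMr // exprn_ge0.
apply: (@le_trans _ _ (20 * T * ((r + (q + r) * T) * T))).
  apply: ler_wpM2l => //; apply: ler_wpM2r => //; rewrite lerD2l.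
  by apply: ler_wpM2r => //; rewrite lerD2l.
have rT : r * T ^+ 2 <= r * T ^+ 3 by apply: ler_wpM2l.
have -> : 20 * T * ((r + (q + r) * T) * T) = 20 * (r * T ^+ 2) + 20 * (q * T ^+ 3) +
   20 * (r * T ^+ 3) by ring.
have : 0 <= q * T ^+ 3 by rewrite mulr_ge0 // exprn_ge0.
have -> : 40 * T ^+ 3 * (q + r) = 40 * (q * T ^+ 3) + 40 * (r * T ^+ 3) by ring.
by lra.
Qed.

End GcdSums.

(** * Counting on the model quadric *)

Section ModelCount.
Variables (R : realType) (n m D : nat) (d : int) (G : 'I_m -> {mpoly int[n.+1]}).
Variable t0 : nat.
Hypothesis n3 : (3 <= n)%N.
Hypothesis nsq : ~ (exists k : int, d = k ^+ 2).
Hypothesis hG : forall k, G k \is D.+1.-homog.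
Hypothesis g0 : gam (comb G t0) != 0.
Hypothesis small : small_locus (cone_locus d G).

Definition model_point (N : nat) (y : 'rV[int]_n.+1) : Prop :=
  (forall i, (`|y 0%R i| <= N)%N) /\ on_model d (y 0).

Lemma count_le_abs (N : nat) : (0 < N)%N ->
  count_le (fun i : int => (`|i| <= N)%N) (3 * N%:R : R).
Proof.
move=> N0; have h := @count_le_int R N%:R (ler0n R N).
apply: sum_leW h _ _ _ => //; first by move=> i; rewrite ler_nat.
by have : 1 <= N%:R :> R by [rewrite ler1n]; lra.
Qed.

Lemma count_free_box (N : nat) (J : seq 'I_n.+1) (v0 : 'rV[int]_n.+1) : (0 < N)%N ->
  count_le (in_box J (fun _ z => (`|z| <= N)%N) v0) ((3 * N%:R) ^+ size J : R).
Proof.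
move=> N0; rewrite -(@prod_seq_const R _ J (fun=> 3 * N%:R)) //.
by apply: box_count => j _; exact: count_le_abs.
Qed.

Lemma count_degenerate (N : nat) : (0 < N)%N ->
  count_le (fun y => model_point N y /\ nrm d (pt y 2) (pt y 3) = 0)
    (2 * (3 * N%:R * (3 * N%:R) ^+ (n - 3)) : R).
Proof.
move=> N0.
have box (k k' : nat) : (forall j : 'I_n.+1, j != inord k -> ~~ (3 < j)%N ->
      [\/ j = inord k', j = inord 2 | j = inord 3]) ->
    count_le (fun y => [/\ model_point N y, pt y 2 = 0, pt y 3 = 0 & pt y k' = 0])
     (3 * N%:R * (3 * N%:R) ^+ (n - 3) : R).
  move=> hk; have h := @count_free_box N (inord k :: free_idx n) 0 N0.
  rewrite /= size_free_idx // exprS in h.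
  apply: sum_leW h _ _ _ => // y [[yN _] y2 y3 y1]; split=> j; last by [].
  rewrite inE negb_or mem_free_idx mxE => /andP[jk j3].
  by have [] := hk j jk j3 => ->.
have b0 : forall j : 'I_n.+1, j != inord 0 -> ~~ (3 < j)%N ->
      [\/ j = inord 1, j = inord 2 | j = inord 3].
  move=> j jk j3; have [j3'|e|e|[]] := ord_cases j.
  - by rewrite j3' in j3.
  - by rewrite e eqxx in jk.
  - by constructor 1.
  - by constructor 2.
  - by constructor 3.
have b1 : forall j : 'I_n.+1, j != inord 1 -> ~~ (3 < j)%N ->
      [\/ j = inord 0, j = inord 2 | j = inord 3].
  move=> j jk j3; have [j3'|e|e|[]] := ord_cases j.
  - by rewrite j3' in j3.
  - by constructor 1.
  - by rewrite e eqxx in jk.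
  - by constructor 2.
  - by constructor 3.
have h := sum_le_or (box 0%N 1%N b0) (box 1%N 0%N b1).
apply: sum_leW h _ _ _ => //.
  move=> y [[yN hy] /(nrm_eq0 nsq)[y2 y3]].
  have /eqP : pt y 0 * pt y 1 = 0 by rewrite hy y2 y3 nrmE !expr0n mulr0 subr0.
  by rewrite mulf_eq0 => /orP[]/eqP e; [right|left].
lra.
Qed.

(** Once w is fixed with N(w) nonzero, y0 is one of its divisors and determines y1. This serves for
    all w when M is bounded, and otherwise for the few w divisible by a prime p > M. *)
Lemma count_trivial (N : nat) (T w : R) (W : int * int -> Prop) : (0 < N)%N -> 0 <= T ->
  (forall k : nat, (0 < k <= (1 + `|d|) * (N * N))%N -> (tau k)%:R <= T) ->
  count_le W w ->
  count_le (fun y => [/\ model_point N y, nrm d (pt y 2) (pt y 3) != 0 &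
      W (pt y 2, pt y 3)])
    ((3 * N%:R) ^+ (n - 3) * (2 * T) * w).
Proof.
move=> N0 T0 tauT Ww.
have P0 : 0 <= (3 * N%:R) ^+ (n - 3) :> R by rewrite exprn_ge0 // mulr_ge0.
apply: (@count_le_fiber _ 'rV[int]_n.+1 _ _ (fun u : int * int => [/\ W u, (`|u.1| <= N)%N,
   (`|u.2| <= N)%N & nrm d u.1 u.2 != 0])
  (fun y u => pt y 2 = u.1 /\ pt y 3 = u.2)).
- by rewrite mulr_ge0 // mulr_ge0.
- move=> y [[yN hy] ny Wy]; exists (pt y 2, pt y 3) => //; split=> //=; exact: yN.
- move=> [u v] [_ /= uN vN nuv].
  have nT : (tau `|nrm d u v|)%:R <= T.
    by apply: tauT; rewrite absz_gt0 nuv; exact: nrm_bound.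
  have ca := count_le_int_divisors nuv nT.
  apply: (@count_le_fiber _ 'rV[int]_n.+1 _ _ (fun a : int => (a %| nrm d u v)%Z)
    (fun y a => pt y 0 = a)) => //; last 1 first.
    move=> a ad.
    have h := @count_free_box N (free_idx n)
      (\row_i coords a (nrm d u v %/ a)%Z u v (fun=> 0) i) N0.
    rewrite size_free_idx // in h.
    apply: sum_leW h _ _ _ => // y [[[[yN hy] _ _] [/= y2 y3]] ya]; split=> j; last by [].
    have a0 : a != 0 by apply: contraNneq nuv => a0; move: ad; rewrite a0 dvd0z.
    have y1 : pt y 1 = (nrm d u v %/ a)%Z.
      by rewrite -y2 -y3 -hy ya mulrC mulzK.
    rewrite mem_free_idx mxE => j3.
    have [j3'|->|->|[->|->]] := ord_cases j; rewrite ?coords0 ?coords1 ?coords2 ?coords3 //.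
    by rewrite j3' in j3.
  move=> y [[[yN hy] _ _] [/= y2 y3]]; exists (pt y 0) => //.
  by rewrite -y2 -y3 -hy dvdz_mulr.
by apply: sum_leW Ww _ _ _ => // u [].
Qed.

Lemma count_pairs_gcd (N : nat) (M T : R) : (0 < N)%N -> 1 <= M ->
  \sum_(c <- iota 1 N) (c%:R)^-1 <= T ->
  count_le (fun u : int * int => [/\ (`|u.1| <= N)%N, (`|u.2| <= N)%N &
     exists c : nat, [/\ (0 < c <= N)%N, M < c%:R, (c%:Z %| u.1)%Z & (c%:Z %| u.2)%Z]])
   (25 * N%:R ^+ 2 / M * T).
Proof.
move=> N0 M1 hT; have M0 : 0 < M by lra.
have hinv := sum_inv_le hT.
have A0 : 0 <= 25 * N%:R ^+ 2 / M.
  by apply: divr_ge0; [rewrite mulr_ge0 // exprn_ge0|exact: ltW].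
have h := sum_leZ A0 hinv.
apply: (@sum_le_rel _ _ _ _ (fun c : nat => (0 < c <= N)%N /\ M < c%:R)
  (fun u c => (c%:Z %| u.1)%Z /\ (c%:Z %| u.2)%Z) _
  (fun c => 25 * N%:R ^+ 2 / M * (c%:R)^-1)).
- by move=> u [_ _ [c [cN Mc c1 c2]]]; exists c.
- move=> c [/andP[c0 cN] Mc].
  have cm := @count_le_multiples R N c c0 cN.
  have hp := count_le_pair cm cm.
  apply: sum_leW hp _ _ _ => //; first by move=> u [[uN vN _] [cu cv]].
  have cR : 0 < c%:R :> R by lra.
  have -> : 5 * N%:R / c%:R * (5 * N%:R / c%:R) = 25 * N%:R ^+ 2 * (c%:R)^-1 * (c%:R)^-1 :> R.
    by field; rewrite gt_eqF.
  apply: ler_wpM2r; first by rewrite invr_ge0 ltW.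
  apply: ler_wpM2l; first by rewrite mulr_ge0 // exprn_ge0.
  by rewrite lef_pV2 ?posrE // ltW.
by apply: sum_leW h _ _ _ => // c [].
Qed.

(** The bound of [key_count] does not involve [a], a divisor of c^2 N(e), so summing over [a] costs
    2 T. Then [sum_le_keys] is applied. *)
Lemma count_keys : exists2 K : R, 0 <= K &
  forall (N : nat) (M T : R), (0 < N)%N -> 1 <= T -> 1 <= M ->
  (1 + `|d|)%:R <= M -> (`|gam (comb G t0)|%N)%:R <= M ->
  (forall k : nat, (0 < k <= (1 + `|d|) * N ^ 4)%N -> (tau k)%:R <= T) ->
  \sum_(c <- iota 1 N) (c%:R)^-1 <= T ->
  (forall t (x : 'I_n.+1 -> int), (t < elim_range m D)%N ->
     (forall i, (`|x i| <= 2 * N ^ 2)%N) -> ev x (elim_comb d G t0 t) != 0 ->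
     (tau `|ev x (elim_comb d G t0 t)|)%:R <= T) ->
  count_le (fun y => [/\ model_point N y, nrm d (pt y 2) (pt y 3) != 0 &
      exists2 p, sieve_at G M y p & ~ ((p%:Z %| pt y 2)%Z /\ (p%:Z %| pt y 3)%Z)])
    (K * T ^+ 5 * N%:R ^+ (n - 3) * (N%:R ^+ 2 / M + N%:R * Num.sqrt N%:R)).
Proof.
have [K K0 keyK] := key_count R n3 hG g0 small.
(* 80 is 2 for the signs of [a] times 40 from [sum_le_keys]. In T^5, one factor comes from
   [key_count], one from the choice of [a] and three from [sum_le_keys]. *)
exists (80 * K) => [|N M T N0 T1 M1 dM gM tauT hT tauH]; first exact: mulr_ge0.
have T0 : 0 <= T by lra.
have N4 : (N <= (1 + `|d|) * N ^ 4)%N.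
  apply: (@leq_trans (N ^ 4)); last by rewrite leq_pmull.
  by rewrite -{1}[N]expn1 leq_pexp2l.
have keys : sum_le (fun u : nat * (int * int) => [/\ (0 < u.1 <= N)%N,
     (0 < maxn `|u.2.1| `|u.2.2|)%N &
     (maxn `|u.2.1| `|u.2.2| * maxn `|u.2.1| `|u.2.2| <= N)%N])
   (fun u => let X := key_ratio R N u.1 u.2.1 u.2.2 in
      pair_gcd R u.2.1 u.2.2 * (X + X ^+ 2 / M + X ^+ 2 / N%:R))
   (40 * T ^+ 3 * (N%:R ^+ 2 / M + N%:R * Num.sqrt N%:R)).
  apply: sum_le_keys => // k /andP[k0 kN]; apply: tauT.
  by rewrite k0 (leq_trans kN).
pose C := K * T * N%:R ^+ (n - 3).
have C0 : 0 <= C by rewrite /C mulr_ge0 ?exprn_ge0 // mulr_ge0.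
have TC0 : 0 <= 2 * T * C by rewrite mulr_ge0 // mulr_ge0.
pose wt (u : nat * (int * int)) : R := let X := key_ratio R N u.1 u.2.1 u.2.2 in
  pair_gcd R u.2.1 u.2.2 * (X + X ^+ 2 / M + X ^+ 2 / N%:R).
apply: (@sum_le_rel _ 'rV[int]_n.+1 _ _ (fun u : nat * (int * int) * int =>
    key_ok d N u.1.1 u.1.2.1 u.1.2.2 u.2)
  (fun y u => key_rel d N u.1.1 u.1.2.1 u.1.2.2 u.2 y /\
     exists2 p, sieve_at G M y p & ~~ (p %| u.1.1)%N) _
  (fun u => C * wt u.1)).
- move=> y [[yN hy] ny [p sp pw]].
  have nz : pt y 0 * pt y 1 != 0 by rewrite hy.
  have a0 : pt y 0 != 0 by apply: contraNneq nz => ->; rewrite mul0r.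
  have b0 : pt y 1 != 0 by apply: contraNneq nz => ->; rewrite mulr0.
  have [c [e2 [e3 [[cN cu cv] [E0 EE cE] [ne ae at'] [q0 qd qE] mp]]]] :=
    key_vector nsq a0 b0 hy (yN _) (yN _) (yN _).
  exists (c, (e2, e3), pt y 0) => /=; first by split.
  split; first by split.
  exists p => //; apply/negP => pc; apply: pw.
  have pcZ : (p%:Z %| c%:Z)%Z by [].
  by split; [exact: dvdz_trans pcZ cu|exact: dvdz_trans pcZ cv].
- move=> [[c [e2 e3]] a] /= ok.
  have h := keyK N c e2 e3 a M T ok N0 T1 dM gM tauH.
  apply: sum_leW h _ _ _ => //; first by move=> y [_].
  by rewrite le_eqVlt; apply/orP; left; apply/eqP; rewrite /C /wt /=; ring.
have h := sum_leZ TC0 keys.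
apply: (@sum_le_rel _ _ _ _ (fun u : nat * (int * int) => [/\ (0 < u.1 <= N)%N,
     (0 < maxn `|u.2.1| `|u.2.2|)%N,
     (maxn `|u.2.1| `|u.2.2| * maxn `|u.2.1| `|u.2.2| <= N)%N &
     nrm d u.2.1 u.2.2 != 0])
  (fun u k => u.1 = k) _ (fun u => 2 * T * C * wt u)).
- by move=> [u a] /= [[cN _ _] [E0 EE _] [ne _] _ _]; exists u.
- move=> [c [e2 e3]] /= [cN E0 EE ne].
  have k0 : c%:Z ^+ 2 * nrm d e2 e3 != 0.
    by rewrite mulf_neq0 // expf_neq0 // eqz_nat -lt0n; case/andP: cN.
  have wt0 : 0 <= C * wt (c, (e2, e3)).
    apply: mulr_ge0 => //; apply: mulr_ge0 => //=.
    have X0 : 0 <= key_ratio R N c e2 e3 by rewrite divr_ge0 // mulr_ge0.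
    apply: addr_ge0; first apply: addr_ge0 => //.
      by apply: divr_ge0; [exact: exprn_ge0|lra].
    by apply: divr_ge0; [exact: exprn_ge0|].
  have ca : count_le (fun a : int => (a %| c%:Z ^+ 2 * nrm d e2 e3)%Z) (2 * T).
    apply: count_le_int_divisors => //; apply: tauT; rewrite absz_gt0 k0 /=.
    have e2E : (`|e2| <= maxn `|e2| `|e3|)%N by exact: leq_maxl.
    have e3E : (`|e3| <= maxn `|e2| `|e3|)%N by exact: leq_maxr.
    have nb := leq_trans (nrm_bound d e2E e3E) (leq_mul (leqnn _) EE).
    rewrite abszM abszX /= (_ : (N ^ 4 = N * N * (N * N))%N); last by ring.
    have [_ c_N] := andP cN.
    have c2 : (c ^ 2 <= N * N)%N by rewrite -mulnn leq_mul.
    apply: (leq_trans (leq_mul c2 nb)); rewrite mulnCA leq_mul2l leq_mul2l.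
    by rewrite leq_pmulr ?orbT.
  have h2 := sum_le_const (w := fun=> C * wt (c, (e2, e3))) wt0 ca (fun _ _ => lexx _).
  have -> : 2 * T * C * wt (c, (e2, e3)) = C * wt (c, (e2, e3)) * (2 * T) by ring.
  apply: (@sum_le_inj _ _ _ _ _ snd _ _ _ _ _ _ h2) => /=.
  + by move=> [[c' [e2' e3']] a] /= [[_ _ [_ ae] _ _] [<- <- <-]].
  + by move=> [u a] [u' a'] [_ /= ->] [_ /= ->] /= ->.
  + by move=> [u a] [_ /= ->].
apply: sum_leW h _ _ _; [by move=> u []|by move=> u _|].
by rewrite le_eqVlt; apply/orP; left; apply/eqP; rewrite /C; ring.
Qed.

(** If M < [p0], the trivial bound N^(n-1) is already at most p0 N^(n-1) / M up to powers of T. If M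
    >= [p0], every p > M exceeds 1 + |d| and |gam|, and the points have N(w) = 0, or p dividing w,
    or are covered by [count_keys]. *)
Lemma model_count_T : exists2 K : R, 0 <= K &
  forall (N : nat) (M T : R), (0 < N)%N -> 1 <= T -> 1 <= M ->
  (forall k : nat, (0 < k <= (1 + `|d|) * N ^ 4)%N -> (tau k)%:R <= T) ->
  \sum_(c <- iota 1 N) (c%:R)^-1 <= T ->
  (forall t (x : 'I_n.+1 -> int), (t < elim_range m D)%N ->
     (forall i, (`|x i| <= 2 * N ^ 2)%N) -> ev x (elim_comb d G t0 t) != 0 ->
     (tau `|ev x (elim_comb d G t0 t)|)%:R <= T) ->
  count_le (fun y => model_point N y /\ exists p, sieve_at G M y p)
    (K * (T ^+ 5 * N%:R ^+ (n - 3) * (N%:R ^+ 2 / M + N%:R * Num.sqrt N%:R))).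
Proof.
have [K K0 keysK] := count_keys.
pose p0 : R := (1 + `|d| + `|gam (comb G t0)|)%:R.
pose k3 : R := 3 ^+ (n - 3).
have k30 : 0 <= k3 by rewrite exprn_ge0.
(* 6 for the points with N(w) = 0, 50 for those with p dividing w, 18 p0 for the range M < p0. *)
exists (k3 * (56 + 18 * p0) + K).
  by rewrite addr_ge0 // mulr_ge0 // addr_ge0 // mulr_ge0.
move=> N M T N0 T1 M1 tauT hT tauH.
have T0 : 0 <= T by lra.
have M0 : 0 < M by lra.
have NR : 0 <= N%:R :> R by [].
have tauT' k : (0 < k <= (1 + `|d|) * (N * N))%N -> (tau k)%:R <= T.
  move=> /andP[k0 kN]; apply: tauT; rewrite k0 (leq_trans kN) // leq_mul2l.
  by rewrite mulnn leq_pexp2l ?orbT.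
set Pn : R := N%:R ^+ (n - 3); set NM : R := N%:R ^+ 2 / M; set NS : R := N%:R * Num.sqrt N%:R.
have Pn0 : 0 <= Pn by rewrite exprn_ge0.
have NM0 : 0 <= NM by rewrite divr_ge0 ?exprn_ge0 // ltW.
have NS0 : 0 <= NS by rewrite mulr_ge0 // sqrtr_ge0.
have sq1 : 1 <= Num.sqrt N%:R :> R by rewrite -[leLHS]sqrtr1 ler_wsqrtr // ler1n.
have NleNS : N%:R <= NS by rewrite /NS ler_peMr.
have T5_ge j : (j <= 5)%N -> T ^+ j <= T ^+ 5 by move=> j5; rewrite ler_weXn2l.
have T5_1 : 1 <= T ^+ 5 by exact: (T5_ge 0%N).
have T5_T : T <= T ^+ 5 by exact: (T5_ge 1%N).
have T5_2 : T * T <= T ^+ 5 by rewrite -expr2 T5_ge.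
have deg : 2 * (3 * N%:R * (3 * N%:R) ^+ (n - 3)) <= k3 * 6 * (T ^+ 5 * Pn * NS).
  rewrite exprMn -/k3 -/Pn.
  have -> : 2 * (3 * N%:R * (k3 * Pn)) = k3 * 6 * (Pn * N%:R) by ring.
  apply: ler_wpM2l; first exact: mulr_ge0.
  rewrite -mulrA -[leLHS]mul1r; apply: ler_pM => //; first exact: mulr_ge0.
  exact: ler_wpM2l.
have cdeg := count_degenerate N0.
have [Msmall|Mbig] := ltrP M p0.
  have cw := count_le_pair (count_le_abs N0) (count_le_abs N0).
  have ct := count_trivial N0 T0 tauT' cw.
  have h := sum_le_or cdeg ct; apply: sum_leW h _ _ _ => //.
    move=> y [[yN hy] _].
    have [n0|n0] := eqVneq (nrm d (pt y 2) (pt y 3)) 0; first by left.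
    by right; split=> //; split=> /=; exact: yN.
  have le2 : (3 * N%:R) ^+ (n - 3) * (2 * T) * (3 * N%:R * (3 * N%:R)) <=
      k3 * (18 * p0) * (T ^+ 5 * Pn * NM).
    rewrite exprMn -/k3 -/Pn.
    have -> : k3 * Pn * (2 * T) * (3 * N%:R * (3 * N%:R)) =
       k3 * 18 * (T * Pn * N%:R ^+ 2) by ring.
    have -> : k3 * (18 * p0) * (T ^+ 5 * Pn * NM) = k3 * 18 * (T ^+ 5 * Pn * (p0 * NM)) by ring.
    apply: ler_wpM2l; first exact: mulr_ge0.
    apply: ler_pM; [exact: mulr_ge0|exact: exprn_ge0|exact: ler_wpM2r|].
    rewrite /NM mulrA ler_pdivlMr // mulrC; apply: ler_wpM2r; first exact: exprn_ge0.
    exact: ltW.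
  apply: (le_trans (lerD deg le2)).
  have TP0 : 0 <= T ^+ 5 * Pn by rewrite mulr_ge0 // exprn_ge0.
  have a1 : 0 <= T ^+ 5 * Pn * NM by rewrite mulr_ge0.
  have a2 : 0 <= T ^+ 5 * Pn * NS by rewrite mulr_ge0.
  rewrite (_ : T ^+ 5 * Pn * (NM + NS) = T ^+ 5 * Pn * NM + T ^+ 5 * Pn * NS); last by ring.
  move: (T ^+ 5 * Pn * NM) (T ^+ 5 * Pn * NS) a1 a2 => u v u0 v0.
  have p00 : 0 <= p0 by [].
  have b1 : 0 <= k3 * p0 * u by rewrite mulr_ge0 // mulr_ge0.
  have b2 : 0 <= k3 * p0 * v by rewrite mulr_ge0 // mulr_ge0.
  have b3 : 0 <= K * u by rewrite mulr_ge0.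
  have b4 : 0 <= K * v by rewrite mulr_ge0.
  have b5 : 0 <= k3 * u by rewrite mulr_ge0.
  have b6 : 0 <= k3 * v by rewrite mulr_ge0.
  have -> : (k3 * (56 + 18 * p0) + K) * (u + v) = 56 * (k3 * u) + 56 * (k3 * v) +
    18 * (k3 * p0 * u) + 18 * (k3 * p0 * v) + K * u + K * v by ring.
  have -> : k3 * 6 * v + k3 * (18 * p0) * u = 6 * (k3 * v) + 18 * (k3 * p0 * u) by ring.
  by lra.
have dM : (1 + `|d|)%:R <= M by apply: le_trans Mbig; rewrite ler_nat leq_addr.
have gM : (`|gam (comb G t0)|%N)%:R <= M.
  by apply: le_trans Mbig; rewrite ler_nat leq_addl.
have ck := keysK N M T N0 T1 M1 dM gM tauT hT tauH.
have cp := count_trivial N0 T0 tauT' (count_pairs_gcd N0 M1 hT).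
have h := sum_le_or cdeg (sum_le_or ck cp); apply: sum_leW h _ _ _ => //.
  move=> y [[yN hy] [p sp]].
  have [n0|n0] := eqVneq (nrm d (pt y 2) (pt y 3)) 0; first by left.
  right; have [[p2 p3]|np] := pselect ((p%:Z %| pt y 2)%Z /\ (p%:Z %| pt y 3)%Z); last first.
    by left; split=> //; exists p.
  right; split=> //; split=> //=.
  have [pp Mp _] := sp; exists p; split=> //; rewrite prime_gt0 //=.
  have [y20|y20] := eqVneq (pt y 2) 0; last first.
    by apply: leq_trans (yN (inord 2)); rewrite dvdn_leq // absz_gt0.
  apply: leq_trans (yN (inord 3)); rewrite dvdn_leq // absz_gt0.
  by apply: contraNneq n0 => y30; rewrite y20 y30 nrmE !expr0n mulr0 subr0.
have le2 : (3 * N%:R) ^+ (n - 3) * (2 * T) * (25 * N%:R ^+ 2 / M * T) <=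
    k3 * 50 * (T ^+ 5 * Pn * NM).
  rewrite exprMn -/k3 -/Pn.
  have -> : k3 * Pn * (2 * T) * (25 * N%:R ^+ 2 / M * T) = k3 * 50 * (T * T * Pn * NM).
    by rewrite /NM; ring.
  apply: ler_wpM2l; first exact: mulr_ge0.
  apply: ler_wpM2r => //; exact: ler_wpM2r.
apply: (le_trans (lerD deg (lerD (lexx _) le2))).
have TP0 : 0 <= T ^+ 5 * Pn by rewrite mulr_ge0 // exprn_ge0.
have a1 : 0 <= T ^+ 5 * Pn * NM by rewrite mulr_ge0.
have a2 : 0 <= T ^+ 5 * Pn * NS by rewrite mulr_ge0.
have -> : K * T ^+ 5 * Pn * (NM + NS) = K * (T ^+ 5 * Pn * NM) + K * (T ^+ 5 * Pn * NS) by ring.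
rewrite (_ : T ^+ 5 * Pn * (NM + NS) = T ^+ 5 * Pn * NM + T ^+ 5 * Pn * NS); last by ring.
  move: (T ^+ 5 * Pn * NM) (T ^+ 5 * Pn * NS) a1 a2 => u v u0 v0.
have p00 : 0 <= p0 by [].
have b1 : 0 <= k3 * p0 * u by rewrite mulr_ge0 // mulr_ge0.
have b2 : 0 <= k3 * p0 * v by rewrite mulr_ge0 // mulr_ge0.
have b5 : 0 <= k3 * u by rewrite mulr_ge0.
have b6 : 0 <= k3 * v by rewrite mulr_ge0.
have -> : (k3 * (56 + 18 * p0) + K) * (u + v) = 56 * (k3 * u) + 56 * (k3 * v) +
  18 * (k3 * p0 * u) + 18 * (k3 * p0 * v) + K * u + K * v by ring.
have -> : k3 * 6 * v + (K * u + K * v + k3 * 50 * u) = 6 * (k3 * v) + 50 * (k3 * u) +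
  K * u + K * v by ring.
by lra.
Qed.

Lemma elim_tau_bound (eta : R) : 0 < eta -> exists2 K : R, 1 <= K &
  forall (N t : nat) (x : 'I_n.+1 -> int), (0 < N)%N -> (t < elim_range m D)%N ->
     (forall i, (`|x i| <= 2 * N ^ 2)%N) -> ev x (elim_comb d G t0 t) != 0 ->
     (tau `|ev x (elim_comb d G t0 t)|)%:R <= K * N%:R `^ eta.
Proof.
move=> eta0; elim: (elim_range m D) => [|r [K K1 KP]]; first by exists 1.
have [C CP] := ev_bound (elim_comb d G t0 r).
set s := msize _ in CP.
have [K' K'1 K'P] := tau_le_poly (C * 2 ^ s) (2 * s) eta0.
exists (K + K') => [|N t x N0]; first lra.
have NT0 : 0 <= N%:R `^ eta :> R by rewrite powR_ge0.
rewrite ltnS leq_eqVlt => /orP[/eqP->|tr] xN ne; last first.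
  apply: le_trans (KP N t x N0 tr xN ne) _.
  by apply: ler_wpM2r => //; lra.
apply: (@le_trans _ _ (K' * N%:R `^ eta)); last by apply: ler_wpM2r => //; lra.
apply: K'P => //; first by rewrite absz_gt0.
apply: leq_trans (CP (2 * N ^ 2)%N x _ xN) _.
  by rewrite muln_gt0 /= expn_gt0 N0.
by rewrite expnMn -mulnA -expnM.
Qed.

Lemma model_count (eta : R) : 0 < eta -> exists2 K : R, 0 <= K &
  forall (N : nat) (M : R), (0 < N)%N -> 1 <= M ->
  count_le (fun y => model_point N y /\ exists p, sieve_at G M y p)
    (K * N%:R `^ eta * (N%:R ^+ (n - 3) * (N%:R ^+ 2 / M + N%:R * Num.sqrt N%:R))).
Proof.
(* [T] enters to the fifth power. *)
move=> eta0; pose e5 := eta / 5.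
have e50 : 0 < e5 by rewrite divr_gt0.
have [K K0 KP] := model_count_T.
have [Ka Ka1 KaP] := tau_le_poly (1 + `|d|) 4 e50.
have [Kb Kb1 KbP] := elim_tau_bound e50.
have [Kc Kc1 KcP] := harmonic_le_powR e50.
pose Kt := Ka + Kb + Kc.
exists (K * Kt ^+ 5) => [|N M N0 M1].
  by apply: mulr_ge0 => //; apply: exprn_ge0; rewrite /Kt; lra.
pose P : R := N%:R `^ e5.
have P1 : 1 <= P by apply: powR_ge1; [rewrite ler1n|exact: ltW].
pose T := Kt * P.
have aT : Ka * P <= T by apply: ler_wpM2r; rewrite /Kt; lra.
have bT : Kb * P <= T by apply: ler_wpM2r; rewrite /Kt; lra.
have cT : Kc * P <= T by apply: ler_wpM2r; rewrite /Kt; lra.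
have T1 : 1 <= T by rewrite -[leLHS]mulr1; apply: ler_pM; rewrite /Kt //; lra.
have h := KP N M T N0 T1 M1 _ _ _.
have E : T ^+ 5 = Kt ^+ 5 * N%:R `^ eta.
  rewrite /T exprMn; congr (_ * _).
  by rewrite /P -powR_mulrn ?powR_ge0 // -powRrM /e5 divfK // pnatr_eq0.
have -> : K * Kt ^+ 5 * N%:R `^ eta * (N%:R ^+ (n - 3) * (N%:R ^+ 2 / M + N%:R * Num.sqrt N%:R)) =
  K * (T ^+ 5 * N%:R ^+ (n - 3) * (N%:R ^+ 2 / M + N%:R * Num.sqrt N%:R)).
  by rewrite E; ring.
apply: h.
- by move=> k /andP[k0 kN]; apply: le_trans aT; exact: KaP.
- by apply: le_trans cT; exact: KcP.
- by move=> t x tr xN ne; apply: le_trans bT; exact: KbP.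
Qed.

End ModelCount.

(** * Reduction to the model quadric *)

Section Shear.
Variables (R : comNzRingType) (n : nat) (d : int).
Implicit Types (kap y : 'I_n.+1 -> R).

(* The unipotent automorphism of x0 x1 = N(x2, x3) fixing (1, 0, 0, ...) and
   moving the apex (0, 1, 0, ...) to (N(kap), 1, kap). *)
Definition shear kap y : 'I_n.+1 -> R :=
  let k := fun i => kap (inord i) in let x := fun i => y (inord i) in
  coords (x 0%N + nrm d (k 2%N) (k 3%N) * x 1%N
          + 2 * (k 2%N * x 2%N - d%:~R * k 3%N * x 3%N))
    (x 1%N) (x 2%N + k 2%N * x 1%N) (x 3%N + k 3%N * x 1%N)
    (fun i => y i + kap i * x 1%N).

Lemma shear_model kap y : (3 <= n)%N -> on_model d y -> on_model d (shear kap y).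
Proof.
move=> n3; rewrite /on_model /shear coords0 // coords1 // coords2 // coords3 // /nrm.
by move=> h; rewrite !mulrDl h; ring.
Qed.

Lemma shearK kap y : (3 <= n)%N -> shear (fun i => - kap i) (shear kap y) =1 y.
Proof.
move=> n3 i; rewrite -[RHS]coords_eta {1}/shear /=.
have s1 : shear kap y (inord 1) = y (inord 1) by rewrite /shear coords1.
have s2 : shear kap y (inord 2) = y (inord 2) + kap (inord 2) * y (inord 1).
  by rewrite /shear coords2.
have s3 : shear kap y (inord 3) = y (inord 3) + kap (inord 3) * y (inord 1).
  by rewrite /shear coords3.
rewrite {1}/shear coords0 // s1 s2 s3 /nrm /coords.
case E : (val i) => [|[|[|[|k]]]]; try by ring.
by rewrite {1}/shear /coords E; ring.
Qed.

Lemma shear_apex kap : (3 <= n)%N -> shear kap (apex R n) =1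
  coords (nrm d (kap (inord 2)) (kap (inord 3))) 1 (kap (inord 2)) (kap (inord 3)) kap.
Proof.
move=> n3 i; rewrite /shear /apex coords0 // coords1 // coords2 // coords3 //.
rewrite /coords; case E : (val i) => [|[|[|[|k]]]]; by ring.
Qed.

Definition lin (A : 'I_n.+1 -> 'I_n.+1 -> R) y : 'I_n.+1 -> R :=
  fun i => \sum_j A i j * y j.

End Shear.

Lemma shear_morph (R S : comNzRingType) (phi : {rmorphism R -> S}) n d
    (kap y : 'I_n.+1 -> R) i :
  phi (shear d kap y i) = shear d (phi \o kap) (phi \o y) i.
Proof.
rewrite /shear /coords; case: (val i) => [|[|[|[|k]]]] /=;
  rewrite ?rmorphD ?rmorphM ?rmorphB ?rmorphM ?rmorph_int ?rmorph_nat ?(nrm_morph phi) //.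
Qed.

Lemma lin_morph (R S : comNzRingType) (phi : {rmorphism R -> S}) n
    (A : 'I_n.+1 -> 'I_n.+1 -> R) (y : 'I_n.+1 -> R) i :
  phi (lin A y i) = lin (fun i j => phi (A i j)) (phi \o y) i.
Proof. by rewrite /lin rmorph_sum; apply: eq_bigr => j _; rewrite rmorphM. Qed.

Lemma eq_lin (R : comNzRingType) n (A B : 'I_n.+1 -> 'I_n.+1 -> R) (y z : 'I_n.+1 -> R) :
  A =2 B -> y =1 z -> lin A y =1 lin B z.
Proof. by move=> AB yz i; apply: eq_bigr => j _; rewrite AB yz. Qed.

Lemma eq_shear (R : comNzRingType) n d (k l : 'I_n.+1 -> R) (y z : 'I_n.+1 -> R) :
  k =1 l -> y =1 z -> shear d k y =1 shear d l z.
Proof.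
by move=> kl yz i; rewrite /shear /coords !kl !yz.
Qed.

Lemma lin_adj (R : comNzRingType) n (A : 'M[R]_n.+1) (y : 'I_n.+1 -> R) :
  lin A (lin (\adj A) y) =1 (fun i => \det A * y i).
Proof.
move=> i; rewrite /lin.
have h := congr1 (fun B : 'M[R]_n.+1 => (B *m (\col_j y j)) i 0) (mul_mx_adj A).
rewrite /= -mulmxA mul_scalar_mx [RHS]mxE [X in _ = _ * X]mxE in h.
rewrite -h [RHS]mxE; apply: eq_bigr => j _; congr (_ * _).
by rewrite [RHS]mxE; apply: eq_bigr => k _; rewrite [X in _ = _ * X]mxE.
Qed.

Lemma adj_lin (R : comNzRingType) n (A : 'M[R]_n.+1) (y : 'I_n.+1 -> R) :
  lin (\adj A) (lin A y) =1 (fun i => \det A * y i).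
Proof.
move=> i; rewrite /lin.
have h := congr1 (fun B : 'M[R]_n.+1 => (B *m (\col_j y j)) i 0) (mul_adj_mx A).
rewrite /= -mulmxA mul_scalar_mx [RHS]mxE [X in _ = _ * X]mxE in h.
rewrite -h [RHS]mxE; apply: eq_bigr => j _; congr (_ * _).
by rewrite [RHS]mxE; apply: eq_bigr => k _; rewrite [X in _ = _ * X]mxE.
Qed.

Lemma dhomog_comp (m k D : nat) (L : m.-tuple {mpoly int[k]}) (P : {mpoly int[m]}) :
  P \is D.-homog -> (forall i, tnth L i \is 1.-homog) -> P \mPo L \is D.-homog.
Proof.
move=> /dhomogP hP hL; rewrite comp_mpolyEX big_seq; apply: rpred_sum => a /hP da.
have {da}<- : mdeg a = D := da.
apply: rpredZ; rewrite comp_mpolyX mdegE.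
elim/big_rec2: _ => [|i p q _ ih]; first exact: dhomog1.
by apply: dhomogM => //; rewrite -[X in X.-homog]mul1n; exact: dhomogMn.
Qed.

Lemma clear_denominators (n : nat) (A : 'M[rat]_n) :
  exists (mu : int) (B : 'M[int]_n), mu != 0 /\ map_mx intr B = mu%:~R *: A.
Proof.
pose mu := \prod_(u : 'I_n * 'I_n) denq (A u.1 u.2).
exists mu, (\matrix_(i, j) (numq (A i j) *
  \prod_(u : 'I_n * 'I_n | u != (i, j)) denq (A u.1 u.2))); split.
  by rewrite prodf_seq_neq0; apply/allP => u _ /=; exact: denq_neq0.
apply/matrixP => i j; rewrite !mxE /mu [in RHS](bigD1 (i, j)) //= !intrM.
rewrite mulrAC; congr (_ * _).
by rewrite -{3}[A i j]divq_num_den mulrCA divff ?mulr1 // intr_eq0 denq_neq0.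
Qed.

Lemma mmap_comp (R S : comNzRingType) (f : {rmorphism R -> S}) (m k : nat) (v : 'I_k -> S)
    (L : m.-tuple {mpoly R[k]}) (P : {mpoly R[m]}) :
  mmap f v (P \mPo L) = mmap f (fun i => mmap f v (tnth L i)) P.
Proof.
rewrite /comp_mpoly [mmap _ _ P]/mmap raddf_sum /= [RHS]/mmap.
apply: eq_bigr => a _; rewrite rmorphM /= mmapC; congr (_ * _).
by rewrite /mmap1 rmorph_prod; apply: eq_bigr => i _; rewrite rmorphXn.
Qed.

Lemma mmap_map (R : comNzRingType) (m : nat) (f : {rmorphism rat -> R}) (v : 'I_m -> R)
   (P : {mpoly int[m]}) : mmap f v (map_mpoly (intr : int -> rat) P) = ev v P.
Proof.
rewrite [map_mpoly _ _]/mmap raddf_sum /= evE; apply: eq_bigr => a _.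
rewrite rmorphM; congr (_ * _).
  exact: (etrans (mmapC _ _ _) (rmorph_int f _)).
rewrite /mmap1 rmorph_prod; apply: eq_bigr => i _.
rewrite rmorphXn; congr (_ ^+ _).
exact: (etrans (mmapX _ _ _) (mmap1U _ _)).
Qed.

Lemma integral_equiv (n : nat) (Q : {mpoly int[n.+1]}) (c : rat) (d : int) :
  (3 <= n)%N -> Q \is 2.-homog -> c != 0 ->
  equiv_over_rat (map_mpoly (intr : int -> rat) Q) (c *: model_form n d) ->
  exists (B : 'M[int]_n.+1) (c' : algC), [/\ \det B != 0, c' != 0 &
    forall v : 'I_n.+1 -> algC, ev (lin (fun i j => (B i j)%:~R) v) Q =
      c' * (v (inord 0) * v (inord 1) - nrm d (v (inord 2)) (v (inord 3)))].
Proof.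
move=> n3 hQ c0 [A uA hA].
have [mu [B [mu0 BE]]] := clear_denominators A.
have muC : (mu%:~R : algC) != 0 by rewrite intr_eq0.
exists B, (mu%:~R ^+ 2 * ratr c); split.
- have : \det (map_mx (intr : int -> rat) B) != 0.
    by rewrite BE detZ mulf_neq0 ?expf_neq0 ?intr_eq0.
  by rewrite det_map_mx intr_eq0.
- by rewrite mulf_neq0 ?expf_neq0 // fmorph_eq0.
move=> v; pose phi : {rmorphism {mpoly rat[n.+1]} -> algC} := mmap (ratr : rat -> algC) v.
have phiX i : phi 'X_i = v i by rewrite /phi /= mmapX mmap1U.
have phiZ b p : phi (b *: p) = ratr b * phi p := mmapZ _ _ _ _.
have e1 : phi (lin_subst A (map_mpoly intr Q)) =
    ev (fun i => \sum_j ratr (A i j) * v j) Q.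
  rewrite [LHS](mmap_comp (ratr : {rmorphism rat -> algC})).
  rewrite [LHS](mmap_map (ratr : {rmorphism rat -> algC})); apply: eq_ev => i.
  rewrite tnth_mktuple -/(phi _) rmorph_sum; apply: eq_bigr => j _.
  by rewrite phiZ phiX.
have e2 : ev (lin (fun i j => (B i j)%:~R) v) Q =
    mu%:~R ^+ 2 * ev (fun i => \sum_j ratr (A i j) * v j) Q.
  rewrite -(ev_homog_scale _ _ hQ); apply: eq_ev => i.
  rewrite /lin mulr_sumr; apply: eq_bigr => j _; rewrite mulrA; congr (_ * _).
  have := congr1 (fun C : 'M[rat]_n.+1 => ratr (C i j) : algC) BE.
  by rewrite !mxE rmorphM !rmorph_int.
rewrite e2 -e1 hA phiZ [LHS]mulrA; congr (_ * _).
rewrite /model_form rmorphB rmorphM !phiX rmorphB phiZ !rmorphXn !phiX rmorph_int /nrm.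
by [].
Qed.

Lemma dhomog_map_algC (m D : nat) (P : {mpoly int[m]}) :
  P \is D.-homog -> map_mpoly (intr : int -> algC) P \is D.-homog.
Proof.
move=> /dhomogP hP; apply/dhomogP => a; rewrite mcoeff_msupp mcoeff_map_mpoly => ca.
by apply: hP; rewrite mcoeff_msupp; apply: contraNneq ca => ->.
Qed.

Section Variety.
Variables (n r : nat) (Q : {mpoly int[n.+1]}) (F : 'I_r -> {mpoly int[n.+1]}).

Definition in_variety (x : 'I_n.+1 -> algC) : Prop :=
  [/\ exists i, x i != 0, ev x Q = 0 & forall i, ev x (F i) = 0].

Lemma variety_small_locus : (0 < n)%N -> Q \is 2.-homog -> (forall i, is_form (F i)) ->
  proj_codim_ge 3 (variety Q F) -> small_locus in_variety.
Proof.
move=> n0 hQ hF hc l.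
have Zc : proj_closed (variety Q F).
  exists [set f | f = map_mpoly (intr : int -> algC) Q \/
      exists i, f = map_mpoly (intr : int -> algC) (F i)]%classic => //.
  move=> f [->|[i ->]]; first by exists 2; exact: dhomog_map_algC.
  by have [D hD] := hF i; exists D; exact: dhomog_map_algC.
have [P P0 PZ] := codim3_alg_dep l n0 Zc hc.
exists P => // x [[i xi] xQ xF].
have xE (H : {mpoly algC[n.+1]}) : H.@[(\row_i x i) 0] = H.@[x].
  by apply: meval_eq => j; rewrite mxE.
rewrite -(PZ (\row_i x i)); first by apply: meval_eq => j; rewrite xE.
split.
  by apply: contraNneq xi => /rowP/(_ i); rewrite !mxE => ->.
move=> f [->|[j ->]]; rewrite xE meval_map_ev //.
Qed.

End Variety.

Section Reduction.
Variables (n r : nat) (Q : {mpoly int[n.+1]}) (F : 'I_r -> {mpoly int[n.+1]}) (d : int).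
Variables (B : 'M[int]_n.+1) (c' : algC).
Hypothesis n3 : (3 <= n)%N.
Hypothesis hQ : Q \is 2.-homog.
Hypothesis detB : \det B != 0.
Hypothesis c'0 : c' != 0.
Hypothesis hB : forall v : 'I_n.+1 -> algC, ev (lin (fun i j => (B i j)%:~R) v) Q =
  c' * (v (inord 0) * v (inord 1) - nrm d (v (inord 2)) (v (inord 3))).
Variable df : 'I_r -> nat.
Hypothesis hF : forall i, F i \is (df i).-homog.
Hypothesis small : small_locus (in_variety Q F).

Definition form_deg : nat := \sum_i df i.
(* Multiplying by powers of all variables makes the degrees equal without
   changing the common zeros. *)
Definition padded (u : 'I_r * 'I_n.+1) : {mpoly int[n.+1]} :=
  F u.1 * 'X_(u.2) ^+ (form_deg.+1 - df u.1).

Lemma padded_homog u : padded u \is form_deg.+1.-homog.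
Proof.
have le : (df u.1 <= form_deg)%N by rewrite /form_deg (bigD1 u.1) //= leq_addr.
rewrite -[X in X.-homog](subnKC (leqW le)); apply: dhomogM => //.
rewrite -[X in X.-homog]mul1n; apply: dhomogMn.
by rewrite dhomogX; apply/eqP; exact: mdeg1.
Qed.

Lemma ev_padded (R : comNzRingType) (x : 'I_n.+1 -> R) u :
  ev x (padded u) = ev x (F u.1) * x u.2 ^+ (form_deg.+1 - df u.1).
Proof. by rewrite /padded evM evX evXU. Qed.

(** The image of the apex under the shear by [kap], as in [shear_apex]; these points fill the chart
    y1 = 1 of the model quadric. *)
Definition conic_point (R : comNzRingType) (kap : 'I_n.+1 -> R) : 'I_n.+1 -> R :=
  coords (nrm d (kap (inord 2)) (kap (inord 3))) 1 (kap (inord 2)) (kap (inord 3)) kap.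

Lemma inord_shift_lt (i : 'I_n.-1) : (i.+2 < n.+1)%N.
Proof. by have := ltn_ord i; lia. Qed.

(** Otherwise the forms vanish at all integral points of the chart y1 = 1, hence identically in
    [kap], hence at all its algebraic points. But there the n - 1 coordinates 2, ..., n are free,
    against [small]. *)
Lemma exists_good_shift : exists (kap : 'I_n.+1 -> int) u,
  ev (lin B (conic_point kap)) (padded u) != 0.
Proof.
apply: contrapT => no.
have all0 (kap : 'I_n.+1 -> int) u : ev (lin B (conic_point kap)) (padded u) = 0.
  by apply/eqP; apply: contraT => ne; exfalso; apply: no; exists kap, u.
pose L i : {mpoly int[n.+1]} := lin (fun i j => (B i j)%:~R)
  (conic_point (fun i => 'X_i)) i.
have evL (R : comNzRingType) (kap : 'I_n.+1 -> R) i :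
    ev kap (L i) = lin (fun i j => (B i j)%:~R) (conic_point kap) i.
  pose phi : {rmorphism {mpoly int[n.+1]} -> R} := mmap intr kap.
  have phiX j : phi 'X_j = kap j := evXU kap j.
  rewrite [LHS](lin_morph phi); apply: eq_lin => [j k|j]; first exact: (rmorph_int phi).
  rewrite /conic_point coords_comp (nrm_morph phi) rmorph1 !phiX /coords.
  by case: (val j) => [|[|[|[|k]]]] //; rewrite /= phiX.
have R0 u : padded u \mPo [tuple L i | i < n.+1] = 0.
  apply/eqP; apply: contraT => /mpoly_nonzero_point[kap].
  rewrite -ev_int ev_comp => /eqP; case.
  rewrite -(all0 kap u); apply: eq_ev => i; rewrite tnth_mktuple evL.
  by apply: eq_lin => // j k; rewrite intz.
have all0C (kap : 'I_n.+1 -> algC) u :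
    ev (lin (fun i j => (B i j)%:~R) (conic_point kap)) (padded u) = 0.
  have := congr1 (ev kap) (R0 u); rewrite ev0 ev_comp => h; rewrite -[RHS]h.
  by apply: eq_ev => i; rewrite tnth_mktuple evL.
pose BC : 'M[algC]_n.+1 := map_mx intr B.
have detC : \det BC != 0 by rewrite det_map_mx intr_eq0.
pose l (i : 'I_n.-1) : {mpoly algC[n.+1]} := \sum_j (\adj BC) (inord i.+2) j *: 'X_j.
have [P P0 PZ] := small l.
have [o /eqP[]] := mpoly_nonzero_point P0.
have i0P : (0 < n.-1)%N by lia.
(* The adjugate recovers the conic point only up to [\det BC]; dividing by it beforehand makes the
   values of the [l i] at [x] equal to [o], where [P] does not vanish. *)
pose kap (j : 'I_n.+1) : algC := (\det BC)^-1 * o (insubd (Ordinal i0P) (j - 2)%N).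
pose x := lin BC (conic_point kap).
have adjx i : lin (\adj BC) x i = \det BC * conic_point kap i by rewrite adj_lin.
have xB : x =1 lin (fun i j => (B i j)%:~R) (conic_point kap).
  by apply: eq_lin => // i j; rewrite mxE.
rewrite -(PZ x); last first.
  have xnz : exists i, x i != 0.
    apply: contrapT => /forallNP nz; case/eqP: detC.
    have h := adjx (inord 1); rewrite /conic_point coords1 // mulr1 in h; rewrite -h.
    by rewrite /lin big1 // => j _; have /negP := nz j; rewrite negbK => /eqP->; rewrite mulr0.
  split=> //.
    rewrite (eq_ev _ xB) hB /conic_point coords0 // coords1 // coords2 // coords3 //.
    by rewrite mulr1 subrr mulr0.
  move=> i; have [j xj] := xnz.
  have := all0C kap (i, j); rewrite -(eq_ev _ xB) ev_padded /= => /eqP.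
  by rewrite mulf_eq0 expf_eq0 (negPf xj) andbF orbF => /eqP.
apply: meval_eq => i; rewrite /l raddf_sum /=.
transitivity (lin (\adj BC) x (inord i.+2)); last first.
  by apply: eq_bigr => j _; rewrite mevalZ mevalXU.
rewrite adjx /conic_point.
have lt := inord_shift_lt i.
have kapE (j : 'I_n.+1) : val j = i.+2 -> \det BC * kap j = o i.
  move=> je; rewrite /kap mulrA divff // mul1r; congr o; apply: val_inj.
  by rewrite val_insubd /= je subn2 /= ltn_ord.
rewrite /coords /= inordK //; case E : (nat_of_ord i) => [|[|k]] /=.
- by rewrite kapE //= inordK ?E //; lia.
- by rewrite kapE //= inordK ?E //; lia.
- by rewrite kapE //= E inordK // -E.
Qed.

Variable kap : 'I_n.+1 -> int.

(* Pulled back so that the point B (conic_point kap) of Q = 0 becomes the apex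
   (0, 1, 0, ...). *)
Definition moved (k : 'I_#|{: 'I_r * 'I_n.+1}|) : {mpoly int[n.+1]} :=
  padded (enum_val k) \mPo [tuple lin (fun i j => (B i j)%:~R)
    (shear d (fun i => (kap i)%:~R) (fun i => 'X_i)) i | i < n.+1].

Lemma ev_moved (R : comNzRingType) (y : 'I_n.+1 -> R) k : ev y (moved k) =
  ev (lin (fun i j => (B i j)%:~R) (shear d (fun i => (kap i)%:~R) y)) (padded (enum_val k)).
Proof.
rewrite ev_comp; apply: eq_ev => i; rewrite tnth_mktuple.
pose phi : {rmorphism {mpoly int[n.+1]} -> R} := mmap intr y.
rewrite [LHS](lin_morph phi); apply: eq_lin => [j j'|j]; first exact: (rmorph_int phi).
rewrite [LHS](shear_morph phi); apply: eq_shear => j'; first exact: (rmorph_int phi).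
exact: (evXU y j').
Qed.

Lemma moved_homog k : moved k \is form_deg.+1.-homog.
Proof.
apply: dhomog_comp; first exact: padded_homog.
move=> i; rewrite tnth_mktuple; apply: rpred_sum => j _; rewrite mulrzl; apply: rpredMz.
have X1 (t : 'I_n.+1) : ('X_t : {mpoly int[n.+1]}) \is 1.-homog.
  by rewrite dhomogX; apply/eqP; exact: mdeg1.
rewrite /shear -(nrm_morph (intr : {rmorphism int -> {mpoly int[n.+1]}})) -intrM.
rewrite !mulrzl mulr_natl /coords.
case: (val j) => [|[|[|[|t]]]] //; rewrite ?mulrzl; apply: rpredD => //;
  try exact: rpredMz.
  by apply: rpredD => //; exact: rpredMz.
by apply: rpredMn; apply: rpredB; exact: rpredMz.
Qed.

Lemma moved_gam : (exists u, ev (lin B (conic_point kap)) (padded u) != 0) ->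
  exists t0, gam (comb moved t0) != 0.
Proof.
move=> [u uP].
pose f : {poly int} := \poly_(k < #|{: 'I_r * 'I_n.+1}|)
  (if insub k is Some k' then ev (apex int n) (moved k') else 0).
have f0 : f != 0.
  apply: contraNneq uP => /(congr1 (fun p : {poly int} => p`_(enum_rank u))).
  rewrite coef0 coef_poly ltn_ord valK ev_moved enum_rankK => h.
  apply/eqP; rewrite -[RHS]h.
  apply: eq_ev => i; apply: eq_lin => [j k|j]; first by rewrite intz.
  rewrite /conic_point -(shear_apex d kap n3 j); apply: eq_shear => // t; by rewrite intz.
have [t0 _ ht] := poly_nonzero_nat f0.
by exists t0; rewrite /gam ev_comb.
Qed.

(** A family on the new cone is composed with the inverse change of variables [back], which is
    polynomial over the algebraic numbers; its relation on the original variety is then the one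
    sought. *)
Lemma moved_small : small_locus (cone_locus d moved).
Proof.
move=> l; pose BC : 'M[algC]_n.+1 := map_mx intr B.
have detC : \det BC != 0 by rewrite det_map_mx intr_eq0.
pose kC (i : 'I_n.+1) : algC := (kap i)%:~R.
pose back (x : 'I_n.+1 -> algC) := shear d (fun i => - kC i)
  (fun i => (\det BC)^-1 * lin (\adj BC) x i).
pose backX (i : 'I_n.+1) : {mpoly algC[n.+1]} := shear d (fun i => (- kC i)%:MP)
  (fun i => (\det BC)^-1%:MP * lin (fun i j => ((\adj BC) i j)%:MP) (fun j => 'X_j) i) i.
have backE x i : (backX i).@[x] = back x i.
  pose phi : {rmorphism {mpoly algC[n.+1]} -> algC} := meval x.
  have phiC (b : algC) : phi b%:MP = b := mevalC x b.
  have phiX j : phi 'X_j = x j := mevalXU x j.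
  rewrite [LHS](shear_morph phi); apply: eq_shear => j; first exact: phiC.
  rewrite /= rmorphM (lin_morph phi); congr (_ * _); first exact: phiC.
  by apply: eq_lin => [k k'|k]; [exact: phiC|exact: phiX].
have [P P0 PZ] := small (fun i => l i \mPo [tuple backX j | j < n.+1]).
exists P => // v [[i0 vi0] hv vG].
pose x := lin (fun i j => (B i j)%:~R) (shear d kC v).
have xE : x =1 lin BC (shear d kC v) by apply: eq_lin => // i j; rewrite mxE.
have backx : back x =1 v.
  move=> i; rewrite -[RHS](shearK d kC v n3 i); apply: eq_shear => // j.
  rewrite (eq_lin (fun _ _ => erefl) xE) adj_lin mulrA mulVf // mul1r.
  by [].
rewrite -[RHS](PZ x).
  apply: meval_eq => i; rewrite comp_mpoly_meval; apply: meval_eq => j.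
  by rewrite tnth_mktuple backE backx.
have xnz : exists i, x i != 0.
  apply: contrapT => /forallNP nz.
  have x0 i : x i = 0 by have /negP := nz i; rewrite negbK => /eqP.
  case/eqP: vi0; rewrite -backx /back.
  have z0 i : (\det BC)^-1 * lin (\adj BC) x i = 0.
    by rewrite /lin big1 ?mulr0 // => j _; rewrite x0 mulr0.
  by rewrite /shear /coords !z0; case: (val i0) => [|[|[|[|k]]]]; ring.
split=> //.
  rewrite hB; have := shear_model kC n3 hv; rewrite /on_model => ->.
  by rewrite subrr mulr0.
move=> i; have [j xj] := xnz.
have := vG (enum_rank (i, j)); rewrite ev_moved enum_rankK -/kC -/x ev_padded /= => /eqP.
by rewrite mulf_eq0 expf_eq0 (negPf xj) andbF orbF => /eqP.
Qed.

(** The adjugate stands for the inverse so that the image stays integral. The resulting factor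
    [\det B] is harmless, as all conditions are homogeneous. *)
Definition to_model (x : 'rV[int]_n.+1) : 'rV[int]_n.+1 :=
  \row_i shear d (fun i => - kap i) (lin (\adj B) (x 0)) i.

Lemma to_modelK x : lin B (shear d kap (to_model x 0)) =1 (fun i => \det B * x 0 i).
Proof.
move=> i; rewrite -lin_adj; apply: eq_lin => // j.
rewrite -[RHS](shearK d (fun i => - kap i) (lin (\adj B) (x 0)) n3 j).
apply: eq_shear => k; first by rewrite opprK.
by rewrite mxE.
Qed.

Lemma to_model_inj : injective to_model.
Proof.
move=> x x' xx'; apply/rowP => i; apply: (mulfI detB).
by rewrite -to_modelK xx' to_modelK.
Qed.

Lemma to_model_on (x : 'rV[int]_n.+1) : Q.@[x 0] = 0 -> on_model d (to_model x 0).
Proof.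
move=> Qx.
have h : on_model d (lin (\adj B) (x 0)).
  pose y := lin (\adj B) (x 0).
  pose yC (i : 'I_n.+1) : algC := (y i)%:~R.
  have e : ev (lin (fun i j => (B i j)%:~R) yC) Q = 0.
    have -> : ev (lin (fun i j => (B i j)%:~R) yC) Q =
        (ev (fun i => \det B * x 0 i) Q)%:~R.
      rewrite (ev_morph (intr : {rmorphism int -> algC})); apply: eq_ev => i.
      rewrite /= -lin_adj -/y.
      by rewrite [RHS](lin_morph (intr : {rmorphism int -> algC})).
    by rewrite (ev_homog_scale _ _ hQ) ev_int Qx mulr0.
  move: e; rewrite hB => /eqP; rewrite mulf_eq0 (negPf c'0) /= /yC.
  rewrite -(nrm_morph (intr : {rmorphism int -> algC})) -intrM -rmorphB intr_eq0 subr_eq0.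
  by move=> /eqP.
have := shear_model (fun i => - kap i) n3 h.
by rewrite /on_model /to_model !mxE.
Qed.

Lemma to_model_dvd (x : 'rV[int]_n.+1) (p : int) :
  (forall i, (p %| (F i).@[x 0%R])%Z) -> forall k, (p %| ev (to_model x 0%R) (moved k))%Z.
Proof.
move=> pF k; rewrite ev_moved.
have -> : ev (lin (fun i j => (B i j)%:~R)
    (shear d (fun i => (kap i)%:~R) (to_model x 0))) (padded (enum_val k)) =
  ev (fun i => \det B * x 0 i) (padded (enum_val k)).
  apply: eq_ev => i; rewrite -to_modelK; apply: eq_lin => [j j'|j]; first by rewrite intz.
  by apply: eq_shear => // j'; rewrite intz.
rewrite (ev_homog_scale _ _ (padded_homog _)) ev_padded dvdz_mull // dvdz_mulr //.
by rewrite ev_int.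
Qed.

Lemma to_model_bound : exists2 C : nat, (0 < C)%N & forall (N : nat) (x : 'rV[int]_n.+1),
  (forall i, (`|x 0%R i| <= N)%N) -> forall i, (`|to_model x 0%R i| <= C * N)%N.
Proof.
pose C1 := (\sum_i \sum_j `|(\adj B) i j|)%N.
pose C2 := (2 + `|nrm d (- kap (inord 2)) (- kap (inord 3))| + 2 * `|kap (inord 2)| +
  2 * `|(d * kap (inord 3))%R| + \sum_i `|kap i|)%N.
exists (C2 * C1 + 1)%N; first by rewrite addn1.
move=> N x xN i.
have linN j : (`|lin (\adj B) (x 0%R) j| <= C1 * N)%N.
  apply: (@leq_trans ((\sum_k `|(\adj B) j k|) * N)%N); last first.
    by rewrite leq_mul2r /C1 [X in (_ <= X)%N](bigD1 j) //= leq_addr orbT.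
  rewrite /lin big_distrl /=.
  elim/big_rec2: _ => [|k s z _ ih]; first by rewrite absz0.
  have : (`|((\adj B) j k * x 0 k)%R| <= `|(\adj B) j k| * N)%N by rewrite abszM leq_mul.
  by move: ih; move: (_ * _)%R (_ * _)%N => u v; clear; lia.
apply: (@leq_trans (C2 * (C1 * N))%N); last by rewrite [leqRHS]mulnDl mulnA leq_addr.
rewrite mxE; move: (lin _ _) linN => y; move: (C1 * N)%N => N' yN.
have kN j : (`|kap j| <= \sum_i `|kap i|)%N by rewrite (bigD1 j) //= leq_addr.
have prod (z : int) j : (`|(z * y j)%R| <= `|z| * N')%N by rewrite abszM leq_mul.
have y0 := yN (inord 0); have y1 := yN (inord 1).
have y2 := yN (inord 2); have y3 := yN (inord 3).
have p1 := prod (nrm d (- kap (inord 2)) (- kap (inord 3))) (inord 1).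
have p2 := prod (kap (inord 2)) (inord 2).
have p3 := prod (d * kap (inord 3)) (inord 3).
have q j := leq_trans (prod (kap j) (inord 1)) (leq_mul (kN j) (leqnn N')).
have q2 := q (inord 2); have q3 := q (inord 3); have qi := q i; have yi := yN i.
have -> : (C2 * N' = 2 * N' + `|nrm d (- kap (inord 2)) (- kap (inord 3))| * N' +
   2 * (`|kap (inord 2)| * N') + 2 * (`|(d * kap (inord 3))%R| * N') +
   (\sum_i `|kap i|) * N')%N by rewrite /C2 4!mulnDl -!mulnA.
move: p1 p2 p3 q2 q3 qi.
move: (`|nrm d (- kap (inord 2)) (- kap (inord 3))| * N')%N (`|kap (inord 2)| * N')%N
  (`|(d * kap (inord 3))%R| * N')%N ((\sum_i `|kap i|) * N')%N => a b e f p1 p2 p3 q2 q3 qi.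
rewrite /shear /coords /= intz; case: (nat_of_ord i) => [|[|[|[|t]]]].
- have -> : 2 * (- kap (inord 2) * y (inord 2) - d * - kap (inord 3) * y (inord 3)) =
    - (2 * (kap (inord 2) * y (inord 2))) + 2 * (d * kap (inord 3) * y (inord 3)) by ring.
  by move: y0 p1 p2 p3; clear; lia.
- by move: y1; clear; lia.
- by rewrite mulNr; move: y2 q2; clear; lia.
- by rewrite mulNr; move: y3 q3; clear; lia.
- by rewrite mulNr; move: yi qi; clear; lia.
Qed.

End Reduction.

(** * Return to the given quadric and the final bound *)

(** A prime p > M also exceeds any M' <= M; this freedom lets the theorem use min(M, B) as the
    sieving level. [C] bounds the growth of coordinates under [to_model]. *)
Lemma sieve_count_le (R : realType) (n r : nat) (Q : {mpoly int[n.+1]})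
    (F : 'I_r -> {mpoly int[n.+1]}) (eta : R) :
  (3 <= n)%N -> Q \is 2.-homog ->
  (exists (c : rat) (d : int), [/\ c != 0, ~ (exists m : int, d = m ^+ 2) &
     equiv_over_rat (map_mpoly (intr : int -> rat) Q) (c *: model_form n d)]) ->
  (forall i : 'I_r, is_form (F i)) -> proj_codim_ge 3 (variety Q F) -> 0 < eta ->
  exists2 K : R, 0 <= K & forall B M M' : R, 1 <= B -> 1 <= M' -> M' <= M ->
    (sieve_count Q F B M)%:R <=
    K * B `^ eta * (B ^+ (n - 1) / M' + B ^+ (n - 2) * Num.sqrt B).
Proof.
move=> n3 hQ [c [d [c0 nsq eqv]]] hF hcodim eta0.
have n0 : (0 < n)%N by lia.
have [A [c' [detA c'0 hA]]] := integral_equiv n3 hQ c0 eqv.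
have [df hdf] := choice hF.
have small := variety_small_locus n0 hQ hF hcodim.
have [kap kapP] := exists_good_shift n3 hQ detA c'0 hA df small.
have [t0 g0] := moved_gam n3 kapP.
have hG := moved_homog d A hdf kap.
have smallG := moved_small n3 detA hA df small kap.
have [K K0 KP] := model_count n3 nsq hG g0 smallG eta0.
have [C C0 CP] := @to_model_bound n d A kap.
have CR : 1 <= C%:R :> R by rewrite ler1n.
exists (K * C%:R `^ eta * C%:R ^+ (n - 1)).
  by rewrite mulr_ge0 ?exprn_ge0 // mulr_ge0 // powR_ge0.
move=> B M M' B1 M'1 M'M.
have B0 : 0 <= B by lra.
have M'0 : 0 < M' by lra.
pose b := Num.truncn B.
have b1 : (0 < b)%N by rewrite truncn_ge_nat.
have bB : b%:R <= B by rewrite truncn_le.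
pose N := (C * b)%N.
have N0 : (0 < N)%N by rewrite muln_gt0 C0.
have h := KP N M' N0 M'1.
set W := _ * _ in h.
have hs : count_le (sieve_set Q F B M) W.
  apply: (@sum_le_inj _ _ _ _ _ (to_model d A kap) _ (fun=> 1) _ _ _ _ h) => //.
  - move=> x [Qx xB [p [pp Mp pF]]]; split.
      split; last exact: (to_model_on n3 hQ c'0 hA).
      apply: CP => i; apply: leq_trans (_ : supnorm x <= b)%N; first exact: (leq_bigmax i).
      by rewrite truncn_ge_nat.
    exists p; split=> //; first exact: le_lt_trans Mp.
    by move=> k; exact: (to_model_dvd d A n3 hdf kap pF k).
  - by move=> x y _ _; exact: (to_model_inj n3 detA).
have fin := finite_sieve_set Q F B M.
have cnt : (sieve_count Q F B M)%:R <= W.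
  rewrite /sieve_count; apply: (count_leE hs); first exact: fset_uniq.
  by move=> x; rewrite in_fset_set // inE.
apply: (le_trans cnt); rewrite /W.
have CB1 : 1 <= C%:R * B by rewrite -[leLHS]mulr1; apply: ler_pM.
have NR : 0 <= N%:R :> R by [].
have NCB : N%:R <= C%:R * B by rewrite /N natrM; apply: ler_wpM2l.
have CB0 : 0 <= C%:R * B by lra.
have e1 : N%:R `^ eta <= C%:R `^ eta * B `^ eta.
  rewrite -powRM //; apply: ge0_ler_powR; rewrite ?nnegrE //; exact: ltW.
have e2 : N%:R ^+ (n - 3) * (N%:R ^+ 2 / M' + N%:R * Num.sqrt N%:R) <=
    C%:R ^+ (n - 1) * (B ^+ (n - 1) / M' + B ^+ (n - 2) * Num.sqrt B).
  have p1 k : N%:R ^+ k <= (C%:R * B) ^+ k by apply: lerXn2r.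
  have sN : Num.sqrt N%:R <= C%:R * Num.sqrt B.
    apply: (@le_trans _ _ (Num.sqrt (C%:R * B))); first exact: ler_wsqrtr.
    rewrite sqrtrM //; apply: ler_wpM2r; first exact: sqrtr_ge0.
    have -> : C%:R = Num.sqrt (C%:R ^+ 2) :> R by rewrite sqrtr_sqr ger0_norm.
    by rewrite ler_wsqrtr // sqrtr_sqr ger0_norm // expr2 ler_peMr.
  have -> : C%:R ^+ (n - 1) * (B ^+ (n - 1) / M' + B ^+ (n - 2) * Num.sqrt B) =
    (C%:R * B) ^+ (n - 3) * ((C%:R * B) ^+ 2 / M' + (C%:R * B) * (C%:R * Num.sqrt B)).
    have -> : (n - 1 = n - 3 + 2)%N by clear - n3; lia.
    have -> : (n - 2 = n - 3 + 1)%N by clear - n3; lia.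
    move: (n - 3)%N (C%:R) (Num.sqrt B) (M'^-1) => k x y z.
    by rewrite exprMn !exprD; ring.
  apply: ler_pM; rewrite ?exprn_ge0 // ?p1 //.
    apply: addr_ge0; first by apply: divr_ge0; [exact: exprn_ge0|exact: ltW].
    by rewrite mulr_ge0 // sqrtr_ge0.
  apply: lerD.
    by apply: ler_wpM2r; [rewrite invr_ge0 ltW|exact: p1].
  by apply: ler_pM => //; exact: sqrtr_ge0.
have -> : K * C%:R `^ eta * C%:R ^+ (n - 1) * B `^ eta *
   (B ^+ (n - 1) / M' + B ^+ (n - 2) * Num.sqrt B) =
   K * (C%:R `^ eta * B `^ eta) * (C%:R ^+ (n - 1) *
     (B ^+ (n - 1) / M' + B ^+ (n - 2) * Num.sqrt B)) by ring.
apply: ler_pM => //.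
- by rewrite mulr_ge0 // powR_ge0.
- apply: mulr_ge0; first exact: exprn_ge0.
  apply: addr_ge0; first by apply: divr_ge0; [exact: exprn_ge0|exact: ltW].
  by rewrite mulr_ge0 // sqrtr_ge0.
- exact: ler_wpM2l.
Qed.

Theorem theorem1p3 (R : realType) (n r : nat) (hn : (3 <= n)%N)
    (Q : {mpoly int[n.+1]}) (F : 'I_r -> {mpoly int[n.+1]})
    (hQ : Q \is 2.-homog)
    (hQequiv : exists (c : rat) (d : int),
       [/\ c != 0, ~ (exists m : int, d = m ^+ 2) &
           equiv_over_rat (map_mpoly (intr : int -> rat) Q)
                          (c *: model_form n d)])
    (hF : forall i : 'I_r, is_form (F i))
    (hcodim : proj_codim_ge 3 (variety Q F))
    (eps : R) (heps : 0 < eps) :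
  exists k : R, forall B M : R, 1 <= B -> 1 < M ->
    (sieve_count Q F B M)%:R <=
      k * (B `^ (n%:R - 1 + eps) / (M * ln M) + B `^ (n%:R - 3 / 2 + eps)).
(* Half of eps pays for the divisor bounds, the other half for log M. *)
pose eta := eps / 2.
have eta0 : 0 < eta by rewrite divr_gt0.
have [K K0 KP] := sieve_count_le hn hQ hQequiv hF hcodim eta0.
exists (K * (eta^-1 + 2)) => B M B1 M1.
have B0 : 0 < B by lra.
have Bn0 : B != 0 by rewrite gt_eqF.
have M0 : 0 < M by lra.
have lnM : 0 < ln M by exact: ln_gt0.
set S := B `^ (n%:R - 3 / 2 + eps).
have S0 : 0 <= S by exact: powR_ge0.
set L := B `^ (n%:R - 1 + eps) / (M * ln M).
have L0 : 0 <= L by apply: divr_ge0; [exact: powR_ge0|rewrite mulr_ge0 // ltW].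
have i0 : 0 <= eta^-1 by rewrite invr_ge0 ltW.
have Beta : 0 <= B `^ eta by exact: powR_ge0.
have addpow x y : B `^ x * B `^ y = B `^ (x + y) by rewrite powRD // Bn0 implybT.
have n1E : B ^+ (n - 1) = B `^ (n%:R - 1).
  by rewrite -powR_mulrn ?ltW // natrB // (leq_trans _ hn).
have n2E : B ^+ (n - 2) * Num.sqrt B = B `^ (n%:R - 3 / 2).
  rewrite -powR_mulrn ?ltW // -powR12_sqrt ?ltW // addpow natrB ?(leq_trans _ hn) //.
  by congr (_ `^ _); field.
have Sle : B `^ eta * B `^ (n%:R - 3 / 2) <= S.
  rewrite addpow; apply: ler_powR => //.
  by rewrite addrC lerD2l /eta; lra.
have KS : 0 <= K * S by rewrite mulr_ge0.
have KL : 0 <= K * L by rewrite mulr_ge0.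
have iKS : 0 <= eta^-1 * (K * S) by rewrite mulr_ge0.
have -> : K * (eta^-1 + 2) * (L + S) =
  K * (eta^-1 * L) + 2 * (K * L) + eta^-1 * (K * S) + 2 * (K * S) by ring.
have [MB|BM] := lerP M B.
  have le := KP B M M B1 (ltW M1) (lexx M).
  rewrite n1E n2E in le.
  have Lle : B `^ eta * (B `^ (n%:R - 1) / M) <= eta^-1 * L.
    have lnB : ln M <= eta^-1 * B `^ eta.
      apply: le_trans (ln_le_powR eta0 B0); rewrite ler_ln ?posrE //.
    have -> : eta^-1 * L = B `^ eta * (B `^ (n%:R - 1) / M) * (eta^-1 * B `^ eta / ln M).
      have -> : L = B `^ eta * B `^ eta * B `^ (n%:R - 1) / (M * ln M).
        rewrite /L !addpow; congr (_ `^ _ / _).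
        by rewrite /eta; field.
      by field; rewrite !gt_eqF.
    apply: ler_peMr; last by rewrite ler_pdivlMr // mul1r.
    by rewrite mulr_ge0 // divr_ge0 ?powR_ge0 // ltW.
  have le' : K * (B `^ eta) * (B `^ (n%:R - 1) / M + B `^ (n%:R - 3 / 2)) <=
      K * (eta^-1 * L) + K * S.
    by rewrite -mulrA -mulrDr; apply: ler_wpM2l => //; rewrite mulrDr; apply: lerD.
  by apply: (le_trans le); apply: (le_trans le'); lra.
(* For M > B the level is lowered to B; then B^(n-1) / B is absorbed by B^(n-3/2), whence the 2 in
   the constant. *)
have le := KP B M B B1 B1 (ltW BM).
have n1B : B ^+ (n - 1) / B <= B ^+ (n - 2) * Num.sqrt B.
  have -> : (n - 1 = (n - 2).+1)%N by clear - hn; lia.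
  rewrite exprSr mulfK // ler_peMr //; first by rewrite exprn_ge0 // ltW.
  by rewrite -[leLHS]sqrtr1 ler_wsqrtr.
have iKL : 0 <= K * (eta^-1 * L) by rewrite mulr_ge0 // mulr_ge0.
apply: (@le_trans _ _ (2 * (K * S))); last by lra.
apply: (le_trans le); rewrite n2E in n1B *.
have -> : 2 * (K * S) = K * (S + S) by ring.
rewrite -mulrA; apply: ler_wpM2l => //; rewrite mulrDr; apply: lerD => //.
by apply: le_trans Sle; apply: ler_wpM2l.
Qed.
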